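(* Let $\Theta\subset\mathbb{R}^d$ be open, convex and bounded, and let $X_0,X_1,\ldots$ satisfy $$X_j=S(\vartheta,X_{j-1})+\varepsilon_j,\qquad j\ge 1,$$ where $(\varepsilon_j)_{j\ge1}$ are i.i.d. with known density $g$ and $\vartheta\in\Theta$ is unknown. Let $\ell(\vartheta,x,x')=\ln g\big(x'-S(\vartheta,x)\big)$ and let $\mathbb{I}(\vartheta)=\mathbf{E}_\vartheta\big[\dot\ell(\vartheta,X_0,X_1)\dot\ell(\vartheta,X_0,X_1)^{\mathbb{T}}\big]$ be the Fisher information matrix. Assume Conditions $\mathcal{R}$ (stated in the context) hold. Let $\frac14<\delta\le\frac12$, $N=[n^\delta]$, and let $\bar\vartheta_N$ be a preliminary estimator, i.e. a function of $X_0,\ldots,X_N$, such that $\sqrt{N}(\bar\vartheta_N-\vartheta)$ is tight uniformly on compacts $\mathbb{K}\subset\Theta$. For $s\in(\tau_\delta,1]$, $\tau_\delta=n^{-1+\delta}$, put $k=[sn]$, $$\Delta_k(\vartheta,X^k)=\frac{1}{\sqrt{k}}\sum_{j=1}^{k}\dot\ell(\vartheta,X_{j-1},X_j),$$ define the second preliminary estimator-process $$\bar\vartheta_{k,2}=\bar\vartheta_N+\frac{1}{\sqrt{k}}\,\mathbb{I}(\bar\vartheta_N)^{-1}\Delta_k(\bar\vartheta_N,X^k),\qquad k=N+1,\ldots,n,$$ and the two-step MLE-process $$\vartheta^{\star\star}_{s,n}=\bar\vartheta_{k,2}+\frac{1}{\sqrt{k}}\,\mathbb{I}(\bar\vartheta_{k,2})^{-1}\Delta_k(\bar\vartheta_{k,2},X^k).$$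 Then for every $s\in(0,1]$, as $n\to\infty$, $$\sqrt{k}\,(\vartheta^{\star\star}_{s,n}-\vartheta)\Longrightarrow\mathcal{N}\big(0,\mathbb{I}(\vartheta)^{-1}\big),$$ and this estimator is asymptotically efficient for bounded loss functions, i.e. for every $\vartheta_0\in\Theta$ and every bounded loss function $W$, $$\lim_{\rho\to0}\lim_{n\to\infty}\sup_{|\vartheta-\vartheta_0|<\rho}\mathbf{E}_\vartheta W\big(\sqrt{k}(\vartheta^{\star\star}_{s,n}-\vartheta)\big)=\mathbf{E}\,W\big(\zeta\,\mathbb{I}(\vartheta_0)^{-1/2}\big),$$ where $\zeta\sim\mathcal{N}(0,\mathbb{J})$ with $\mathbb{J}$ the $d\times d$ identity matrix.
   Context: $[a]$ denotes the integer part of $a$; a dot denotes differentiation with respect to $\vartheta$, $\mathbb{T}$ denotes transpose, and $\mathbf{P}_\vartheta,\mathbf{E}_\vartheta$ refer to the law of the process under parameter $\vartheta$. A family of random variables $\eta_n(\vartheta)$ is tight uniformly on compacts $\mathbb{K}\subset\Theta$ if for every $\varepsilon>0$ and every compact $\mathbb{K}$ there exists $C>0$ with $\sup_{\vartheta\in\mathbb{K}}\mathbf{P}_\vartheta(|\eta_n(\vartheta)|>C)\le\varepsilon$ for all $n$. A loss function $W:\mathbb{R}^d\to[0,\infty)$ is understood in the usual sense of Ibragimov–Has'minskii (e.g. $W(0)=0$, symmetric, continuous, with convex sublevel sets). Conditions $\mathcal{R}$: (1) The time series $(X_j)_{j\ge0}$ is strictly stationary and has a unique invariant distribution with density $\pi(\vartheta,x)$.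 (2) The preliminary estimator has the tightness property stated in the claim. (3) $S(\vartheta,x)$ is three times continuously differentiable in $\vartheta$, $g>0$ and $g\in\mathcal{C}^3$; the derivatives $\partial^i\ell(\vartheta,x,x')/\partial\vartheta^i$, $i=1,2,3$, satisfy $\sup_{\vartheta\in\Theta}\|\partial^i\ell(\vartheta,x,x')/\partial\vartheta^i\|\le R_i(x,x')$ with $\mathbf{E}_\vartheta|R_i(X_{j-1},X_j)|^2<C$, the constant $C>0$ not depending on $\vartheta$. (4) The law of large numbers $\frac1n\sum_{j=1}^n\dot\ell(\vartheta,X_{j-1},X_j)\dot\ell(\vartheta,X_{j-1},X_j)^{\mathbb{T}}\to\mathbb{I}(\vartheta)$ holds; the central limit theorem $\frac1{\sqrt n}\sum_{j=1}^n\dot\ell(\vartheta,X_{j-1},X_j)\Rightarrow\mathcal{N}(0,\mathbb{I}(\vartheta))$ holds; and the family $\frac1{\sqrt n}\sum_{j=1}^n[\ddot\ell(\vartheta,X_{j-1},X_j)+\mathbb{I}(\vartheta)]$ is tight uniformly on compacts $\mathbb{K}\subset\Theta$. (5) $\mathbb{I}$ is Lipschitz, $|\mathbb{I}(\vartheta_1)-\mathbb{I}(\vartheta_2)|\le L|\vartheta_1-\vartheta_2|$, and uniformly non-degenerate and bounded: $0<\inf_{\vartheta\in\Theta}\inf_{|\lambda|=1}\lambda^{\mathbb{T}}\mathbb{I}(\vartheta)\lambda$ and $\sup_{\vartheta\in\Theta}\sup_{|\lambda|=1}\lambda^{\mathbb{T}}\mathbb{I}(\vartheta)\lambda<\infty$,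 $\lambda\in\mathbb{R}^d$. *)

(* Defs.v *)
From HB Require Import structures.
From mathcomp Require Import all_boot all_order all_algebra.
From mathcomp Require Import all_classical all_reals all_analysis.
Set Implicit Arguments. Unset Strict Implicit. Unset Printing Implicit Defensive.
Import Order.TTheory GRing.Theory Num.Theory.
Import numFieldNormedType.Exports.
Local Open Scope classical_set_scope.
Local Open Scope ring_scope.

Definition uvec {R : realType} {d : nat} (i : 'I_d) : 'rV[R]_d := delta_mx 0 i.

Definition enorm {R : realType} {d : nat} (v : 'rV[R]_d) : R :=
  Num.sqrt (\sum_(i < d) v 0 i ^+ 2).

Definition convex_set_rV {R : realType} {d : nat} (A : set 'rV[R]_d) : Prop :=
  forall x y (t : R), A x -> A y -> 0 <= t <= 1 -> A ((1 - t) *: x + t *: y).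

Definition bounded_rV {R : realType} {d : nat} (A : set 'rV[R]_d) : Prop :=
  exists M : R, forall x, A x -> enorm x <= M.

Definition part {R : realType} {d : nat} (i : 'I_d) (f : 'rV[R]_d -> R)
  : 'rV[R]_d -> R := fun t => derive f t (uvec i).

Fixpoint Ck_on {R : realType} {d : nat} (k : nat) (A : set 'rV[R]_d)
  (f : 'rV[R]_d -> R) : Prop :=
  (forall t, A t -> {for t, continuous f}) /\
  match k with
  | 0 => True
  | k'.+1 => forall i : 'I_d,
      (forall t, A t -> derivable f t (uvec i)) /\ Ck_on k' A (part i f)
  end.

Fixpoint Ck_R {R : realType} (k : nat) (g : R -> R) : Prop :=
  continuous g /\
  match k with
  | 0 => True
  | k'.+1 => (forall x, derivable g x 1) /\ Ck_R k' (derive1 g)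
  end.

Definition ell {R : realType} {d : nat} (S : 'rV[R]_d -> R -> R) (g : R -> R)
  (x x' : R) : 'rV[R]_d -> R := fun t => ln (g (x' - S t x)).

Definition dl1 {R : realType} {d : nat} (S : 'rV[R]_d -> R -> R) (g : R -> R)
  (t : 'rV[R]_d) (x x' : R) : 'rV[R]_d :=
  \row_i part i (ell S g x x') t.

Definition dl2 {R : realType} {d : nat} (S : 'rV[R]_d -> R -> R) (g : R -> R)
  (t : 'rV[R]_d) (x x' : R) : 'M[R]_d :=
  \matrix_(i, j) part j (part i (ell S g x x')) t.

Definition dl3 {R : realType} {d : nat} (S : 'rV[R]_d -> R -> R) (g : R -> R)
  (t : 'rV[R]_d) (x x' : R) (i j k : 'I_d) : R :=
  part k (part j (part i (ell S g x x'))) t.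

Definition eps {R : realType} {d : nat} {dT} {T : measurableType dT}
  (S : 'rV[R]_d -> R -> R) (X : nat -> T -> R) (t : 'rV[R]_d) (j : nat) : T -> R :=
  fun w => X j w - S t (X j.-1 w).

Definition mutually_independent {R : realType} {dT} {T : measurableType dT}
  (P : probability T R) (Y : nat -> T -> R) : Prop :=
  forall (I : seq nat) (B : nat -> set R), uniq I ->
    (forall i, measurable (B i)) ->
    P (\bigcap_(i in [set` I]) (Y i @^-1` B i)) =
    (\prod_(i <- I) P (Y i @^-1` B i))%E.

Definition has_density {R : realType} {dT} {T : measurableType dT}
  (P : probability T R) (Y : T -> R) (h : R -> R) : Prop :=
  forall B : set R, measurable B ->
    P (Y @^-1` B) = (\int[lebesgue_measure]_(y in B) (h y)%:E)%E.

Definition strictly_stationary {R : realType} {dT} {T : measurableType dT}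
  (P : probability T R) (Y : nat -> T -> R) : Prop :=
  forall (m h : nat) (B : nat -> set R), (forall i, measurable (B i)) ->
    P (\bigcap_(i in `I_m.+1) (Y (h + i)%N @^-1` B i)) =
    P (\bigcap_(i in `I_m.+1) (Y i @^-1` B i)).

(** mu is an invariant distribution of the Markov kernel
    x |-> law of S(x) + eps, eps with density g *)
Definition kernel_invariant {R : realType} (Sx : R -> R) (g : R -> R)
  (mu : probability R R) : Prop :=
  forall B : set R, measurable B ->
    mu B = (\int[mu]_x (\int[lebesgue_measure]_(y in B) (g (y - Sx x))%:E))%E.

Definition fisher {R : realType} {d : nat} {dT} {T : measurableType dT}
  (P : 'rV[R]_d -> probability T R) (X : nat -> T -> R)
  (S : 'rV[R]_d -> R -> R) (g : R -> R) (t : 'rV[R]_d) : 'M[R]_d :=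
  \matrix_(i, j) fine (expectation (P t) (fun w =>
       dl1 S g t (X 0%N w) (X 1%N w) 0 i * dl1 S g t (X 0%N w) (X 1%N w) 0 j)).

Definition cvg_in_prob {R : realType} {dT} {T : measurableType dT}
  (P : probability T R) {V : normedModType R} (Y : nat -> T -> V) (c : V) : Prop :=
  forall e : R, 0 < e -> (fun n => P [set w | e < `|Y n w - c|]) @ \oo --> 0%E.

Definition tight_unif_compacts {R : realType} {d : nat} {dT} {T : measurableType dT}
  (Theta : set 'rV[R]_d) (P : 'rV[R]_d -> probability T R) {V : normedModType R}
  (Y : nat -> 'rV[R]_d -> T -> V) : Prop :=
  forall K : set 'rV[R]_d, compact K -> K `<=` Theta ->
  forall e : R, 0 < e -> exists C : R, 0 < C /\
    forall n t, K t -> (P t [set w | (C < `|Y n t w|)%R] <= e%:E)%E.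

Fixpoint gint {R : realType} (n : nat) (F : (nat -> R) -> R) : R :=
  match n with
  | 0 => F (fun _ => 0)
  | n'.+1 => \int[lebesgue_measure]_(z in [set: R])
       (normal_pdf 0 1 z * gint n' (fun v => F (fun k => if k == n' then z else v k)))
  end.

Definition std_gauss_E {R : realType} {d : nat} (f : 'rV[R]_d -> R) : R :=
  gint d (fun v => f (\row_i v i)).

Definition psd {R : realType} {d : nat} (M : 'M[R]_d) : Prop :=
  forall v : 'rV[R]_d, 0 <= (v *m M *m v^T) 0 0.

Definition msqrt {R : realType} {d : nat} (M : 'M[R]_d) : 'M[R]_d :=
  xget 0 [set B : 'M[R]_d | B^T = B /\ psd B /\ B *m B = M].

Definition gauss_E {R : realType} {d : nat} (Sigma : 'M[R]_d)
  (f : 'rV[R]_d -> R) : R :=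
  std_gauss_E (fun z => f (z *m msqrt Sigma)).

Definition cvg_dist_normal {R : realType} {d : nat} {dT} {T : measurableType dT}
  (P : probability T R) (Y : nat -> T -> 'rV[R]_d) (Sigma : 'M[R]_d) : Prop :=
  forall f : 'rV[R]_d -> R, continuous f -> (exists M : R, forall x, `|f x| <= M) ->
    (fun n => expectation P (f \o Y n)) @ \oo --> (gauss_E Sigma f)%:E.

(** bounded loss function in the sense of Ibragimov--Has'minskii *)
Definition bounded_loss {R : realType} {d : nat} (W : 'rV[R]_d -> R) : Prop :=
  W 0 = 0 /\ (forall x, 0 <= W x) /\ (forall x, W (- x) = W x) /\ continuous W /\
  (forall c : R, convex_set_rV [set x | W x < c]) /\
  (exists M : R, forall x, W x <= M).

Definition Nsize {R : realType} (delta : R) (n : nat) : nat :=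
  Num.truncn ((n%:R : R) `^ delta).

Definition kidx {R : realType} (s : R) (n : nat) : nat := Num.truncn (s * n%:R).

Definition DeltaK {R : realType} {d : nat} {dT} {T : measurableType dT}
  (S : 'rV[R]_d -> R -> R) (g : R -> R) (X : nat -> T -> R)
  (k : nat) (t : 'rV[R]_d) (w : T) : 'rV[R]_d :=
  (Num.sqrt (k%:R))^-1 *: \sum_(1 <= j < k.+1) dl1 S g t (X j.-1 w) (X j w).

Definition onestep {R : realType} {d : nat} {dT} {T : measurableType dT}
  (P : 'rV[R]_d -> probability T R) (S : 'rV[R]_d -> R -> R) (g : R -> R)
  (X : nat -> T -> R) (k : nat) (t : 'rV[R]_d) (w : T) : 'rV[R]_d :=
  t + (Num.sqrt (k%:R))^-1 *: (DeltaK S g X k t w *m invmx (fisher P X S g t)).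

Definition prelim {R : realType} {d : nat} {dT} {T : measurableType dT}
  (est : nat -> (nat -> R) -> 'rV[R]_d) (X : nat -> T -> R) (delta : R)
  (n : nat) (w : T) : 'rV[R]_d :=
  est (Nsize delta n) (fun j => X j w).

Definition two_step {R : realType} {d : nat} {dT} {T : measurableType dT}
  (P : 'rV[R]_d -> probability T R) (S : 'rV[R]_d -> R -> R) (g : R -> R)
  (X : nat -> T -> R) (est : nat -> (nat -> R) -> 'rV[R]_d) (delta s : R)
  (n : nat) (w : T) : 'rV[R]_d :=
  let k := kidx s n in
  let th2 := onestep P S g X k (prelim est X delta n w) w in
  onestep P S g X k th2 w.

(* Main.v *)
Require Import Defs.
From HB Require Import structures.
From mathcomp Require Import all_boot all_order all_algebra.
From mathcomp Require Import all_classical all_reals all_analysis.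
From mathcomp Require Import measurable_realfun.
From mathcomp Require Import ring lra zify.
Set Implicit Arguments. Unset Strict Implicit. Unset Printing Implicit Defensive.
Import Order.TTheory GRing.Theory Num.Theory.
Import numFieldNormedType.Exports.
Local Open Scope classical_set_scope.
Local Open Scope ring_scope.

(** Let Y_n(t) be the normalised error of the two-step estimator under t, and D_k(t) the
    normalised score. Since delta > 1/4, two Newton steps started at a root-N consistent
    estimator give Y_n(t) = D_k(t) I(t)^-1 + o(1) in probability, uniformly for t in a small
    cube. At a fixed t the assumed central limit theorem then yields the first claim; no
    Gaussian integral is needed, only the uniqueness of positive semidefinite square roots.

    Efficiency requires the limit to be uniform in t near t0, which a central limit theorem
    at each t does not provide. For a smooth test function p, the mean of p (D_k(t)) under t is
    compared with the mean of p along one symmetric random walk that does not depend on t: its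
    steps are +- b_i / sqrt k, where the b_i are values of the score along a trajectory for which
    the law of large numbers at t0 holds, so that their covariance is close to I(t0).
    The comparison is Lindeberg's replacement. Conditional covariances of the score are turned
    into means of its derivative by the information identity, and these are averaged over
    short blocks, by stationarity and the assumed tightness. Hence the means of f (Y_n(t)) are
    asymptotically equicontinuous in t, pointwise convergence is locally uniform, and suprema
    over small balls converge. *)

(** * Expectations *)

(** Near [t0] the assumptions give two kinds of control that are uniform in t: second moments of the
    score and of its derivatives, and tightness of the centred second derivatives. The law of large
    numbers for products of scores holds one parameter at a time, and this is why quadratic terms
    are exchanged for second derivatives. That exchange and the Lindeberg condition need moments of
    the noise and of the past separately, whereas the assumptions bound only combinations of both.
    The factors are separated by independence, starting from the nondegeneracy of the information: a
    factor with nonzero mean square passes integrability on to the other one, and fourth moments of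
    the gradient of S then follow from the vanishing integrals of g' and g''. A second obstacle is
    measurability. The estimator evaluates score and information at a random point, which may leave
    [Theta], where nothing is assumed of S. Its expectations are therefore compared with those of
    measurable functions of the score, through a bound valid for arbitrary bounded functions. *)

Definition L1 {d} {T : measurableType d} {R : realType} (P : probability T R)
  (f : T -> R) := P.-integrable setT (EFin \o f).

Definition Ex {d} {T : measurableType d} {R : realType} (P : probability T R)
  (f : T -> R) : R := fine (expectation P f).

Definition L2 {d} {T : measurableType d} {R : realType} (P : probability T R)
  (f : T -> R) := measurable_fun setT f /\ L1 P (fun w => f w ^+ 2).

Section Expectation.
Context {d} {T : measurableType d} {R : realType} (P : probability T R).
Implicit Types f g : T -> R.

Lemma ExE f : Ex P f = (\int[P]_w f w)%R.
Proof. by rewrite /Ex unlock. Qed.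

Lemma L1_meas f : L1 P f -> measurable_fun setT f.
Proof. by move=> /integrableP[/measurable_EFinP]. Qed.

Lemma eq_Ex f g : f =1 g -> Ex P f = Ex P g.
Proof. by move=> /funext ->. Qed.

Lemma eq_L1 f g : f =1 g -> L1 P f -> L1 P g.
Proof. by move=> /funext ->. Qed.

Lemma expectation_fin f : L1 P f -> expectation P f = (Ex P f)%:E.
Proof. by move=> hf; rewrite /Ex fineK// unlock; exact: integrable_fin_num. Qed.

Lemma L1D f g : L1 P f -> L1 P g -> L1 P (fun w => f w + g w).
Proof. by move=> hf hg; apply: (integrableD _ hf hg). Qed.

Lemma L1N f : L1 P f -> L1 P (fun w => - f w).
Proof. by move=> hf; apply: (integrableN hf). Qed.

Lemma L1B f g : L1 P f -> L1 P g -> L1 P (fun w => f w - g w).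
Proof. by move=> hf hg; apply: L1D => //; exact: L1N. Qed.

Lemma L1Z (c : R) f : L1 P f -> L1 P (fun w => c * f w).
Proof. by move=> hf; apply: (integrableZl _ c hf). Qed.

Lemma L1abs f : L1 P f -> L1 P (fun w => `|f w|).
Proof. by move=> hf; apply: (integrable_norm hf). Qed.

Lemma L1c (c : R) : L1 P (fun=> c).
Proof. exact: finite_measure_integrable_cst. Qed.

Lemma L1_le f g : measurable_fun setT f -> L1 P g ->
  (forall w, `|f w| <= g w) -> L1 P f.
Proof.
move=> mf hg fg; apply: (le_integrable _ _ _ hg) => //; first exact/measurable_EFinP.
by move=> w _ /=; rewrite lee_fin (le_trans (fg w))// ler_norm.
Qed.

Lemma L1_bounded f (M : R) : measurable_fun setT f ->
  (forall w, `|f w| <= M) -> L1 P f.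
Proof. by move=> mf fM; exact: (@L1_le f (fun=> M) mf (L1c M) fM). Qed.

Lemma L1_sum {I : Type} (s : seq I) (Q : pred I) (F : I -> T -> R) :
  (forall i, Q i -> L1 P (F i)) -> L1 P (fun w => \sum_(i <- s | Q i) F i w).
Proof.
move=> h; have := integrable_sum (D := setT) (mu := P) measurableT s h.
by apply: eq_integrable => // w _ /=; rewrite -sumEFin.
Qed.

Lemma ExD f g : L1 P f -> L1 P g -> Ex P (fun w => f w + g w) = Ex P f + Ex P g.
Proof. by move=> hf hg; rewrite !ExE RintegralD. Qed.

Lemma ExB f g : L1 P f -> L1 P g -> Ex P (fun w => f w - g w) = Ex P f - Ex P g.
Proof. by move=> hf hg; rewrite !ExE RintegralB. Qed.

Lemma ExZ (c : R) f : L1 P f -> Ex P (fun w => c * f w) = c * Ex P f.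
Proof. by move=> hf; rewrite !ExE RintegralZl. Qed.

Lemma Exc (c : R) : Ex P (fun=> c) = c.
Proof.
by rewrite ExE Rintegral_cst//= probability_setT/= mulr1.
Qed.

Lemma Ex_sum {I : Type} (s : seq I) (F : I -> T -> R) :
  (forall i, L1 P (F i)) ->
  Ex P (fun w => \sum_(i <- s) F i w) = \sum_(i <- s) Ex P (F i).
Proof.
move=> h; elim: s => [|i s IH].
  by rewrite big_nil (@eq_Ex _ (fun=> 0)) ?Exc// => w; rewrite big_nil.
rewrite big_cons -IH -ExD//; last exact: L1_sum.
by apply: eq_Ex => w; rewrite big_cons.
Qed.

Lemma Ex_le f g : L1 P f -> L1 P g -> (forall w, f w <= g w) -> Ex P f <= Ex P g.
Proof. by move=> hf hg fg; rewrite !ExE le_Rintegral. Qed.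

Lemma Ex_ge0 f : (forall w, 0 <= f w) -> 0 <= Ex P f.
Proof. by move=> f0; rewrite ExE Rintegral_ge0. Qed.

Lemma Ex_norm f : L1 P f -> `|Ex P f| <= Ex P (fun w => `|f w|).
Proof. by move=> hf; rewrite !ExE le_normr_Rintegral. Qed.

Lemma L2M f g : L2 P f -> L2 P g -> L1 P (fun w => f w * g w).
Proof.
move=> [mf f2] [mg g2]; apply: (L1_le _ (L1D f2 g2)) => [|w].
  exact: measurable_funM.
by rewrite ler_norml; nra.
Qed.

Lemma L2D f g : L2 P f -> L2 P g -> L2 P (fun w => f w + g w).
Proof.
move=> hf hg; have [mf f2] := hf; have [mg g2] := hg; split.
  exact: measurable_funD.
have := L1D (L1D f2 g2) (L1Z 2 (L2M hf hg)); apply: eq_L1 => w /=; ring.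
Qed.

Lemma L2Z (c : R) f : L2 P f -> L2 P (fun w => c * f w).
Proof.
move=> [mf f2]; split; first exact: measurable_funM.
by have := L1Z (c ^+ 2) f2; apply: eq_L1 => w /=; rewrite exprMn.
Qed.

Lemma L2c (c : R) : L2 P (fun=> c).
Proof. by split => //; exact: L1c. Qed.

Lemma L2abs f : L2 P f -> L2 P (fun w => `|f w|).
Proof.
move=> [mf f2]; split; first exact: measurableT_comp.
by apply: eq_L1 f2 => w; rewrite real_normK// num_real.
Qed.

Lemma L2_L1 f : L2 P f -> L1 P f.
Proof. by move=> hf; apply: eq_L1 (L2M hf (L2c 1)) => w; rewrite mulr1. Qed.

Lemma L2_sum {I : Type} (s : seq I) (F : I -> T -> R) :
  (forall i, L2 P (F i)) -> L2 P (fun w => \sum_(i <- s) F i w).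
Proof.
move=> h; elim: s => [|i s IH].
  by have := L2c 0; congr L2; apply/funext => w; rewrite big_nil.
by have := L2D (h i) IH; congr L2; apply/funext => w; rewrite big_cons.
Qed.

Lemma L2_le f g : measurable_fun setT f -> L2 P g ->
  (forall w, `|f w| <= `|g w|) -> L2 P f.
Proof.
move=> mf [mg g2] fg; split => //; apply: (L1_le _ g2) => [|w].
  exact: measurable_funX.
by rewrite normrX -(real_normK (num_real (g w))) lerXn2r// nnegrE.
Qed.

Lemma Ex_CS f g : L2 P f -> L2 P g ->
  Ex P (fun w => f w * g w) ^+ 2 <=
  Ex P (fun w => f w ^+ 2) * Ex P (fun w => g w ^+ 2).
Proof.
move=> hf hg; set a := Ex P (fun w => f w ^+ 2); set b := Ex P (fun w => g w ^+ 2).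
set c := Ex P _.
have a0 : 0 <= a by apply: Ex_ge0 => w; rewrite sqr_ge0.
have b0 : 0 <= b by apply: Ex_ge0 => w; rewrite sqr_ge0.
have H (x : R) : 0 <= a - 2 * x * c + x ^+ 2 * b.
  have := @Ex_ge0 (fun w => (f w - x * g w) ^+ 2) (fun w => sqr_ge0 _).
  rewrite (@eq_Ex _ (fun w => f w ^+ 2 - (2 * x) * (f w * g w) +
    x ^+ 2 * g w ^+ 2)) => [|w]; last by ring.
  have [mf f2] := hf; have [mg g2] := hg.
  have fg := L2M hf hg.
  have l1 := L1Z (2 * x) fg; have l2 := L1Z (x ^+ 2) g2; have l3 := L1B f2 l1.
  by rewrite ExD// ExB// !ExZ.
have [b00|b00] := eqVneq b 0.
  (* If [b] = 0 the quadratic in x is affine. At this x it would equal -1 unless [c] = 0, so [c]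
     must vanish. *)
  have := H ((a + 1) / (2 * c)); rewrite b00 mulr0 addr0 mulr0.
  have [->|c0] := eqVneq c 0; first by rewrite expr0n.
  have -> : 2 * ((a + 1) / (2 * c)) * c = a + 1 by field.
  lra.
have bp : 0 < b by rewrite lt_neqAle eq_sym b00.
have := H (c / b).
have -> : a - 2 * (c / b) * c + (c / b) ^+ 2 * b = a - c ^+ 2 / b by field.
by rewrite subr_ge0 ler_pdivrMr.
Qed.

Lemma Ex_CS_norm f g (A B : R) : L2 P f -> L2 P g -> 0 <= A -> 0 <= B ->
  Ex P (fun w => f w ^+ 2) <= A ^+ 2 -> Ex P (fun w => g w ^+ 2) <= B ^+ 2 ->
  Ex P (fun w => `|f w| * `|g w|) <= A * B.
Proof.
move=> hf hg A0 B0 fA gB.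
have := Ex_CS (L2abs hf) (L2abs hg).
rewrite (@eq_Ex (fun w => `|f w| ^+ 2) (fun w => f w ^+ 2)); last first.
  by move=> w; rewrite real_normK// num_real.
rewrite (@eq_Ex (fun w => `|g w| ^+ 2) (fun w => g w ^+ 2)); last first.
  by move=> w; rewrite real_normK// num_real.
move=> h; rewrite -(@ler_pXn2r _ 2)// ?nnegrE ?mulr_ge0//; last first.
  by apply: Ex_ge0 => w; rewrite mulr_ge0.
apply: (le_trans h); rewrite exprMn ler_pM//;
  by apply: Ex_ge0 => w; rewrite sqr_ge0.
Qed.

Lemma Ex_indic (A : set T) : measurable A -> (Ex P \1_A)%:E = P A.
Proof.
move=> mA; rewrite ExE /Rintegral integral_indic// setIT fineK//.
exact: fin_num_measure.
Qed.

Lemma L1_indic (A : set T) : measurable A -> L1 P \1_A.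
Proof. by move=> mA; exact: integrable_indic. Qed.

Lemma Ex_markov f (a : R) : L1 P f -> (forall w, 0 <= f w) -> 0 < a ->
  (P [set w | (a < f w)%R] <= (Ex P f / a)%:E)%E.
Proof.
move=> hf f0 a0; have mf := L1_meas hf.
have mA : measurable [set w | a < f w].
  by rewrite -[X in measurable X]setTI; apply: measurable_fun_ltr.
rewrite -Ex_indic// lee_fin ler_pdivlMr// mulrC -ExZ; last exact: L1_indic.
apply: Ex_le => // [|w]; first exact/L1Z/L1_indic.
rewrite indicE; case: (boolP (w \in _)); rewrite ?mulr1 ?mulr0//.
by rewrite inE/= => /ltW.
Qed.

(* The Lebesgue integral of the library is the lower integral on nonmeasurable
   functions, and that integral is still monotone. *)
Lemma lower_integral_le f g : (forall w, 0 <= f w <= g w) ->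
  (\int[P]_w (f w)%:E <= \int[P]_w (g w)%:E)%E.
Proof.
move=> fg; rewrite !ge0_integralTE.
- apply: ge_ereal_sup => _ [h/= hf <-]; apply: ereal_sup_ubound; exists h => // w.
  by apply: (le_trans (hf w)); rewrite lee_fin; case/andP: (fg w).
- by move=> w; rewrite lee_fin; case/andP: (fg w); exact: le_trans.
- by move=> w; rewrite lee_fin; case/andP: (fg w).
Qed.

(** [F] is arbitrary, as a test function of the estimator is. Its positive and negative parts are
    squeezed separately between measurable functions at distance [r], equal to e on A and e + 2M off
    A, by monotonicity of the lower integral. Each part costs [Ex P r], hence the doubled bound. *)
Lemma expectation_sandwich (F G : T -> R) (A : set T) (M e : R) :
  measurable_fun setT G -> measurable A -> (forall w, `|F w| <= M) ->
  (forall w, `|G w| <= M) -> (forall w, A w -> `|F w - G w| <= e) ->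
  0 <= e -> expectation P F \is a fin_num /\
  `|Ex P F - Ex P G| <= 2 * e + 4 * M * fine (P (~` A)).
Proof.
move=> mG mA FM GM FG e0.
have M0 : 0 <= M by apply: le_trans (GM point).
pose r w := e + 2 * M * \1_(~` A) w.
have mnA : measurable (~` A) by exact: measurableC.
have r0 w : 0 <= r w.
  rewrite /r addr_ge0// mulr_ge0 ?mulr_ge0// indicE; exact: ler0n.
have Lr : L1 P r.
  by apply: L1D; [exact: L1c | exact/L1Z/L1_indic].
have Er : Ex P r = e + 2 * M * fine (P (~` A)).
  rewrite ExD ?Exc ?ExZ -?Ex_indic//; [exact: L1_indic|exact: L1c|exact/L1Z/L1_indic].
have Fr w : `|F w - G w| <= r w.
  rewrite /r indicE; have [Aw|nAw] := pselect (A w).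
    by rewrite memNset ?mulr0 ?addr0 ?FG//= => /(_ Aw).
  rewrite mem_set// mulr1 (le_trans (ler_normB _ _))//.
  by rewrite (le_trans (lerD (FM w) (GM w)))//; lra.
have LG : L1 P G := L1_bounded mG GM.
have key (f g : T -> R) : (forall w, 0 <= f w <= M) -> measurable_fun setT g ->
    (forall w, 0 <= g w <= M) -> (forall w, `|f w - g w| <= r w) ->
    (\int[P]_w (f w)%:E \is a fin_num)%E /\
    `|(\int[P]_w f w)%R - (\int[P]_w g w)%R| <= Ex P r.
  move=> f0 mg g0 fg.
  have Lg : L1 P g.
    apply: (L1_bounded mg (M := M)) => w; case/andP: (g0 w) => ? ?.
    by rewrite ger0_norm.
  have up : (\int[P]_w (f w)%:E <= ((\int[P]_w g w)%R + Ex P r)%:E)%E.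
    rewrite -ExE -ExD// -(expectation_fin (L1D Lg Lr)) unlock.
    apply: lower_integral_le => w; move: (fg w) (f0 w); rewrite ler_norml.
    by move=> /andP[_ ?] /andP[-> _] /=; lra.
  have ffin : (\int[P]_w (f w)%:E \is a fin_num)%E.
    rewrite ge0_fin_numE; last by apply: integral_ge0 => w _; rewrite lee_fin; case/andP: (f0 w).
    exact: le_lt_trans up (ltry _).
  split => //.
  have fE : (\int[P]_w (f w)%:E)%E = ((\int[P]_w f w)%R)%:E by rewrite fineK.
  move: up; rewrite fE lee_fin => up.
  (* A measurable minorant of [f], cut at 0 so that its integral can be compared with the lower
     integral of [f]. *)
  pose h w := Num.max 0 (g w - r w).
  have mh : measurable_fun setT h.
    apply: measurable_maxr => //; apply: measurable_funB => //; exact: L1_meas.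
  have h0 w : 0 <= h w <= M.
    rewrite /h le_max lexx/= ge_max M0/=; case/andP: (g0 w) => _ ?.
    by rewrite lerBlDr (le_trans (y := M))// lerDl.
  have Lh : L1 P h.
    by apply: (L1_bounded mh (M := M)) => w; case/andP: (h0 w) => ? ?; rewrite ger0_norm.
  have low : Ex P h <= (\int[P]_w f w)%R.
    rewrite -lee_fin -fE -(expectation_fin Lh) unlock.
    apply: lower_integral_le => w; case/andP: (h0 w) => -> _ /=.
    rewrite /h ge_max; case/andP: (f0 w) => -> _ /=.
    by move: (fg w); rewrite ler_norml => /andP[? _]; lra.
  have low2 : (\int[P]_w g w)%R - Ex P r <= Ex P h.
    rewrite -ExE -ExB//; apply: Ex_le => //; first exact: L1B.
    by move=> w; rewrite /h le_max lexx orbT.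
  by rewrite ler_norml; lra.
have pM (f : T -> R) : (forall w, `|f w| <= M) -> forall w, 0 <= f^\+ w <= M.
  move=> fM w; rewrite /funrpos le_max lexx orbT ge_max M0 andbT /=.
  by apply: le_trans (fM w); rewrite ler_norm.
have nM (f : T -> R) : (forall w, `|f w| <= M) -> forall w, 0 <= f^\- w <= M.
  move=> fM w; rewrite /funrneg le_max lexx orbT ge_max M0 andbT /=.
  by apply: le_trans (fM w); rewrite -normrN ler_norm.
have lip0 (x y : R) : `|Num.max x 0 - Num.max y 0| <= `|x - y|.
  have := ler_norm (x - y); have := ler_norm (- (x - y)).
  rewrite normrN ler_norml /Num.max; case: ltP => ?; case: ltP => ?; lra.
have lipP w : `|F^\+ w - G^\+ w| <= r w by exact: le_trans (lip0 _ _) (Fr w).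
have lipN w : `|F^\- w - G^\- w| <= r w.
  apply: le_trans (lip0 _ _) _; apply: le_trans (Fr w).
  by rewrite opprK addrC distrC.
have [fp kp] := key _ _ (pM _ FM) (measurable_funrpos mG) (pM _ GM) lipP.
have [fn kn] := key _ _ (nM _ FM) (measurable_funrneg mG) (nM _ GM) lipN.
have FE : expectation P F = (\int[P]_w (F^\+ w)%:E - \int[P]_w (F^\- w)%:E)%E.
  rewrite unlock integralE; congr (_ - _)%E; apply: eq_integral => w _.
    exact: (congr1 (fun h => h w) (funerpos F)).
  exact: (congr1 (fun h => h w) (funerneg F)).
have GE : Ex P G = (\int[P]_w G^\+ w)%R - (\int[P]_w G^\- w)%R.
  rewrite -!ExE -ExB.
  - apply: eq_Ex => w; rewrite /funrpos/funrneg /Num.max; case: ifP; case: ifP; lra.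
  - by apply: (L1_bounded (M := M) (measurable_funrpos mG)) => w; case/andP: (pM _ GM w) => ? ?; rewrite ger0_norm.
  - by apply: (L1_bounded (M := M) (measurable_funrneg mG)) => w; case/andP: (nM _ GM w) => ? ?; rewrite ger0_norm.
split; first by rewrite FE fin_numB fp fn.
rewrite {1}/Ex FE fineB//.
have -> : 2 * e + 4 * M * fine (P (~` A)) = Ex P r + Ex P r by rewrite Er; ring.
rewrite GE.
set a := fine _ in kp *; set b := fine (\int[P]_w (F^\- w)%:E)%E in kn *.
rewrite (_ : _ - _ = (a - (\int[P]_w G^\+ w)%R) - (b - (\int[P]_w G^\- w)%R)).
  by rewrite (le_trans (ler_normB _ _))// lerD.
by ring.
Qed.

End Expectation.

(** * Independence of the past and stationarity *)

Section Product.
Context {d d1 d2} {T : measurableType d} {T1 : measurableType d1}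
  {T2 : measurableType d2} {R : realType} (P : probability T R).
Variables (W : {mfun T >-> T1}) (V : {mfun T >-> T2}).
Hypothesis WV : forall A B, measurable A -> measurable B ->
  P (W @^-1` A `&` V @^-1` B) = (P (W @^-1` A) * P (V @^-1` B))%E.

Let Z : T -> T1 * T2 := fun w => (W w, V w).
Let mZ : measurable_fun setT Z.
Proof. by apply: measurable_fun_pair. Qed.
HB.instance Definition _ := isMeasurableFun.Build _ _ _ _ Z mZ.

(** Independence on rectangles determines the joint law, by uniqueness of the product measure;
    Tonelli's theorem then applies. *)
Let jointE (X : set (T1 * T2)) : measurable X ->
  (distribution P W \x distribution P V)%E X = distribution P (Z : {mfun T >-> _}) X.
Proof.
move=> mX.
apply: (@product_measure_unique _ _ _ _ _ (distribution P W) (distribution P V)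
  (distribution P (Z : {mfun T >-> _}))) => //.
Qed.

Let integral_joint (f : T1 * T2 -> \bar R) : measurable_fun setT f ->
  (forall z, 0 <= f z)%E ->
  (\int[P]_w f (W w, V w) =
   \int[distribution P W]_x \int[distribution P V]_y f (x, y))%E.
Proof.
move=> mf f0.
rewrite -(fubini_tonelli1 f)//.
rewrite (@eq_measure_integral _ _ _ _ (distribution P (Z : {mfun T >-> _}))).
  by rewrite ge0_integral_distribution.
by move=> A mA _; exact: jointE.
Qed.

Lemma indep_integral_mul (F : T1 -> R) (G : T2 -> R) :
  measurable_fun setT F -> measurable_fun setT G ->
  (forall x, 0 <= F x) -> (forall y, 0 <= G y) ->
  (\int[P]_w (F (W w) * G (V w))%:E =
   \int[P]_w (F (W w))%:E * \int[P]_w (G (V w))%:E)%E.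
Proof.
move=> mF mG F0 G0.
have mf : measurable_fun setT (fun z : T1 * T2 => (F z.1 * G z.2)%:E).
  apply/measurable_EFinP; apply: measurable_funM.
    exact: (measurableT_comp mF measurable_fst).
  exact: (measurableT_comp mG measurable_snd).
rewrite (integral_joint mf); last by move=> z; rewrite lee_fin mulr_ge0.
have eG : (\int[distribution P V]_y (G y)%:E = \int[P]_w (G (V w))%:E)%E.
  by rewrite ge0_integral_distribution//; exact/measurable_EFinP.
have eF : (\int[distribution P W]_x (F x)%:E = \int[P]_w (F (W w))%:E)%E.
  by rewrite ge0_integral_distribution//; exact/measurable_EFinP.
rewrite -eF -eG.
transitivity (\int[distribution P W]_x
    ((F x)%:E * \int[distribution P V]_y (G y)%:E))%E.
  apply: eq_integral => x _ /=.
  under eq_integral do rewrite EFinM.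
  by rewrite ge0_integralZl//; [exact/measurable_EFinP|move=> y _; rewrite lee_fin|rewrite lee_fin].
rewrite ge0_integralZr//; first exact/measurable_EFinP.
  by move=> y _; rewrite lee_fin.
by apply: integral_ge0 => y _; rewrite lee_fin.
Qed.

Lemma indep_L1 (F : T1 -> R) (G : T2 -> R) :
  measurable_fun setT F -> measurable_fun setT G ->
  L1 P (F \o W) -> L1 P (G \o V) -> L1 P (fun w => F (W w) * G (V w)).
Proof.
move=> mF mG /integrableP[_ iF] /integrableP[_ iG]; apply/integrableP; split.
  apply/measurable_EFinP; apply: measurable_funM.
    exact: (measurableT_comp mF).
  exact: (measurableT_comp mG).
rewrite (_ : (fun x => _) = (fun w => (`|F (W w)|%R * `|G (V w)|%R)%:E)); last first.
  by apply/funext => w /=; rewrite normrM.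
rewrite (@indep_integral_mul (fun x => `|F x|) (fun y => `|G y|))//.
- rewrite lte_mul_pinfty//; first by apply: integral_ge0 => y _; rewrite lee_fin.
  by rewrite ge0_fin_numE//; apply: integral_ge0 => y _; rewrite lee_fin.
- exact: measurableT_comp.
- exact: measurableT_comp.
Qed.

Lemma indep_ExM (F : T1 -> R) (G : T2 -> R) :
  measurable_fun setT F -> measurable_fun setT G ->
  L1 P (F \o W) -> L1 P (G \o V) ->
  Ex P (fun w => F (W w) * G (V w)) = Ex P (F \o W) * Ex P (G \o V).
Proof.
move=> mF mG lF lG.
have ge (f : T1 -> R) (g : T2 -> R) : measurable_fun setT f -> measurable_fun setT g ->
    (forall x, 0 <= f x) -> (forall y, 0 <= g y) -> L1 P (f \o W) -> L1 P (g \o V) ->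
    Ex P (fun w => f (W w) * g (V w)) = Ex P (f \o W) * Ex P (g \o V).
  move=> mf mg f0 g0 lf lg; rewrite !ExE /Rintegral indep_integral_mul// fineM//.
    exact: (@integrable_fin_num _ _ _ P setT measurableT _ lf).
  exact: (@integrable_fin_num _ _ _ P setT measurableT _ lg).
have Lp (U : T -> R) : L1 P U -> L1 P (fun w => Num.max (U w) 0).
  move=> lU; apply: (L1_le _ (L1abs lU)) => [|w].
    by apply: measurable_maxr => //; exact: (L1_meas lU).
  by rewrite ger0_norm ?le_max ?lexx ?orbT// ge_max ler_norm normr_ge0.
have Ln (U : T -> R) : L1 P U -> L1 P (fun w => Num.max (- U w) 0).
  by move=> lU; apply: Lp; exact: L1N.
have mp d0 (T0 : measurableType d0) (f : T0 -> R) : measurable_fun setT f ->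
    measurable_fun setT (fun x => Num.max (f x) 0).
  by move=> mf; exact: measurable_maxr.
have mn d0 (T0 : measurableType d0) (f : T0 -> R) : measurable_fun setT f ->
    measurable_fun setT (fun x => Num.max (- f x) 0).
  by move=> mf; apply: mp; exact: measurable_funN.
have m0 (x : R) : 0 <= Num.max x 0 by rewrite le_max lexx orbT.
have dec (x : R) : x = Num.max x 0 - Num.max (- x) 0.
  by rewrite /Num.max; case: ifP; case: ifP; lra.
have lFp := Lp _ lF; have lFn := Ln _ lF; have lGp := Lp _ lG; have lGn := Ln _ lG.
have pp := ge _ _ (mp _ _ _ mF) (mp _ _ _ mG) (fun=> m0 _) (fun=> m0 _) lFp lGp.
have pn := ge _ _ (mp _ _ _ mF) (mn _ _ _ mG) (fun=> m0 _) (fun=> m0 _) lFp lGn.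
have np := ge _ _ (mn _ _ _ mF) (mp _ _ _ mG) (fun=> m0 _) (fun=> m0 _) lFn lGp.
have nn := ge _ _ (mn _ _ _ mF) (mn _ _ _ mG) (fun=> m0 _) (fun=> m0 _) lFn lGn.
have jpp := indep_L1 (mp _ _ _ mF) (mp _ _ _ mG) lFp lGp.
have jpn := indep_L1 (mp _ _ _ mF) (mn _ _ _ mG) lFp lGn.
have jnp := indep_L1 (mn _ _ _ mF) (mp _ _ _ mG) lFn lGp.
have jnn := indep_L1 (mn _ _ _ mF) (mn _ _ _ mG) lFn lGn.
have EF : Ex P (F \o W) = Ex P (fun w => Num.max (F (W w)) 0) -
    Ex P (fun w => Num.max (- F (W w)) 0).
  by rewrite -ExB//; apply: eq_Ex => w /=; exact: dec.
have EG : Ex P (G \o V) = Ex P (fun w => Num.max (G (V w)) 0) -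
    Ex P (fun w => Num.max (- G (V w)) 0).
  by rewrite -ExB//; apply: eq_Ex => w /=; exact: dec.
rewrite EF EG.
transitivity (Ex P (fun w => (Num.max (F (W w)) 0 * Num.max (G (V w)) 0 -
    Num.max (F (W w)) 0 * Num.max (- G (V w)) 0) -
    (Num.max (- F (W w)) 0 * Num.max (G (V w)) 0 -
    Num.max (- F (W w)) 0 * Num.max (- G (V w)) 0))).
  by apply: eq_Ex => w; rewrite {1}(dec (F (W w))) {1}(dec (G (V w))); ring.
rewrite ExB; [|exact: L1B|exact: L1B].
by rewrite ExB// ExB// pp pn np nn /comp; ring.
Qed.

End Product.

(** * The sigma-algebra of the past *)

Definition past_sets {T : Type} {d} {U : measurableType d} (Y : nat -> T -> U)
  (n : nat) : set (set T) :=
  [set A | exists B : nat -> set U, (forall i, measurable (B i)) /\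
     A = \bigcap_(i in `I_n) (Y i @^-1` B i)].

(** The sample space with the smaller sigma-algebra of [Y 0], ..., [Y n.-1]. As it is a type of its
    own, adaptedness is ordinary measurability. *)
Definition past {T : pointedType} {d} {U : measurableType d} (Y : nat -> T -> U)
  (n : nat) := g_sigma_algebraType (past_sets Y n).

Section Past.
Context {d} {T : measurableType d} {R : realType} (P : probability T R).
Variable Y : nat -> T -> R.
Hypothesis mY : forall i, measurable_fun setT (Y i).

Lemma past_sets_measurable n : past_sets Y n `<=` measurable.
Proof.
move=> A [B [mB ->]]; apply: bigcap_measurableType => i _.
by rewrite -[X in measurable X]setTI; exact: mY.
Qed.

Lemma past_sub n (A : set T) : measurable (A : set (past Y n)) -> measurable A.
Proof.
apply: smallest_sub; first exact: sigma_algebra_measurable.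
exact: past_sets_measurable.
Qed.

Lemma past_measW d' (U : measurableType d') n (F : T -> U) :
  measurable_fun setT (F : past Y n -> U) -> measurable_fun setT F.
Proof. by move=> mF _ B mB; apply: (@past_sub n); exact: mF. Qed.

Lemma past_coord n i : (i < n)%N -> measurable_fun setT (Y i : past Y n -> R).
Proof.
move=> ni _ B mB; rewrite setTI; apply: sub_sigma_algebra.
exists (fun j => if j == i then B else setT); split.
  by move=> j; case: eqP.
apply/seteqP; split => [w Bw j /= _|w /(_ i ni)/=]; last by rewrite eqxx.
by case: eqP => [->|].
Qed.

Lemma past_setsI n : setI_closed (past_sets Y n).
Proof.
move=> _ _ [A [mA ->]] [B [mB ->]]; exists (fun i => A i `&` B i); split.
  by move=> i; exact: measurableI.
apply/seteqP; split => [w [hA hB] i ni|w h]; first by split; [exact: hA|exact: hB].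
by split => i ni; have [] := h i ni.
Qed.

Hypothesis ind : mutually_independent P Y.

(** As functions of A both sides are finite measures: a restriction of P and a multiple of P. On
    rectangles they agree by mutual independence for the indices 0, ..., n; rectangles are closed
    under intersection, so the measures agree on the generated sigma-algebra. *)
Lemma past_indep n A B : measurable (A : set (past Y n)) -> measurable B ->
  P (A `&` Y n @^-1` B) = (P A * P (Y n @^-1` B))%E.
Proof.
move=> mA mB.
have mE : measurable (Y n @^-1` B) by rewrite -[X in measurable X]setTI; exact: mY.
have Pfin : P (Y n @^-1` B) \is a fin_num by exact: fin_num_measure.
have p0 : 0 <= fine (P (Y n @^-1` B)) by rewrite fine_ge0.
have cE : ((NngNum p0)%:num)%:E = P (Y n @^-1` B) by exact: fineK.
suff key : mrestr P mE A = mscale (NngNum p0) P A.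
  by move: key; rewrite /mrestr /mscale cE muleC.
apply: (@g_sigma_algebra_measure_unique _ _ _ (past_sets Y n) _ (fun=> setT)) => //.
- exact: past_sets_measurable.
- move=> _; exists (fun=> setT); split => //.
  by apply/seteqP; split.
- by rewrite bigcup_const//; exists 0%N.
- exact: past_setsI.
- move=> _ [C [mC ->]]; rewrite /= /mrestr /mscale cE.
  have := ind (I := iota 0 n) (iota_uniq _ _) mC.
  have := ind (I := iota 0 n.+1) (B := fun i => if (i < n)%N then C i else B)
    (iota_uniq _ _).
  rewrite -addn1 iotaD /= add0n big_cat/= big_seq1 ltnn => h1 h2.
  have -> : `I_n = [set` iota 0 n].
    by apply/seteqP; split => i /=; rewrite mem_iota add0n.
  rewrite h2 muleC.
  transitivity ((\prod_(i <- iota 0 n) P (Y i @^-1`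
      (if (i < n)%N then C i else B))) * P (Y n @^-1` B))%E; last first.
    congr (_ * _)%E; apply: eq_big_seq => i; rewrite mem_iota add0n => /= ni.
    by rewrite ni.
  rewrite -h1; last by move=> i; case: ifP.
  congr (P _); apply/seteqP; split => w.
    move=> [h w0] i /=; rewrite mem_cat mem_iota add0n inE => /orP[/= ni|/eqP ->].
      by rewrite ni; apply: (h i); rewrite /= mem_iota add0n.
    by rewrite ltnn.
  move=> h; split.
    move=> i /=; rewrite mem_iota add0n => /= ni.
    by have := h i; rewrite /= mem_cat mem_iota add0n ni/=; exact.
  by have := h n; rewrite /= mem_cat inE eqxx orbT ltnn; exact.
- by move=> _; rewrite /= /mrestr setTI ltey_eq fin_num_measure.
Qed.

(** The identity as a random element of the past: independence of a sigma-algebra and a variable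
    becomes independence of two random elements. *)
Let idW (n : nat) : {mfun T >-> past Y n}.
Proof.
refine (@mfun_Sub _ _ T (past Y n) (idfun : T -> past Y n) _).
by apply: mem_set => _ B mB; rewrite setTI; exact: (past_sub (n := n)).
Defined.

Let funY (n : nat) : {mfun T >-> R}.
Proof. by refine (@mfun_Sub _ _ T R (Y n) _); apply: mem_set; exact: mY. Defined.

Section Use.
Variables (n : nat) (F : T -> R) (G : R -> R).
Hypothesis mF : measurable_fun setT (F : past Y n -> R).
Hypothesis mG : measurable_fun setT G.

Lemma past_integral_mul : (forall x, 0 <= F x) -> (forall y, 0 <= G y) ->
  (\int[P]_w (F w * G (Y n w))%:E =
   \int[P]_w (F w)%:E * \int[P]_w (G (Y n w))%:E)%E.
Proof.
move=> F0 G0; apply: (@indep_integral_mul _ _ _ _ _ _ _ P (idW n) (funY n)) => //.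
by move=> A B mA mB; exact: past_indep.
Qed.

Lemma past_L1M : L1 P F -> L1 P (G \o Y n) -> L1 P (fun w => F w * G (Y n w)).
Proof.
move=> lF lG; apply: (@indep_L1 _ _ _ _ _ _ _ P (idW n) (funY n)) => //.
by move=> A B mA mB; exact: past_indep.
Qed.

Lemma past_ExM : L1 P F -> L1 P (G \o Y n) ->
  Ex P (fun w => F w * G (Y n w)) = Ex P F * Ex P (G \o Y n).
Proof.
move=> lF lG; apply: (@indep_ExM _ _ _ _ _ _ _ P (idW n) (funY n)) => //.
by move=> A B mA mB; exact: past_indep.
Qed.

End Use.
End Past.

Definition cyl (R : realType) : set (set (nat -> R)) :=
  [set A | exists m (B : nat -> set R), (forall i, measurable (B i)) /\
     A = [set v | forall i, (i < m.+1)%N -> B i (v i)]].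

Section Stationary.
Context {d} {T : measurableType d} {R : realType} (P : probability T R).
Variable X : nat -> T -> R.
Hypothesis mX : forall i, measurable_fun setT (X i).
Hypothesis st : strictly_stationary P X.

Let seqT := g_sigma_algebraType (@cyl R).
Let shift (h : nat) : T -> seqT := fun w i => X (h + i) w.

Let mshift h : measurable_fun setT (shift h).
Proof.
apply: measurability => // _ [_ [m [B [mB ->]]] <-].
rewrite (_ : _ `&` _ = \bigcap_(i in `I_m.+1) (X (h + i)%N @^-1` B i)); last first.
  by apply/seteqP; split => [w [_ hw] i im|w hw]; [exact: hw|split => // i im; exact: hw].
apply: bigcap_measurableType => i _.
by rewrite -[X in measurable X]setTI; exact: mX.
Qed.

Lemma cyl_coord i : measurable_fun setT (fun v : seqT => v i : R).
Proof.
move=> _ B mB; rewrite setTI; apply: sub_sigma_algebra.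
exists i, (fun j => if j == i then B else setT); split.
  by move=> j; case: eqP.
apply/seteqP; split => [v Bv j /= _|v /(_ i (ltnSn i))/=]; last by rewrite eqxx.
by case: eqP => [->|].
Qed.

Let shiftm (h : nat) : {mfun T >-> seqT}.
Proof. by refine (@mfun_Sub _ _ T seqT (shift h) _); apply: mem_set; exact: mshift. Defined.

(** The laws of the shifted and of the original trajectory agree on cylinders, a generating family
    closed under intersection; hence they agree for functionals of the whole trajectory. *)
Lemma stationary_Ex (f : (nat -> R) -> R) (h : nat) :
  measurable_fun setT (f : seqT -> R) -> (forall v, 0 <= f v) ->
  Ex P (fun w => f (fun i => X (h + i) w)) = Ex P (fun w => f (fun i => X i w)).
Proof.
move=> mf f0; rewrite !ExE /Rintegral; congr fine.
have H k : (\int[P]_w (f (fun i => X (k + i) w))%:E =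
    \int[distribution P (shiftm k)]_v (f v)%:E)%E.
  by rewrite ge0_integral_distribution//; exact/measurable_EFinP.
rewrite H (H 0%N); apply: eq_measure_integral => A mA _.
apply: (@g_sigma_algebra_measure_unique _ _ seqT (@cyl R) _ (fun=> setT)) => //.
- by move=> B cB; exact: sub_sigma_algebra.
- by move=> _; exists 0%N, (fun=> setT); split => //; apply/seteqP; split.
- by rewrite bigcup_const//; exists 0%N.
- move=> _ _ [m [B [mB ->]]] [m' [B' [mB' ->]]].
  exists (maxn m m'), (fun i => (if (i <= m)%N then B i else setT) `&`
    (if (i <= m')%N then B' i else setT)); split.
    by move=> i; apply: measurableI; case: ifP.
  apply/seteqP; split => v.
    by move=> [h1 h2] i _; split; case: ifP => // im; [exact: h1|exact: h2].
  move=> hv; split => i im.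
    by have := hv i; rewrite ltnS leq_max (im : (i <= m)%N)/= => /(_ isT)[].
  by have := hv i; rewrite ltnS leq_max (im : (i <= m')%N) orbT/= => /(_ isT)[].
- move=> _ [m [B [mB ->]]]; have := st m h mB.
  rewrite /distribution /pushforward /=.
  rewrite (_ : \bigcap_(i in `I_m.+1) (X (h + i)%N @^-1` B i) =
    shift h @^-1` [set v | forall i, (i < m.+1)%N -> B i (v i)])//.
- by move=> _; rewrite ltey_eq fin_num_measure.
Qed.

End Stationary.

(** * Integrals against the noise density *)

Section Density.
Context {d} {T : measurableType d} {R : realType} (P : probability T R).
Variables (Y : T -> R) (g : R -> R).
Local Notation mu := (@lebesgue_measure R).
Hypotheses (mY : measurable_fun setT Y) (hY : has_density P Y g).
Hypotheses (mg : measurable_fun setT g) (g0 : forall x, 0 <= g x).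

Let Ym : {mfun T >-> measurableTypeR R}.
Proof. by refine (@mfun_Sub _ _ T (measurableTypeR R) Y _); apply: mem_set; exact: mY. Defined.

Lemma density_integrable : mu.-integrable setT (EFin \o g).
Proof.
apply/integrableP; split; first exact/measurable_EFinP.
rewrite (_ : (fun x => _) = (fun x => (g x)%:E)); last first.
  by apply/funext => x /=; rewrite ger0_norm.
by rewrite -hY// preimage_setT probability_setT ltry.
Qed.

Let dom : distribution P Ym `<< mu.
Proof.
apply/null_content_dominatesP => A mA A0.
rewrite /distribution /pushforward/= (hY mA).
by apply: null_set_integral => //; exact/measurable_funTS/measurable_EFinP.
Qed.

(** The density is given only through probabilities of sets. Since integrals over sets determine a
    function almost everywhere, [g] is the Radon-Nikodym derivative of the law, and the change of
    variables extends the formula to functions; applied to |f| it also gives integrability. *)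
Lemma integral_density (f : R -> R) : measurable_fun setT f -> L1 P (f \o Y) ->
  mu.-integrable setT (fun x => (f x * g x)%:E) /\
  (\int[mu]_x (f x * g x)%:E = (Ex P (f \o Y))%:E)%E.
Proof.
move=> mf lf.
have domc : charge_of_finite_measure (distribution P Ym) `<< mu := dom.
have RNg : ae_eq mu setT (Radon_Nikodym (charge_of_finite_measure (distribution P Ym)) mu)
   (EFin \o g).
  apply: integral_ae_eq => //.
  - by apply: Radon_Nikodym_integrable; exact: domc.
  - by apply/measurable_EFinP.
  - by move=> A _ mA; rewrite -(Radon_Nikodym_integral domc mA) /= -hY.
have main (k : R -> R) : measurable_fun setT k -> L1 P (k \o Y) ->
    (\int[mu]_x (k x * g x)%:E = \int[P]_w (k (Y w))%:E)%E.
  move=> mk lk.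
  have ik : (distribution P Ym).-integrable setT (EFin \o k).
    apply/integrableP; split; first exact/measurable_EFinP.
    move/integrableP : lk => [_].
    rewrite (ge0_integral_distribution (P := P) Ym (f := fun x => (`|k x|)%:E))//.
    by apply/measurable_EFinP/measurableT_comp.
  rewrite -(integral_distribution (P := P) (X := Ym) (f := EFin \o k))//; last exact/measurable_EFinP.
  rewrite -(Radon_Nikodym_change_of_variables dom measurableT ik).
  apply: ae_eq_integral => //.
  - by apply/measurable_EFinP/measurable_funM.
  - apply: emeasurable_funM; first exact/measurable_EFinP.
    by apply: (measurable_int mu); apply: Radon_Nikodym_integrable; exact: domc.
  - by apply: filterS RNg => x /= h _; rewrite h// EFinM.
split; last by rewrite main// -(expectation_fin lf) unlock.
apply/integrableP; split; first exact/measurable_EFinP/measurable_funM.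
rewrite (_ : (fun x => _) = (fun x => (`|f x| * g x)%:E)); last first.
  by apply/funext => x /=; rewrite normrM (ger0_norm (g0 x)).
have mf' : measurable_fun setT (fun x => `|f x|) by exact: measurableT_comp.
rewrite (main (fun x => `|f x|))//; last exact: L1abs lf.
by move/integrableP : lf => [].
Qed.

End Density.

Local Notation mu := (@lebesgue_measure _).
(** An integrable function may have no limit at infinity, but it is small somewhere in every long
    interval. The fundamental theorem is applied between such points, and dominated convergence
    exhausts the line. The uses are h = g, which centres the noise score, and h = g', which gives
    the information identity. *)
Lemma integral_derivative0 {R : realType} (h : R -> R) :
  (forall x, derivable h x 1) -> continuous (derive1 h) ->
  (@lebesgue_measure R).-integrable setT (EFin \o h) ->
  (@lebesgue_measure R).-integrable setT (EFin \o derive1 h) ->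
  (\int[@lebesgue_measure R]_x (derive1 h x)%:E = 0)%E.
Proof.
move=> dh ch' ih ih'.
have ch : continuous h.
  by move=> x; apply: differentiable_continuous; apply/derivable1_diffP.
have mh : measurable_fun setT (fun x => `|(h x)%:E|)%E.
  apply: measurableT_comp => //; apply/measurable_EFinP.
  exact: continuous_measurable_fun.
(* If |h| > e on an interval of length m = (|C| + 1) / e, the integral there would exceed [C], the
   integral of |h| over the line. *)
have small (a e : R) : 0 < e -> exists m, 0 < m /\ forall b, 
    (forall x, x \in `[b, b + m] -> e < `|h x|) -> False.
  move=> e0.
  pose C := fine (\int[mu]_x `|(h x)%:E|)%E.
  have CE : (\int[mu]_x `|(h x)%:E| = C%:E)%E.
    rewrite /C fineK// ge0_fin_numE ?integral_ge0//.
    by move/integrableP : ih => [].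
  exists ((`|C| + 1) / e); split; first by rewrite divr_gt0// ltr_wpDl.
  set m := _ / e => b hb.
  have m0 : 0 < m by rewrite /m divr_gt0// ltr_wpDl.
  have : (\int[mu]_(x in `[b, (b + m)%R]) (e%:E) <= \int[mu]_x `|(h x)%:E|)%E.
    apply: (@le_trans _ _ (\int[mu]_(x in `[b, (b + m)%R]) `|(h x)%:E|)%E).
      apply: ge0_le_integral => //.
      - by move=> x _; rewrite lee_fin ltW.
      - exact: measurable_funTS.
      - by move=> x xb; rewrite lee_fin ltW// hb.
    exact: ge0_subset_integral.
  rewrite integral_cst//= lebesgue_measure_itv/= lte_fin ltrDl m0.
  rewrite -EFinB addrAC subrr add0r -EFinM CE lee_fin /m mulrCA divff ?mulr1 ?gt_eqF//.
  by have := ler_norm C; lra.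
have near_pt (n : nat) : exists p : R * R, n%:R <= p.1 /\ p.2 <= - n%:R /\
    `|h p.1| <= n.+1%:R^-1 /\ `|h p.2| <= n.+1%:R^-1.
  have [m [m0 hm]] := small 0 n.+1%:R^-1 ltac:(by rewrite invr_gt0).
  have [x [hx1 hx2]] : exists x, n%:R <= x /\ `|h x| <= n.+1%:R^-1.
    apply: contrapT => hn; apply: (hm n%:R) => x; rewrite in_itv/= => /andP[nx _].
    by rewrite ltNge; apply/negP => hx; apply: hn; exists x.
  have [y [hy1 hy2]] : exists y, y <= - n%:R /\ `|h y| <= n.+1%:R^-1.
    apply: contrapT => hn; apply: (hm (- n%:R - m)) => z.
    rewrite in_itv/= => /andP[_ nx]; rewrite ltNge; apply/negP => hx; apply: hn.
    by exists z; split => //; move: nx; rewrite subrK.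
  by exists (x, y).
have [p hp] := choice near_pt.
pose I n : set R := `[(p n).2, (p n).1]%classic.
have FTC n : (\int[mu]_(x in I n) (derive1 h x)%:E = (h (p n).1)%:E - (h (p n).2)%:E)%E.
  have [h1 [h2 _]] := hp n.
  have : (p n).2 <= (p n).1.
    by apply: le_trans h2 (le_trans _ h1); rewrite lerNl (le_trans (y := 0))// oppr_le0.
  rewrite le_eqVlt => /predU1P[e|lt].
    by rewrite /I e set_itv1 integral_set1 -EFinB subrr.
  apply: (@continuous_FTC2 R (derive1 h) h _ _ lt).
  - exact: continuous_subspaceT.
  - split; first by move=> x _; exact: dh.
      exact: cvg_at_right_filter (ch _).
    exact: cvg_at_left_filter (ch _).
  - by move=> x _.
have cv0 : (\int[mu]_(x in I n) (derive1 h x)%:E)%E @[n --> \oo] --> (0 : \bar R)%E.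
  under eq_fun do rewrite FTC -EFinB.
  apply: cvg_EFin; first by near=> n.
  rewrite (_ : fine \o _ = fun n => h (p n).1 - h (p n).2); last by apply/funext.
  apply: norm_cvg0; apply: (@squeeze_cvgr _ _ _ _ (fun=> 0) (fun n : nat => 2 * n.+1%:R^-1)).
  - near=> n; rewrite normr_ge0/= (le_trans (ler_normB _ _))//.
    by have [_ [_ [h3 h4]]] := hp n; rewrite mulr_natl mulr2n lerD.
  - exact: cvg_cst.
  - rewrite -(mulr0 2); apply: cvgM; [exact: cvg_cst|exact: cvg_harmonic].
have mI n : measurable (I n) by exact: measurable_itv.
have mf : measurable_fun setT (EFin \o derive1 h).
  by apply/measurable_EFinP; exact: continuous_measurable_fun.
have [_ _ cv1] : [/\ mu.-integrable setT (EFin \o derive1 h),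
    [sequence \int[mu]_x `|((EFin \o derive1 h) \_ (I n)) x - (derive1 h x)%:E|]_n @ \oo --> 0 &
    [sequence \int[mu]_x (((EFin \o derive1 h) \_ (I n)) x)]_n @ \oo -->
      \int[mu]_x (derive1 h x)%:E]%E.
  apply: (@dominated_convergence _ _ _ mu setT measurableT
    (fun n => (EFin \o derive1 h) \_ (I n)) (EFin \o derive1 h)
    (abse \o (EFin \o derive1 h))) => //.
  - by move=> n; apply/(measurable_restrictT _ (mI n)); exact: measurable_funTS.
  - apply: aeW => x _; apply: cvg_near_cst; near=> n.
    rewrite /patch ifT// inE /I/= in_itv/=; have [h1 [h2 _]] := hp n.
    have : `|x| <= n%:R by near: n; exact: nbhs_infty_ger.
    by rewrite ler_norml => /andP[n1 n2]; rewrite (le_trans h2 n1) (le_trans n2 h1).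
  - exact: integrable_abse.
  - apply: aeW => x n _; rewrite /patch; case: ifP => //= _.
    by rewrite normr0 lee_fin.
apply: (cvg_unique _ _ cv0) => //.
have -> : (fun n => \int[mu]_(x in I n) (derive1 h x)%:E)%E =
    [sequence \int[mu]_x (((EFin \o derive1 h) \_ (I n)) x)]_n%E.
  by apply/funext => n; rewrite integral_mkcond.
exact: cv1.
Unshelve. all: by end_near. Qed.

(** * Taylor expansions *)

Section MatrixNorm.
Context {R : realType} {m n : nat}.
Implicit Types A : 'M[R]_(m, n).

Lemma norm_entry A i j : `|A i j| <= `|A|.
Proof.
rewrite [leRHS](mx_normrE A) -[leLHS]/((fun ij : 'I_m * 'I_n => `|A ij.1 ij.2|) (i, j)).
exact: le_bigmax.
Qed.

Lemma norm_le_entries A (c : R) : 0 <= c -> (forall i j, `|A i j| <= c) -> `|A| <= c.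
Proof. by move=> c0 h; rewrite [leLHS](mx_normrE A); apply: bigmax_le => // -[i j] _; exact: h. Qed.

End MatrixNorm.

Section Lines.
Context {R : realType} {V : normedModType R}.

Lemma is_derive_line (f : V -> R) (t v : V) (a D : R) :
  is_derive (a *: v + t) v f D -> is_derive a 1 (fun h : R => f (h *: v + t)) D.
Proof.
move=> df.
have e : (fun h : R => h^-1 *: (((fun h : R => f (h *: v + t)) \o shift a) (h *: 1) -
    f (a *: v + t))) = (fun h => h^-1 *: ((f \o shift (a *: v + t)) (h *: v) - f (a *: v + t))).
  apply/funext => h /=; congr (_ *: (f _ - _)).
  by rewrite /shift/= scalerDl addrA scaler1.
split; first by rewrite /derivable e; exact: (@ex_derive _ _ _ _ _ _ _ df).
by rewrite /derive e; exact: (@derive_val _ _ _ _ _ _ _ df).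
Qed.

Lemma is_derive_line0 (f : V -> R) (t v : V) (D : R) :
  is_derive (0 : R) 1 (fun h : R => f (h *: v + t)) D -> is_derive t v f D.
Proof.
move=> df.
have e : (fun h : R => h^-1 *: (((fun h : R => f (h *: v + t)) \o shift 0) (h *: 1) -
    f (0 *: v + t))) = (fun h => h^-1 *: ((f \o shift t) (h *: v) - f t)).
  apply/funext => h /=; congr (_ *: (f _ - f _)); last by rewrite scale0r add0r.
  by rewrite addr0 scaler1.
split; first by rewrite /derivable -e; exact: (@ex_derive _ _ _ _ _ _ _ df).
by rewrite /derive -e; exact: (@derive_val _ _ _ _ _ _ _ df).
Qed.

Lemma is_derive_compR (F : R -> R) (s : V -> R) (t v : V) (a b : R) :
  is_derive (s t) 1 F a -> is_derive t v s b -> is_derive t v (F \o s) (a * b).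
Proof.
move=> dF ds; apply: is_derive_line0.
have ds' : is_derive (0 : R) 1 (fun h : R => s (h *: v + t)) b.
  by apply: is_derive_line; rewrite scale0r add0r.
apply: (@is_derive1_comp _ F (fun h : R => s (h *: v + t))) => //.
by rewrite scale0r add0r.
Qed.

Lemma MVT_line (f : V -> R) (t v : V) (a c K : R) :
  (forall h, `|h| <= `|a| -> exists D, is_derive (h *: v + t) v f D /\ `|D - c| <= K) ->
  `|f (a *: v + t) - f t - a * c| <= K * `|a|.
Proof.
move=> H; pose k h := f (h *: v + t).
have /choice[D hD] : forall h, exists D, `|h| <= `|a| ->
    is_derive (h *: v + t) v f D /\ `|D - c| <= K.
  move=> h; have [ha|] := boolP (`|h| <= `|a|); last by exists 0.
  by have [D hD] := H h ha; exists D.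
have dk (h : R) : `|h| <= `|a| -> is_derive h 1 k (D h).
  by move=> ha; apply: is_derive_line; case: (hD h ha).
have ck (x y : R) : (forall h, h \in `[x, y] -> `|h| <= `|a|) ->
    {within `[x, y], continuous k}.
  move=> xy; apply: derivable_within_continuous => h hxy.
  by have [] := dk h (xy h hxy).
have k0 : k 0 = f t by rewrite /k scale0r add0r.
have [a0|a0] := leP 0 a.
  have sub h : h \in `[0, a] -> `|h| <= `|a|.
    by rewrite in_itv/= => /andP[? ?]; rewrite !ger0_norm// (le_trans _ a0).
  have dkI x : x \in `]0, a[ -> is_derive x 1 k (D x).
    by move=> xa; apply/dk/sub/subset_itv_oo_cc.
  have [x xa] := MVT_segment a0 dkI (ck _ _ sub).
  rewrite -/(k a) k0 subr0 => ->; rewrite [a * c]mulrC -mulrBl normrM.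
  by rewrite ler_wpM2r//; have [] := hD x (sub _ xa).
have sub h : h \in `[a, 0] -> `|h| <= `|a|.
  rewrite in_itv/= => /andP[? ?]; rewrite !ler0_norm ?lerN2//; exact: ltW.
have dkI x : x \in `]a, 0[ -> is_derive x 1 k (D x).
  by move=> xa; apply/dk/sub/subset_itv_oo_cc.
have [x xa] := MVT_segment (ltW a0) dkI (ck _ _ sub).
rewrite k0 -/(k a) => e.
have -> : k a - f t - a * c = (D x - c) * a.
  by rewrite -[k a - f t]opprB e sub0r mulrN opprK mulrBl [a * c]mulrC.
by rewrite normrM ler_wpM2r//; have [] := hD x (sub _ xa).
Qed.

End Lines.

Section Cube.
Context {R : realType} {d : nat}.
Implicit Types (t u : 'rV[R]_d) (f : 'rV[R]_d -> R).

(* Move from t to t + u one coordinate at a time, so that only partial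
   derivatives at points of the cube are needed. *)
Lemma cube_increment f t u (c : 'I_d -> R) (K : R) :
  (forall t' i, `|t' - t| <= `|u| ->
     derivable f t' (uvec i) /\ `|part i f t' - c i| <= K) ->
  `|f (t + u) - f t - \sum_i u 0 i * c i| <= d%:R * K * `|u|.
Proof.
move=> H.
pose p m : 'rV[R]_d := \row_j (t 0 j + (if (j < m)%N then u 0 j else 0)).
have p0 : p 0%N = t by apply/rowP => j; rewrite mxE addr0.
have pd : p d = t + u by apply/rowP => j; rewrite !mxE ltn_ord.
have pS (i : 'I_d) : p i.+1 = u 0 i *: uvec i + p i.
  apply/rowP => j; rewrite !mxE eqxx/= ltnS leq_eqVlt addrCA; congr (_ + _).
  have [->|ji] := eqVneq j i; first by rewrite eqxx/= mulr1 ltnn addr0.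
  by rewrite (_ : (j == i :> nat) = false) ?mulr0 ?add0r//; apply/negbTE.
have step (i : 'I_d) : `|f (p i.+1) - f (p i) - u 0 i * c i| <= K * `|u|.
  have K0 : 0 <= K.
    have [|_] := H t i; first by rewrite subrr normr0.
    exact: le_trans.
  rewrite pS; apply: (@le_trans _ _ (K * `|u 0 i|)); last first.
    by rewrite ler_wpM2l// norm_entry.
  apply: MVT_line => h hu.
  have [|dq hq] := H (h *: uvec i + p i) i; last first.
    by exists (part i f (h *: uvec i + p i)); split => //; exact: derivableP.
  apply: norm_le_entries => // r j; rewrite (ord1 r) !mxE eqxx/=.
  rewrite [_ + (t 0 j + _)]addrCA [t 0 j + _]addrC addrK.
  have [->|ji] := eqVneq j i.
    by rewrite ltnn addr0 mulr1 (le_trans hu)// norm_entry.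
  rewrite mulr0 add0r; case: ifP => _; last by rewrite normr0.
  exact: norm_entry.
have -> : f (t + u) - f t = \sum_(i < d) (f (p i.+1) - f (p i)).
  rewrite -pd -{1}p0.
  by rewrite -(big_mkord xpredT (fun i => f (p i.+1) - f (p i))) telescope_sumr.
rewrite -sumrB (le_trans (ler_norm_sum _ _ _))//.
rewrite (le_trans (ler_sum _ (fun i _ => step i)))// sumr_const card_ord.
by rewrite -mulrA mulr_natl.
Qed.

(** [cube_increment] is used twice: each partial derivative moves by at most d K |u| in the cube,
    and then [f] is expanded with its partials frozen at [t]. *)
Lemma cube_taylor f t u (K : R) :
  (forall t' i j, `|t' - t| <= `|u| -> [/\ derivable f t' (uvec i),
     derivable (part i f) t' (uvec j) & `|part j (part i f) t'| <= K]) ->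
  `|f (t + u) - f t - \sum_i u 0 i * part i f t| <= d%:R ^+ 2 * K * `|u| ^+ 2.
Proof.
move=> H.
have -> : d%:R ^+ 2 * K * `|u| ^+ 2 = d%:R * (d%:R * K * `|u|) * `|u| by ring.
apply: cube_increment => t' i t'u.
have [//|K0 _] := H t' i i; split => //.
have h := @cube_increment (part i f) t (t' - t) (fun=> 0) K.
rewrite [t + _]addrC subrK big1 ?subr0 in h; last by move=> j _; rewrite mulr0.
apply: le_trans (h _) _.
  by move=> t'' j t''t; have [_ ? ?] := H t'' i j (le_trans t''t t'u); rewrite subr0.
by rewrite ler_wpM2l// mulr_ge0//; have [_ _] := H t' i i t'u; exact: le_trans.
Qed.

End Cube.

(** * Derivatives of the log-density *)

(** A pointwise limit of difference quotients with steps 1 / (n + 1). The index shift by [N] keeps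
    the displaced parameter in [Theta], where measurability in x is assumed. *)
Lemma measurable_part {R : realType} {d : nat} (Theta : set 'rV[R]_d)
    (F : 'rV[R]_d -> R -> R) (t : 'rV[R]_d) (i : 'I_d) : open Theta -> Theta t ->
  (forall t, Theta t -> measurable_fun setT (F t)) ->
  (forall x, derivable (F^~ x) t (uvec i)) ->
  measurable_fun setT (fun x => part i (F^~ x) t).
Proof.
move=> oT Tt mF dF.
pose h n : R := n.+1%:R^-1.
have h0 : h n @[n --> \oo] --> (0 : R) by exact: cvg_harmonic.
have hT : h n *: uvec i + t @[n --> \oo] --> t.
  have : h n *: uvec i + t @[n --> \oo] --> 0 *: uvec i + t.
    by apply: cvgD; [exact: cvgZr_tmp|exact: cvg_cst].
  by rewrite scale0r add0r.
have [N _ hN] : \forall n \near \oo, Theta (h n *: uvec i + t).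
  by apply: hT; exact: open_nbhs_nbhs.
pose f n x := (h (n + N)%N)^-1 * (F (h (n + N)%N *: uvec i + t) x - F t x).
apply: (@measurable_fun_cvg _ _ _ setT f).
  move=> n; apply: measurable_funM => //; apply: measurable_funB; apply: mF => //.
  by apply: hN => /=; rewrite leq_addl.
move=> x _.
have c : (fun h0 : R => h0^-1 *: ((F^~ x \o shift t) (h0 *: uvec i) - F t x)) @ 0^'
    --> part i (F^~ x) t by exact: dF.
have c2 : h n @[n --> \oo] --> 0^'.
  move=> A; rewrite /= /dnbhs => -[e/= e0 hA].
  have /cvgrPdist_lt/(_ e e0) := h0.
  by apply: filterS => n hn; apply: hA => //; rewrite invr_eq0 pnatr_eq0.
have := cvg_comp _ _ c2 c.
rewrite -(cvg_shiftn N); apply: cvg_trans; apply: near_eq_cvg; near=> n.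
by rewrite /f /= .
Unshelve. all: by end_near. Qed.

(** The derivative of ln g; [dscore] is the second derivative. *)
Definition score {R : realType} (g : R -> R) (x : R) : R := derive1 g x / g x.

Definition dscore {R : realType} (g : R -> R) (x : R) : R :=
  derive1 (derive1 g) x / g x - score g x ^+ 2.

Section Score.
Context {R : realType} (g : R -> R).
Hypotheses (gpos : forall x, 0 < g x) (hg : Ck_R 3 g).

Let dg (x : R) : is_derive x 1 g (derive1 g x).
Proof.
by case: hg => _ [dg _]; rewrite derive1E; exact/derivableP.
Qed.

Let ddg (x : R) : is_derive x 1 (derive1 g) (derive1 (derive1 g) x).
Proof.
by case: hg => _ [_ [_ [dg' _]]]; rewrite [derive1 (derive1 g) x]derive1E; exact/derivableP.
Qed.

Let dddg (x : R) : is_derive x 1 (derive1 (derive1 g)) (derive1 (derive1 (derive1 g)) x).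
Proof.
case: hg => _ [_ [_ [_ [_ [dg' _]]]]].
by rewrite [derive1 (derive1 (derive1 g)) x]derive1E; exact/derivableP.
Qed.

Let g_neq0 (x : R) : g x != 0. Proof. by rewrite gt_eqF. Qed.

Lemma is_derive_lng (x : R) : is_derive x 1 (fun y => ln (g y)) (score g x).
Proof.
have dl : is_derive (g x) 1 (@ln R) (g x)^-1 by exact: is_derive1_ln.
rewrite /score mulrC; exact: (is_derive1_comp dl (dg x)).
Qed.

Lemma is_derive_quot (f : R -> R) (f' x : R) : is_derive x 1 f f' ->
  is_derive x 1 (fun y => f y / g y) (f' / g x - f x / g x * score g x).
Proof.
move=> df; have dV := is_deriveV (g_neq0 x) (dg x).
apply: (is_derive_eq (is_deriveM df dV)).
by rewrite /score /GRing.scale/=; field; exact: g_neq0.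
Qed.

Lemma is_derive_score (x : R) : is_derive x 1 (score g) (dscore g x).
Proof. by apply: is_derive_eq (is_derive_quot (ddg x)) _; rewrite /dscore expr2. Qed.

Lemma derivable_dscore (x : R) : derivable (dscore g) x 1.
Proof.
have d1 := is_derive_quot (dddg x); have d2 := is_deriveX 2 (is_derive_score x).
exact: (@ex_derive _ _ _ _ _ _ _ (is_deriveB d1 d2)).
Qed.

Lemma measurable_score : measurable_fun setT (score g).
Proof.
apply: continuous_measurable_fun => x; apply: differentiable_continuous.
by apply/derivable1_diffP; exact: (@ex_derive _ _ _ _ _ _ _ (is_derive_score x)).
Qed.

Lemma measurable_dscore : measurable_fun setT (dscore g).
Proof.
apply: continuous_measurable_fun => x; apply: differentiable_continuous.
by apply/derivable1_diffP; exact: derivable_dscore.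
Qed.

Lemma score_g x : score g x * g x = derive1 g x.
Proof. by rewrite /score divfK. Qed.

(** The source of the information identity: against the noise density this combination integrates
    like g'', that is, to zero. *)
Lemma dscore_g x : (dscore g x + score g x ^+ 2) * g x = derive1 (derive1 g) x.
Proof. by rewrite /dscore subrK divfK. Qed.

End Score.

Section Ell.
Context {R : realType} {d : nat} (Theta : set 'rV[R]_d) (S : 'rV[R]_d -> R -> R)
  (g : R -> R).
Hypotheses (oT : open Theta) (hS : forall x, Ck_on 3 Theta (S^~ x)).
Hypotheses (gpos : forall x, 0 < g x) (hg : Ck_R 3 g).

Definition dS (t : 'rV[R]_d) (i : 'I_d) (x : R) : R := part i (S^~ x) t.
Definition ddS (t : 'rV[R]_d) (i j : 'I_d) (x : R) : R := part j (part i (S^~ x)) t.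

Let isdS t i x : Theta t -> is_derive t (uvec i) (S^~ x) (dS t i x).
Proof. by move=> Tt; apply: derivableP; case: (hS x) => _ /(_ i)[+ _]; exact. Qed.

Let isddS t i j x : Theta t -> is_derive t (uvec j) (fun t => dS t i x) (ddS t i j x).
Proof.
by move=> Tt; apply: derivableP; case: (hS x) => _ /(_ i)[_] [_] /(_ j)[+ _]; exact.
Qed.

Let derdddS t i j k x : Theta t -> derivable (fun t => ddS t i j x) t (uvec k).
Proof.
by move=> Tt; case: (hS x) => _ /(_ i)[_] [_] /(_ j)[_] [_] /(_ k)[+ _]; exact.
Qed.

Let is_derive_res (F : R -> R) (a : R) t i x x' : Theta t ->
  is_derive (x' - S t x) 1 F a ->
  is_derive t (uvec i) (fun t => F (x' - S t x)) (- (a * dS t i x)).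
Proof.
move=> Tt dF; rewrite -mulrN.
apply: (@is_derive_compR _ _ F (fun t => x' - S t x) t (uvec i) _ _ dF).
apply: is_derive_eq (is_deriveB (is_derive_cst x' t (uvec i)) (isdS i x Tt)) _.
by rewrite sub0r.
Qed.

Let nearT t (f f' : 'rV[R]_d -> R) : Theta t -> (forall t, Theta t -> f t = f' t) ->
  \near t, f t = f' t.
Proof.
move=> Tt ff'; have := open_nbhs_nbhs (conj oT Tt).
by apply: filterS => u Tu; exact: ff'.
Qed.

Lemma is_derive_ell t i x x' : Theta t ->
  is_derive t (uvec i) (ell S g x x') (- (score g (x' - S t x) * dS t i x)).
Proof.
move=> Tt; exact: (is_derive_res (F := fun y => ln (g y)) i Tt (is_derive_lng gpos hg _)).
Qed.

Lemma part_ell t i x x' : Theta t ->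
  part i (ell S g x x') t = - (score g (x' - S t x) * dS t i x).
Proof. by move=> Tt; exact: (@derive_val _ _ _ _ _ _ _ (is_derive_ell i x x' Tt)). Qed.

Lemma is_derive_part_ell t i j x x' : Theta t ->
  is_derive t (uvec j) (part i (ell S g x x'))
    (dscore g (x' - S t x) * (dS t i x * dS t j x) - score g (x' - S t x) * ddS t i j x).
Proof.
move=> Tt; apply: (near_eq_is_derive (f := fun t => - (score g (x' - S t x) * dS t i x))).
  by apply: nearT => // u Tu; rewrite part_ell.
have d1 := is_derive_res j Tt (is_derive_score gpos hg (x' - S t x)).
apply: is_derive_eq (is_deriveN (is_deriveM d1 (isddS i j x Tt))) _.
by rewrite /GRing.scale/=; ring.
Qed.

Lemma part_part_ell t i j x x' : Theta t ->
  part j (part i (ell S g x x')) t =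
  dscore g (x' - S t x) * (dS t i x * dS t j x) - score g (x' - S t x) * ddS t i j x.
Proof. by move=> Tt; exact: (@derive_val _ _ _ _ _ _ _ (is_derive_part_ell i j x x' Tt)). Qed.

Lemma derivable_part_part_ell t i j k x x' : Theta t ->
  derivable (part j (part i (ell S g x x'))) t (uvec k).
Proof.
move=> Tt; apply: (near_eq_derivable (f := fun t =>
   dscore g (x' - S t x) * (dS t i x * dS t j x) - score g (x' - S t x) * ddS t i j x)).
  by apply: nearT => // u Tu; rewrite part_part_ell.
have d1 := is_derive_res k Tt (is_derive_score gpos hg (x' - S t x)).
have d2 := is_derive_res k Tt (derivableP (@derivable_dscore _ _ gpos hg (x' - S t x))).
apply: derivableB; apply: derivableM.
- exact: (@ex_derive _ _ _ _ _ _ _ d2).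
- apply: derivableM; [exact: (@ex_derive _ _ _ _ _ _ _ (isddS i k x Tt))|
    exact: (@ex_derive _ _ _ _ _ _ _ (isddS j k x Tt))].
- exact: (@ex_derive _ _ _ _ _ _ _ d1).
- exact: derdddS.
Qed.

Lemma dl1E t x x' i : Theta t ->
  dl1 S g t x x' 0 i = - (score g (x' - S t x) * dS t i x).
Proof. by move=> Tt; rewrite mxE part_ell. Qed.

Lemma dl2E t x x' i j : Theta t -> dl2 S g t x x' i j =
  dscore g (x' - S t x) * (dS t i x * dS t j x) - score g (x' - S t x) * ddS t i j x.
Proof. by move=> Tt; rewrite mxE part_part_ell. Qed.

Lemma dl1_taylor t u x x' i (K : R) :
  (forall t', `|t' - t| <= `|u| -> Theta t') ->
  (forall t' i j k, `|t' - t| <= `|u| -> `|dl3 S g t' x x' i j k| <= K) ->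
  `|dl1 S g (t + u) x x' 0 i - dl1 S g t x x' 0 i -
    \sum_j u 0 j * dl2 S g t x x' i j| <= d%:R ^+ 2 * K * `|u| ^+ 2.
Proof.
move=> hT hK; rewrite 2!mxE; under eq_bigr do rewrite mxE.
apply: cube_taylor => t' j k t't; split; last exact: hK.
- exact: (@ex_derive _ _ _ _ _ _ _ (is_derive_part_ell i j x x' (hT _ t't))).
- by apply: derivable_part_part_ell; exact: hT.
Qed.

Hypothesis mS : forall t, Theta t -> measurable_fun setT (S t).

Lemma measurable_dS t i : Theta t -> measurable_fun setT (dS t i).
Proof.
move=> Tt; apply: (measurable_part oT Tt) => // x.
exact: (@ex_derive _ _ _ _ _ _ _ (isdS i x Tt)).
Qed.

Lemma measurable_ddS t i j : Theta t -> measurable_fun setT (ddS t i j).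
Proof.
move=> Tt; apply: (measurable_part (F := fun t => dS t i) oT Tt).
  by move=> u Tu; exact: measurable_dS.
by move=> x; exact: (@ex_derive _ _ _ _ _ _ _ (isddS i j x Tt)).
Qed.

Section Compose.
Context {d'} {U : measurableType d'} (V W : U -> R).
Hypotheses (mV : measurable_fun setT V) (mW : measurable_fun setT W).

Let mres t : Theta t -> measurable_fun setT (fun w => W w - S t (V w)).
Proof.
by move=> Tt; apply: measurable_funB => //; apply: measurableT_comp => //; exact: mS.
Qed.

Lemma measurable_dl1 t i : Theta t ->
  measurable_fun setT (fun w => dl1 S g t (V w) (W w) 0 i).
Proof.
move=> Tt; under eq_fun do rewrite dl1E//.
apply: measurable_funN; apply: measurable_funM.
  by apply: (measurableT_comp (measurable_score gpos hg)); exact: mres.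
by apply: (measurableT_comp (measurable_dS i Tt)).
Qed.

Lemma measurable_dl2 t i j : Theta t ->
  measurable_fun setT (fun w => dl2 S g t (V w) (W w) i j).
Proof.
move=> Tt; under eq_fun do rewrite dl2E//.
apply: measurable_funB; apply: measurable_funM.
- by apply: (measurableT_comp (measurable_dscore gpos hg)); exact: mres.
- by apply: measurable_funM; apply: (measurableT_comp (measurable_dS _ Tt)).
- by apply: (measurableT_comp (measurable_score gpos hg)); exact: mres.
- by apply: (measurableT_comp (measurable_ddS _ _ Tt)).
Qed.

End Compose.
End Ell.

(** * Lindeberg's replacement by a random walk *)

(** Measurability is tested on vectors with measurable coordinates over an arbitrary space [U], so
    that one hypothesis serves both the full sigma-algebra and that of the past. *)
Definition coord_measurable {R : realType} {d : nat} (h : 'rV[R]_d -> R) : Prop :=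
  forall d' (U : measurableType d') (v : 'I_d -> U -> R),
    (forall i, measurable_fun setT (v i)) ->
    measurable_fun setT (fun w => h (\row_i v i w)).

(* [G] and [H] play the role of the gradient and of the Hessian of [f]. *)
Record test_data {R : realType} {d : nat} (B : R) (f : 'rV[R]_d -> R)
    (G : 'I_d -> 'rV[R]_d -> R) (H : 'I_d -> 'I_d -> 'rV[R]_d -> R) : Prop := {
  td_mf : coord_measurable f;
  td_mG : forall a, coord_measurable (G a);
  td_mH : forall a b, coord_measurable (H a b);
  td_f : forall x, `|f x| <= B;
  td_G : forall a x, `|G a x| <= B;
  td_H : forall a b x, `|H a b x| <= B;
  td_lipf : forall x v, `|f (x + v) - f x| <= B * `|v|;
  td_lipG : forall a x v, `|G a (x + v) - G a x| <= B * `|v|;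
  td_lip : forall a b x v, `|H a b (x + v) - H a b x| <= B * `|v|;
  td_taylor : forall x v, `|v| <= 1 ->
    `|f (x + v) - f x - \sum_a G a x * v 0 a
       - 2^-1 * \sum_a \sum_b H a b x * (v 0 a * v 0 b)| <= B * `|v| ^+ 3 }.

Lemma measurable_mxnorm {d0} {U : measurableType d0} {R : realType} {m n : nat}
    (M : U -> 'M[R]_(m, n)) : (forall i j, measurable_fun setT (fun w => M w i j)) ->
  measurable_fun setT (fun w => `|M w|).
Proof.
move=> mM; rewrite (_ : (fun w => _) = fun w => \big[Num.max/0]_ij `|M w ij.1 ij.2|); last first.
  apply/funext => w; apply/eqP; rewrite eq_le; apply/andP; split.
    apply: norm_le_entries; first by apply: bigmax_ge_id.
    move=> i j; rewrite -[leLHS]/((fun ij : 'I_m * 'I_n => `|M w ij.1 ij.2|) (i, j)).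
    exact: le_bigmax.
  by apply: bigmax_le => // -[i j] _; exact: norm_entry.
elim: (index_enum _) => [|i l IH].
  by rewrite (_ : (fun w => _) = fun=> 0)//; apply/funext => w; rewrite big_nil.
rewrite (_ : (fun w => _) = fun w => Num.max `|M w i.1 i.2|
    (\big[Num.max/0]_(ij <- l) `|M w ij.1 ij.2|)).
  by apply: measurable_maxr => //; apply: measurableT_comp.
by apply/funext => w; rewrite big_cons.
Qed.

Section Average.
Context {R : realType} {d N : nat} (bs : 'I_N -> 'rV[R]_d).
Hypothesis N0 : (0 < N)%N.

Definition avg (F : 'I_N -> R) : R := N%:R^-1 * \sum_i F i.

Lemma avg_le (F G : 'I_N -> R) : (forall i, F i <= G i) -> avg F <= avg G.
Proof. by move=> h; rewrite /avg ler_wpM2l ?invr_ge0//; apply: ler_sum => i _. Qed.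

Lemma avg_norm (F : 'I_N -> R) : `|avg F| <= avg (fun i => `|F i|).
Proof.
by rewrite /avg normrM ger0_norm ?invr_ge0// ler_wpM2l ?invr_ge0// ler_norm_sum.
Qed.

Lemma avgc (c : R) : avg (fun=> c) = c.
Proof.
by rewrite /avg sumr_const card_ord -[c *+ N]mulr_natl mulrA mulVf ?mul1r// pnatr_eq0 -lt0n.
Qed.

Lemma avgD F G : avg (fun i => F i + G i) = avg F + avg G.
Proof. by rewrite /avg big_split/= mulrDr. Qed.

Lemma avgZ c F : avg (fun i => c * F i) = c * avg F.
Proof. by rewrite /avg -mulr_sumr mulrCA. Qed.

Lemma avg_sum (n : nat) (F : 'I_n -> 'I_N -> R) :
  avg (fun i => \sum_k F k i) = \sum_k avg (F k).
Proof. by rewrite /avg exchange_big/= mulr_sumr. Qed.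

Lemma avg_bound F c : (forall i, `|F i| <= c) -> `|avg F| <= c.
Proof.
by move=> h; apply: (le_trans (avg_norm F)); rewrite -[leRHS]avgc; exact: avg_le.
Qed.

(* one step of a random walk whose increments are +- r b_i, i uniform *)
Definition walk (r : R) (h : 'rV[R]_d -> R) (x : 'rV[R]_d) : R :=
  avg (fun i => 2^-1 * (h (x + r *: bs i) + h (x - r *: bs i))).

Definition walk_cov (a b : 'I_d) : R := avg (fun i => bs i 0 a * bs i 0 b).

Lemma walk_bound r h c x : (forall x, `|h x| <= c) -> `|walk r h x| <= c.
Proof.
move=> hc; apply: avg_bound => i; rewrite normrM ger0_norm ?invr_ge0//.
rewrite mulrC ler_pdivrMr// (le_trans (ler_normD _ _))//.
by rewrite mulr_natr mulr2n lerD.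
Qed.

Lemma walkD r f h x : walk r (fun x => f x + h x) x = walk r f x + walk r h x.
Proof. by rewrite /walk -avgD; congr avg; apply/funext => i; ring. Qed.

Lemma walkZ r c h x : walk r (fun x => c * h x) x = c * walk r h x.
Proof. by rewrite /walk -avgZ; congr avg; apply/funext => i; ring. Qed.

Lemma walk_sum r (n : nat) (F : 'I_n -> 'rV[R]_d -> R) x :
  walk r (fun x => \sum_k F k x) x = \sum_k walk r (F k) x.
Proof.
rewrite /walk -avg_sum; congr avg; apply/funext => i.
by rewrite -mulr_sumr big_split.
Qed.

Lemma walk_shift r h v x : walk r h (x + v) = walk r (fun y => h (y + v)) x.
Proof.
rewrite /walk; congr avg; apply/funext => i.
by rewrite addrAC [x + v - _]addrAC.
Qed.

Lemma walk_measurable r h : coord_measurable h -> coord_measurable (walk r h).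
Proof.
move=> mh d' U v mv; rewrite /walk /avg.
apply: measurable_funM => //; apply: measurable_sum => i.
apply: measurable_funM => //; apply: measurable_funD.
  have := mh _ _ (fun a w => v a w + r * bs i 0 a).
  have -> : (fun w => h (\row_i0 (v i0 w + r * bs i 0 i0))) = fun w => h (\row_i0 v i0 w + r *: bs i).
    by apply/funext => w; congr h; apply/rowP => k; rewrite !mxE.
  by apply => a; exact: measurable_funD.
have := mh _ _ (fun a w => v a w - r * bs i 0 a).
have -> : (fun w => h (\row_i0 (v i0 w - r * bs i 0 i0))) = fun w => h (\row_i0 v i0 w - r *: bs i).
  by apply/funext => w; congr h; apply/rowP => k; rewrite !mxE.
by apply => a; exact: measurable_funB.
Qed.

Lemma walk_lip r h (B : R) x v : (forall x v, `|h (x + v) - h x| <= B * `|v|) ->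
  `|walk r h (x + v) - walk r h x| <= B * `|v|.
Proof.
move=> hB; rewrite walk_shift -[_ - _]/(_ + _) -mulN1r -walkZ -walkD.
by apply: walk_bound => y; rewrite mulN1r.
Qed.

(** A walk step averages translations, and every clause of [test_data] is a bound invariant under
    translation. Hence [B] stays the same after any number of steps, which is what allows
    replacement errors to be summed over k steps. *)
Lemma walk_test B f G H r : test_data B f G H ->
  test_data B (walk r f) (fun a => walk r (G a)) (fun a b => walk r (H a b)).
Proof.
move=> td; split.
- exact: walk_measurable (td_mf td).
- by move=> a; exact: walk_measurable (td_mG td a).
- by move=> a b; exact: walk_measurable (td_mH td a b).
- by move=> x; exact: walk_bound (td_f td).
- by move=> a x; exact: walk_bound (td_G td a).
- by move=> a b x; exact: walk_bound (td_H td a b).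
- by move=> x v; apply: walk_lip (td_lipf td).
- by move=> a x v; apply: walk_lip (td_lipG td a).
- by move=> a b x v; apply: walk_lip (td_lip td a b).
- move=> x v v1.
  (* For fixed v the Taylor remainder at y is a linear combination of functions of y, so [walk]
     commutes with forming it. *)
  pose R3 y := f (y + v) + (- 1) * f y + (-1) * (\sum_a v 0 a * G a y) +
    (- 2^-1) * \sum_a \sum_b (v 0 a * v 0 b) * H a b y.
  have R3E y : R3 y = f (y + v) - f y - \sum_a G a y * v 0 a
       - 2^-1 * \sum_a \sum_b H a b y * (v 0 a * v 0 b).
    rewrite /R3 !mulN1r mulNr; congr (_ - _ - _ * _).
      by apply: eq_bigr => a _; rewrite mulrC.
    by apply: eq_bigr => a _; apply: eq_bigr => b _; rewrite mulrC.
  suff -> : walk r f (x + v) - walk r f x - \sum_a walk r (G a) x * v 0 a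
       - 2^-1 * \sum_a \sum_b walk r (H a b) x * (v 0 a * v 0 b) = walk r R3 x.
    by apply: walk_bound => y; rewrite R3E; exact: (td_taylor td).
  rewrite /R3 !(walkD, walkZ, walk_sum) -walk_shift !mulN1r mulNr.
  congr (_ - _ - _ * _).
    by apply: eq_bigr => a _; rewrite walkZ mulrC.
  by apply: eq_bigr => a _; rewrite walk_sum; apply: eq_bigr => b _; rewrite walkZ mulrC.
Qed.

Lemma walk_test_iter B f G H r n : test_data B f G H ->
  test_data B (iter n (walk r) f) (fun a => iter n (walk r) (G a))
    (fun a b => iter n (walk r) (H a b)).
Proof. by move=> td; elim: n => // n IH; exact: walk_test. Qed.

End Average.

Section Taylor.
Context {R : realType} {d : nat} (B : R) (f : 'rV[R]_d -> R)
  (G : 'I_d -> 'rV[R]_d -> R) (H : 'I_d -> 'I_d -> 'rV[R]_d -> R).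
Hypothesis td : test_data B f G H.

Definition rem (x v : 'rV[R]_d) : R := f (x + v) - f x - \sum_a G a x * v 0 a
       - 2^-1 * \sum_a \sum_b H a b x * (v 0 a * v 0 b).

(** The crude bounds of the three parts of the remainder: 2B for the values of [f], d B for the
    gradient and d^2 B for the Hessian, all times |v|^2 when |v| >= 1. *)
Definition cst_rem : R := (2 + d%:R + d%:R ^+ 2) * B.

Lemma td_B0 : 0 <= B. Proof. exact: (le_trans (normr_ge0 _) (td_f td 0)). Qed.

Lemma rem_bound2 x v : 1 <= `|v| -> `|rem x v| <= cst_rem * `|v| ^+ 2.
Proof.
move=> v1; have B0 := td_B0.
have d0 : 0 <= d%:R :> R by [].
have h1 : `|f (x + v) - f x| <= 2 * B.
  apply: (le_trans (ler_normB _ _)).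
  by have := td_f td (x + v); have := td_f td x; lra.
have h2 : `|\sum_a G a x * v 0 a| <= d%:R * (B * `|v|).
  rewrite (le_trans (ler_norm_sum _ _ _))//.
  rewrite (le_trans (ler_sum _ (fun a _ => (_ : _ <= B * `|v|))))//.
    by move=> a; rewrite normrM ler_pM// ?(td_G td)// norm_entry.
  by rewrite sumr_const card_ord mulr_natl.
have h3 : `|\sum_a \sum_b H a b x * (v 0 a * v 0 b)| <= d%:R * (d%:R * (B * `|v| ^+ 2)).
  rewrite (le_trans (ler_norm_sum _ _ _))//.
  rewrite (le_trans (ler_sum _ (fun a _ => (_ : _ <= d%:R * (B * `|v| ^+ 2)))))//.
    move=> a; rewrite (le_trans (ler_norm_sum _ _ _))//.
    rewrite (le_trans (ler_sum _ (fun b _ => (_ : _ <= B * `|v| ^+ 2))))//.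
      move=> b; rewrite !normrM ler_pM// ?mulr_ge0// ?(td_H td)// expr2.
      by rewrite ler_pM// norm_entry.
    by rewrite sumr_const card_ord mulr_natl.
  by rewrite sumr_const card_ord -[leLHS]mulr_natl.
rewrite /rem (le_trans (ler_normB _ _))// normrM ger0_norm ?invr_ge0//.
rewrite (le_trans (lerD (ler_normB _ _) (lexx _)))//.
have v2 : `|v| <= `|v| ^+ 2 by rewrite expr2 ler_peMl.
have v3 : 1 <= `|v| ^+ 2 by rewrite (le_trans v1).
have e1 : 2 * B <= 2 * B * `|v| ^+ 2 by rewrite ler_peMr// mulr_ge0.
have e2 : d%:R * (B * `|v|) <= d%:R * B * `|v| ^+ 2.
  by rewrite -mulrA ler_wpM2l// ler_wpM2l.
have e3 : 2^-1 * (d%:R * (d%:R * (B * `|v| ^+ 2))) <= d%:R ^+ 2 * B * `|v| ^+ 2.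
  rewrite (_ : d%:R ^+ 2 * B * `|v| ^+ 2 = d%:R * (d%:R * (B * `|v| ^+ 2))); last by ring.
  by rewrite ler_piMl ?mulr_ge0// ?exprn_ge0// invf_le1// ler1n.
have i2 : 0 <= 2^-1 :> R by rewrite invr_ge0.
have e4 := ler_wpM2l i2 h3.
have -> : cst_rem * `|v| ^+ 2 = 2 * B * `|v| ^+ 2 + d%:R * B * `|v| ^+ 2 +
    d%:R ^+ 2 * B * `|v| ^+ 2 by rewrite /cst_rem; ring.
apply: lerD; last by exact: le_trans e4 e3.
by apply: lerD; [exact: le_trans h1 e1|exact: le_trans h2 e2].
Qed.

Lemma cst_rem_ge : B <= cst_rem.
Proof.
have B0 := td_B0; have d0 : 0 <= d%:R :> R by [].
by rewrite /cst_rem -[leLHS]mul1r ler_wpM2r//; have := sqr_ge0 (d%:R : R); lra.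
Qed.

(** This and [rem_le2] hold for every v: the cubic bound serves small increments, the quadratic one
    large increments of the score, whose noise factor has only second moments. *)
Lemma rem_le3 x v : `|rem x v| <= cst_rem * `|v| ^+ 3.
Proof.
have B0 := td_B0; have c0 := le_trans B0 cst_rem_ge.
have [v1|/ltW v1] := leP `|v| 1.
  by apply: (le_trans (td_taylor td x v1)); rewrite ler_wpM2r ?exprn_ge0// cst_rem_ge.
apply: (le_trans (rem_bound2 x v1)); rewrite ler_wpM2l//.
by rewrite [leRHS]exprSr ler_peMr// exprn_ge0.
Qed.

Lemma rem_le2 x v : `|rem x v| <= cst_rem * `|v| ^+ 2.
Proof.
have B0 := td_B0; have c0 := le_trans B0 cst_rem_ge.
have [v1|/ltW v1] := leP `|v| 1; last exact: rem_bound2.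
apply: (le_trans (td_taylor td x v1)); rewrite ler_pM ?exprn_ge0// ?cst_rem_ge//.
by rewrite [leLHS]exprSr ler_piMr// exprn_ge0.
Qed.

Context {N : nat} (bs : 'I_N -> 'rV[R]_d).
Hypothesis N0 : (0 < N)%N.

(** Both signs of an increment have the same weight, so the gradient terms cancel and the
    second-order term sees only [walk_cov]. *)
Lemma walk_drift r x : 0 <= r ->
  `|walk bs r f x - f x - 2^-1 * r ^+ 2 * \sum_a \sum_b H a b x * walk_cov bs a b|
  <= cst_rem * r ^+ 3 * avg (fun i => `|bs i| ^+ 3).
Proof.
move=> r0.
have E i : 2^-1 * (f (x + r *: bs i) + f (x - r *: bs i)) = f x +
    2^-1 * r ^+ 2 * (\sum_a \sum_b H a b x * (bs i 0 a * bs i 0 b)) +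
    2^-1 * (rem x (r *: bs i) + rem x (- (r *: bs i))).
  rewrite /rem.
  have -> : \sum_a G a x * (- (r *: bs i)) 0 a = - \sum_a G a x * (r *: bs i) 0 a.
    by rewrite -sumrN; apply: eq_bigr => a _; rewrite !mxE mulrN.
  have q (v : 'rV[R]_d) (c : R) : (forall a, v 0 a = c * bs i 0 a) ->
      \sum_a \sum_b H a b x * (v 0 a * v 0 b) =
      c ^+ 2 * \sum_a \sum_b H a b x * (bs i 0 a * bs i 0 b).
    move=> h; rewrite mulr_sumr; apply: eq_bigr => a _; rewrite mulr_sumr.
    by apply: eq_bigr => b _; rewrite !h; ring.
  rewrite (q (r *: bs i) r); last by move=> a; rewrite mxE.
  rewrite (q (- (r *: bs i)) (- r)); last by move=> a; rewrite !mxE mulNr.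
  by set s := \sum_a _; set s2 := \sum_a _; field.
rewrite /walk; under eq_fun do rewrite E.
rewrite avgD avgD avgc// avgZ avg_sum.
have -> : \sum_a avg (fun i => \sum_b H a b x * (bs i 0 a * bs i 0 b)) =
    \sum_a \sum_b H a b x * walk_cov bs a b.
  apply: eq_bigr => a _; rewrite avg_sum; apply: eq_bigr => b _.
  by rewrite avgZ.
set Q := _ * \sum_a _; set A := avg _.
rewrite (_ : f x + Q + A - f x - Q = A); last by ring.
rewrite -avgZ; apply: (le_trans (avg_norm _)); apply: avg_le => // i.
have c0 : 0 <= cst_rem := le_trans td_B0 cst_rem_ge.
have n3 : `|r *: bs i| ^+ 3 = r ^+ 3 * `|bs i| ^+ 3.
  by rewrite normrZ exprMn (ger0_norm r0).
have := rem_le3 x (r *: bs i); have := rem_le3 x (- (r *: bs i)).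
rewrite normrN n3 mulrA normrM ger0_norm ?invr_ge0// => h1 h2.
rewrite mulrC ler_pdivrMr// (le_trans (ler_normD _ _))// mulr_natr mulr2n.
exact: lerD.
Qed.

Lemma walk_lip0 r (h : 'rV[R]_d -> R) (K : R) x : 0 <= r ->
  (forall x v, `|h (x + v) - h x| <= K * `|v|) ->
  `|walk bs r h x - h x| <= K * r * avg (fun i => `|bs i|).
Proof.
move=> r0 hK; have -> : walk bs r h x - h x =
    avg (fun i => 2^-1 * (h (x + r *: bs i) - h x + (h (x - r *: bs i) - h x))).
  transitivity (walk bs r h x + (-1) * avg (fun _ : 'I_N => h x)).
    by rewrite avgc// mulN1r.
  by rewrite /walk -avgZ -avgD; congr avg; apply/funext => i; field.
rewrite -avgZ; apply: (le_trans (avg_norm _)); apply: avg_le => // i.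
rewrite normrM ger0_norm ?invr_ge0// mulrC ler_pdivrMr//.
rewrite (le_trans (ler_normD _ _))// mulr_natr mulr2n -mulrA.
have e : `|r *: bs i| = r * `|bs i| by rewrite normrZ ger0_norm.
by apply: lerD; apply: (le_trans (hK _ _)); rewrite ?normrN e.
Qed.

End Taylor.

(** * Averaging against slowly varying weights *)

Section Blocks.
Context {dT} {T : measurableType dT} {R : realType} (P : probability T R).
Variables (h D : nat -> T -> R) (B K c2 dl : R) (m : nat).
Hypotheses (mh : forall j, measurable_fun setT (h j)) (hB : forall j w, `|h j w| <= B).
Hypotheses (LD : forall j, L2 P (D j)) (c20 : 0 <= c2) (B0 : 0 <= B) (K0 : 0 <= K).
Hypotheses (D2 : forall j, Ex P (fun w => D j w ^+ 2) <= c2 ^+ 2).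
Hypotheses (hvar : forall j l,
  Ex P (fun w => `|h (j + l)%N w - h j w| * `|D (j + l)%N w|) <= l%:R * K).
Hypotheses (Dsum : forall j, Ex P (fun w => `|\sum_(l < m) D (j + l)%N w|) <= m%:R * dl).
Hypotheses (dl0 : 0 <= dl) (m0 : (0 < m)%N).

Lemma bounded_L1M (F G : T -> R) : measurable_fun setT F -> (forall w, `|F w| <= B) ->
  L1 P G -> L1 P (fun w => F w * G w).
Proof.
move=> mF FB lG; apply: (L1_le _ (L1Z B (L1abs lG))) => [|w].
  by apply: measurable_funM => //; exact: (L1_meas lG).
by rewrite normrM ler_wpM2r.
Qed.

Lemma Ex_abs_le (F : T -> R) (c : R) : L2 P F -> 0 <= c -> Ex P (fun w => F w ^+ 2) <= c ^+ 2 ->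
  Ex P (fun w => `|F w|) <= c.
Proof.
move=> lF c0 Fc; have := Ex_CS_norm lF (L2c P 1) c0 ler01 Fc.
rewrite mulr1 (@eq_Ex _ _ _ _ (fun w => `|F w| * `|1|) (fun w => `|F w|)); last first.
  by move=> w; rewrite normr1 mulr1.
by apply; rewrite Exc.
Qed.

Let LhD j : L1 P (fun w => h j w * D j w).
Proof. by apply: bounded_L1M => //; exact: L2_L1. Qed.

Let hD1 j : `|Ex P (fun w => h j w * D j w)| <= B * c2.
Proof.
rewrite (le_trans (Ex_norm (LhD j)))//.
have l1 := L1abs (L2_L1 (LD j)).
apply: (@le_trans _ _ (Ex P (fun w => B * `|D j w|))).
  apply: Ex_le; [exact: L1abs|exact: L1Z|move=> w].
  by rewrite normrM ler_wpM2r.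
by rewrite ExZ// ler_wpM2l//; apply: Ex_abs_le.
Qed.

Lemma block_sum k : `|\sum_(j < k) Ex P (fun w => h j w * D j w)| <=
  k%:R * (m%:R * K + B * dl) + m%:R * (B * c2).
Proof.
have [n] := ubnP k; elim: n k => // n IH k; rewrite ltnS => kn.
have [km|mk] := ltnP k m.
  apply: (le_trans (ler_norm_sum _ _ _)).
  apply: (@le_trans _ _ (\sum_(j < k) B * c2)); first exact: ler_sum.
  rewrite sumr_const card_ord -[leLHS]mulr_natl -[leLHS]add0r lerD//.
    by rewrite mulr_ge0 ?addr_ge0 ?mulr_ge0.
  by rewrite ler_wpM2r ?mulr_ge0// ler_nat ltnW.
have [k' kE] : exists k', k = (k' + m)%N by exists (k - m)%N; rewrite subnK.
have k'n : (k' < n)%N.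
  by apply: leq_trans kn; rewrite kE -addn1 leq_add2l.
rewrite kE big_split_ord/=; apply: (le_trans (ler_normD _ _)).
have -> : (k' + m)%:R * (m%:R * K + B * dl) + m%:R * (B * c2) =
    (k'%:R * (m%:R * K + B * dl) + m%:R * (B * c2)) + m%:R * (m%:R * K + B * dl).
  by rewrite natrD; ring.
apply: lerD; first exact: IH.
have e : \sum_(i < m) Ex P (fun w => h (k' + i)%N w * D (k' + i)%N w) =
    \sum_(i < m) Ex P (fun w => (h (k' + i)%N w - h k' w) * D (k' + i)%N w) +
    Ex P (fun w => h k' w * \sum_(i < m) D (k' + i)%N w).
  have l2 i : L1 P (fun w => h k' w * D (k' + i)%N w).
    by apply: bounded_L1M => //; exact: L2_L1.
  rewrite (@eq_Ex _ _ _ _ (fun w => h k' w * _) (fun w => \sum_(i < m) h k' w * D (k' + i)%N w)); last first.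
    by move=> w; rewrite mulr_sumr.
  rewrite Ex_sum// -big_split/=; apply: eq_bigr => i _.
  have -> : (fun w => (h (k' + i)%N w - h k' w) * D (k' + i)%N w) =
      fun w => h (k' + i)%N w * D (k' + i)%N w - h k' w * D (k' + i)%N w.
    by apply/funext => w; rewrite mulrBl.
  by rewrite ExB// subrK.
rewrite e mulrDr; apply: (le_trans (ler_normD _ _)); apply: lerD.
  apply: (le_trans (ler_norm_sum _ _ _)).
  apply: (@le_trans _ _ (\sum_(i < m) (m%:R * K))); last first.
    by rewrite sumr_const card_ord -[leLHS]mulr_natl.
  apply: ler_sum => i _; apply: (@le_trans _ _ (i%:R * K)); last first.
    by rewrite ler_wpM2r// ler_nat ltnW.
  apply: le_trans (hvar k' i); apply: (le_trans (Ex_norm _)).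
    apply: (eq_L1 _ (L1B (LhD (k' + i)) (_ : L1 P (fun w => h k' w * D (k' + i)%N w)))).
      by move=> w; rewrite mulrBl.
    by apply: bounded_L1M => //; exact: L2_L1.
  by rewrite le_eqVlt; apply/orP; left; apply/eqP; apply: eq_Ex => w; rewrite normrM.
have lS : L1 P (fun w => \sum_(i < m) D (k' + i)%N w).
  by apply: L1_sum => i _; exact: L2_L1.
apply: (le_trans (Ex_norm (bounded_L1M (mh k') (hB k') lS))).
apply: (@le_trans _ _ (Ex P (fun w => B * `|\sum_(i < m) D (k' + i)%N w|))).
  apply: Ex_le; [by apply: L1abs; exact: bounded_L1M|exact/L1Z/L1abs|move=> w].
  by rewrite normrM ler_wpM2r.
by rewrite ExZ; [rewrite mulrCA ler_wpM2l|exact: L1abs].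
Qed.

End Blocks.

(** * Exchange of score increments for walk steps *)

Section Lindeberg.
Context {dT} {T : measurableType dT} {R : realType} {d : nat} (P : probability T R).
Variables (xi : 'I_d -> nat -> T -> R) (qd : 'I_d -> 'I_d -> nat -> T -> R) (Im : 'M[R]_d).

Definition xv (j : nat) (w : T) : 'rV[R]_d := \row_i xi i j w.
Definition psum (r : R) (j : nat) (w : T) : 'rV[R]_d := r *: \sum_(l < j) xv l w.

Variables (c1 c2 : R) (lam : R -> R).
Hypotheses (c10 : 0 <= c1) (c20 : 0 <= c2).
Hypotheses (Lxi : forall i j, L2 P (xi i j))
  (xi2 : forall i j, Ex P (fun w => xi i j w ^+ 2) <= c1 ^+ 2).
Hypotheses (Lqd : forall a b j, L2 P (qd a b j)).
Hypotheses (D2 : forall a b j, Ex P (fun w => (qd a b j w + Im a b) ^+ 2) <= c2 ^+ 2).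
Hypotheses (xi_mart : forall h r j i (M : R), coord_measurable h -> (forall x, `|h x| <= M) ->
  Ex P (fun w => h (psum r j w) * xi i j w) = 0).
Hypotheses (xi_qd : forall h r j a b (M : R), coord_measurable h -> (forall x, `|h x| <= M) ->
  Ex P (fun w => h (psum r j w) * (xi a j w * xi b j w)) =
  - Ex P (fun w => h (psum r j w) * qd a b j w)).
Hypotheses (xi_min : forall r j, 0 <= r ->
  Ex P (fun w => Num.min (`|xv j w| ^+ 2) (r * `|xv j w| ^+ 3)) <= lam r).
Variables (B : R) (f : 'rV[R]_d -> R)
  (G : 'I_d -> 'rV[R]_d -> R) (H : 'I_d -> 'I_d -> 'rV[R]_d -> R).
Hypothesis td : test_data B f G H.
Variables (N : nat) (bs : 'I_N -> 'rV[R]_d).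
Hypothesis N0 : (0 < N)%N.

Local Notation b1 := (avg (fun i => `|bs i|)).
Local Notation b3 := (avg (fun i => `|bs i| ^+ 3)).
Local Notation cr := (@cst_rem R d B).

Let mxi i j : measurable_fun setT (xi i j). Proof. by case: (Lxi i j). Qed.

Lemma psumS r j w : psum r j.+1 w = psum r j w + r *: xv j w.
Proof. by rewrite /psum big_ord_recr scalerDr. Qed.

Lemma coord_measurable_psum h r j : coord_measurable h ->
  measurable_fun setT (fun w => h (psum r j w)).
Proof.
move=> mh; have := mh _ T (fun a w => r * \sum_(l < j) xi a l w).
have -> : (fun w => h (\row_i (r * \sum_(l < j) xi i l w))) = fun w => h (psum r j w).
  apply/funext => w; congr h; apply/rowP => k; rewrite !mxE summxE; congr (_ * _).
  by apply: eq_bigr => l _; rewrite mxE.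
by apply => a; apply: measurable_funM => //; apply: measurable_sum => l.
Qed.

Lemma measurable_xv_norm j : measurable_fun setT (fun w => `|xv j w|).
Proof.
apply: measurable_mxnorm => i k.
by rewrite (_ : (fun w => _) = xi k j)//; apply/funext => w; rewrite mxE.
Qed.

Let lipH a b x v : `|H a b (x + v) - H a b x| <= B * `|v| := td_lip td a b x v.
Let B0 : 0 <= B := td_B0 td.
Let cr0 : 0 <= cr := le_trans B0 (cst_rem_ge td).

Let mHn r n a b : coord_measurable (iter n (walk bs r) (H a b)).
Proof. exact: (td_mH (walk_test_iter bs N0 r n td) a b). Qed.
Let bHn r n a b x : `|iter n (walk bs r) (H a b) x| <= B.
Proof. exact: (td_H (walk_test_iter bs N0 r n td) a b x). Qed.
Let lipHn r n a b x v : `|iter n (walk bs r) (H a b) (x + v) -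
  iter n (walk bs r) (H a b) x| <= B * `|v|.
Proof. exact: (td_lip (walk_test_iter bs N0 r n td) a b x v). Qed.

Lemma walk_iter_shift r a b n p x : 0 <= r ->
  `|iter (p + n) (walk bs r) (H a b) x - iter n (walk bs r) (H a b) x| <=
  p%:R * (B * r * b1).
Proof.
move=> r0; elim: p => [|p IH]; first by rewrite subrr normr0 mul0r.
rewrite addSn /= -natr1 mulrDl mul1r.
rewrite -[X in `|X - _|](subrK (iter (p + n) (walk bs r) (H a b) x)) -addrA.
rewrite (le_trans (ler_normD _ _))// [leRHS]addrC lerD//.
by apply: walk_lip0.
Qed.

Lemma psum_increment r j l w : 0 <= r ->
  `|psum r (j + l) w - psum r j w| <= r * \sum_(q < l) \sum_i `|xi i (j + q)%N w|.
Proof.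
move=> r0; rewrite /psum -scalerBr normrZ ger0_norm// ler_wpM2l//.
rewrite big_split_ord/= addrAC subrr add0r.
apply: (le_trans (ler_norm_sum _ _ _)); apply: ler_sum => q _.
apply: norm_le_entries; first by apply: sumr_ge0.
move=> z i; rewrite mxE (bigD1 i)//= lerDl; exact: sumr_ge0.
Qed.

Lemma L1_xv2 j : L1 P (fun w => `|xv j w| ^+ 2).
Proof.
apply: (L1_le _ (L1_sum (index_enum 'I_d) (Q := xpredT) (fun i _ => (Lxi i j).2))) => [|w].
  by apply: measurable_funX; exact: measurable_xv_norm.
rewrite ger0_norm ?exprn_ge0//.
have S0 : 0 <= \sum_i xi i j w ^+ 2 by apply: sumr_ge0 => i _; exact: sqr_ge0.
rewrite -[leRHS]sqr_sqrtr// lerXn2r ?nnegrE ?sqrtr_ge0//.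
apply: norm_le_entries => [|z i]; first exact: sqrtr_ge0.
rewrite mxE -sqrtr_sqr ler_wsqrtr// (bigD1 i)//= lerDl.
by apply: sumr_ge0 => l _; exact: sqr_ge0.
Qed.

(** Variation of the Hessian per unit of time, weighted by the centred second derivative: the part
    with [c1] is due to the displacement of the score sum, [b1] to the change in the number of walk
    steps. The factor r makes it vanish with 1 / sqrt k. *)
Definition vcst (r : R) : R := B * r * c2 * (d%:R * c1 + b1).

(** From time j to j + l the score sum moves by l increments and up to l fewer walk steps remain;
    both changes are controlled by the Lipschitz constant [B] common to all iterates. *)
Lemma hessian_variation (r : R) k a b j l : 0 <= r ->
  Ex P (fun w => `|iter (k - (j + l).+1) (walk bs r) (H a b) (psum r (j + l)%N w) -
     iter (k - j.+1) (walk bs r) (H a b) (psum r j w)| *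
     `|qd a b (j + l)%N w + Im a b|) <= l%:R * vcst r.
Proof.
move=> r0; set D := fun w => qd a b (j + l)%N w + Im a b.
have LD : L2 P D by apply: L2D => //; exact: L2c.
have b10 : 0 <= b1 by rewrite /avg mulr_ge0 ?invr_ge0// sumr_ge0.
have LxD q i : L1 P (fun w => `|xi i (j + q)%N w| * `|D w|).
  by apply: L2M; exact: L2abs.
have bound w : `|iter (k - (j + l).+1) (walk bs r) (H a b) (psum r (j + l)%N w) -
     iter (k - j.+1) (walk bs r) (H a b) (psum r j w)| * `|D w| <=
   B * r * (\sum_(q < l) \sum_i `|xi i (j + q)%N w| * `|D w|) + l%:R * (B * r * b1) * `|D w|.
  have -> : \sum_(q < l) \sum_i `|xi i (j + q)%N w| * `|D w| =
      (\sum_(q < l) \sum_i `|xi i (j + q)%N w|) * `|D w|.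
    by rewrite mulr_suml; apply: eq_bigr => q _; rewrite mulr_suml.
  rewrite [B * r * _]mulrA -mulrDl ler_wpM2r//.
  set n1 := (k - (j + l).+1)%N.
  (* Subtraction is truncated: p equals l as long as j + l < k and may be smaller beyond. *)
  have [p [pl ->]] : exists p, (p <= l)%N /\ (k - j.+1 = p + n1)%N.
    by exists (k - j.+1 - n1)%N; rewrite /n1; split; lia.
  rewrite -[X in `|X|](subrKA (iter n1 (walk bs r) (H a b) (psum r j w))).
  rewrite (le_trans (ler_normD _ _))// lerD//.
    have := lipHn r n1 a b (psum r j w) (psum r (j + l) w - psum r j w).
    rewrite [psum r j w + _]addrC subrK => h; apply: (le_trans h).
    by rewrite -mulrA ler_wpM2l// psum_increment.
  rewrite distrC; apply: (le_trans (walk_iter_shift _ _ _ _ _ r0)).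
  by apply: ler_wpM2r; rewrite ?ler_nat// mulr_ge0// mulr_ge0.
have L1s : L1 P (fun w => \sum_(q < l) \sum_i `|xi i (j + q)%N w| * `|D w|).
  by apply: L1_sum => q _; apply: L1_sum => i _.
have L1D' := L1abs (L2_L1 LD).
apply: (@le_trans _ _ (Ex P (fun w => B * r * (\sum_(q < l) \sum_i `|xi i (j + q)%N w| * `|D w|)
    + l%:R * (B * r * b1) * `|D w|))).
  apply: Ex_le => //; last by apply: L1D; exact: L1Z.
  apply: (L1_le _ (L1D (L1Z (B * r) L1s) (L1Z (l%:R * (B * r * b1)) L1D'))) => [|w].
    apply: measurable_funM; apply: measurableT_comp => //; last by case: LD.
    apply: measurable_funB; apply: coord_measurable_psum;
      exact: mHn.
  by rewrite ger0_norm ?mulr_ge0//; exact: bound.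
rewrite (ExD (L1Z (B * r) L1s) (L1Z (l%:R * (B * r * b1)) L1D')) !ExZ//.
have ED : Ex P (fun w => `|D w|) <= c2 by exact: (Ex_abs_le LD c20 (D2 a b (j + l)%N)).
have ES : Ex P (fun w => \sum_(q < l) \sum_i `|xi i (j + q)%N w| * `|D w|) <= l%:R * (d%:R * (c1 * c2)).
  rewrite Ex_sum => [|q]; last exact: L1_sum.
  apply: (@le_trans _ _ (\sum_(q < l) d%:R * (c1 * c2))); last first.
    by rewrite sumr_const card_ord -[leLHS]mulr_natl.
  apply: ler_sum => q _; rewrite Ex_sum//.
  apply: (@le_trans _ _ (\sum_(i < d) (c1 * c2))); last first.
    by rewrite sumr_const card_ord -[leLHS]mulr_natl.
  by apply: ler_sum => i _; exact: (Ex_CS_norm _ LD c10 c20 _ (D2 a b (j + l)%N)).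
have -> : l%:R * vcst r = B * r * (l%:R * (d%:R * (c1 * c2))) + l%:R * (B * r * b1) * c2.
  by rewrite /vcst; ring.
have Br0 : 0 <= B * r := mulr_ge0 B0 r0.
by apply: lerD; apply: ler_wpM2l => //; rewrite mulr_ge0// mulr_ge0.
Qed.

Variable ic : R.
Hypothesis Icov : forall a b, `|Im a b - walk_cov bs a b| <= ic.

(** One score increment is traded for one walk step. The martingale property removes the gradient,
    the information identity turns products of scores into - [qd], and [walk_cov] is exchanged for
    [Im] at cost [ic]. The difference [qd + Im] is kept on the left, being small only after
    averaging over time. *)
Lemma lindeberg_step (r : R) n j : 0 <= r ->
  `|Ex P (fun w => iter n (walk bs r) f (psum r j.+1 w)) -
    Ex P (fun w => iter n.+1 (walk bs r) f (psum r j w)) +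
    2^-1 * r ^+ 2 * \sum_a \sum_b
      Ex P (fun w => iter n (walk bs r) (H a b) (psum r j w) * (qd a b j w + Im a b))|
  <= r ^+ 2 * (2^-1 * d%:R ^+ 2 * B * ic + cr * lam r + cr * r * b3).
Proof.
move=> r0; set Wn := iter n (walk bs r).
have tdn := walk_test_iter bs N0 r n td; rewrite -/Wn in tdn.
pose M w := psum r j w.
have mM h : coord_measurable h -> measurable_fun setT (fun w => h (M w)).
  exact: coord_measurable_psum.
have LM h (K : R) : coord_measurable h -> (forall x, `|h x| <= K) -> L1 P (fun w => h (M w)).
  by move=> mh hK; apply: (@L1_bounded _ _ _ _ _ K) => //; exact: mM.
have LMM h (F : T -> R) : coord_measurable h -> (forall x, `|h x| <= B) -> L1 P F ->
    L1 P (fun w => h (M w) * F w).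
  by move=> mh hK lF; apply: (bounded_L1M (B := B)) => //; exact: mM.
have Lf := LM _ _ (td_mf tdn) (td_f tdn).
have Lf1 : L1 P (fun w => Wn f (psum r j.+1 w)).
  apply: (@L1_bounded _ _ _ _ _ B) => [|w]; last exact: (td_f tdn).
  by apply: coord_measurable_psum; exact: (td_mf tdn).
have LGx a : L1 P (fun w => Wn (G a) (M w) * xi a j w).
  by apply: LMM (td_mG tdn a) (td_G tdn a) _; exact: L2_L1.
have LHx a b : L1 P (fun w => Wn (H a b) (M w) * (xi a j w * xi b j w)).
  by apply: LMM (td_mH tdn a b) (td_H tdn a b) _; exact: L2M.
have LHq a b : L1 P (fun w => Wn (H a b) (M w) * qd a b j w).
  by apply: LMM (td_mH tdn a b) (td_H tdn a b) _; exact: L2_L1.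
have LH a b := LM _ _ (td_mH tdn a b) (td_H tdn a b).
pose s1 w := \sum_a Wn (G a) (M w) * xi a j w.
pose s2 w := \sum_a \sum_b Wn (H a b) (M w) * (xi a j w * xi b j w).
pose s3 w := \sum_a \sum_b Wn (H a b) (M w) * walk_cov bs a b.
pose R1 w := rem (Wn f) (fun a => Wn (G a)) (fun a b => Wn (H a b)) (M w) (r *: xv j w).
pose R2 w := walk bs r (Wn f) (M w) - Wn f (M w) - 2^-1 * r ^+ 2 * s3 w.
have Ls1 : L1 P s1 by apply: L1_sum.
have Ls2 : L1 P s2 by apply: L1_sum => a _; apply: L1_sum.
have Ls3 : L1 P s3.
  apply: L1_sum => a _; apply: L1_sum => b _.
  by apply: eq_L1 (L1Z (walk_cov bs a b) (LH a b)) => w; rewrite mulrC.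
have Lf2 : L1 P (fun w => walk bs r (Wn f) (M w)).
  apply: (LM (walk bs r (Wn f)) B); first by apply: walk_measurable; exact: (td_mf tdn).
  by move=> x; apply: walk_bound => // y; exact: (td_f tdn).
have e1 w : Wn f (psum r j.+1 w) = Wn f (M w) + r * s1 w + 2^-1 * r ^+ 2 * s2 w + R1 w.
  rewrite /R1 /rem psumS -/(M w).
  have -> : \sum_a Wn (G a) (M w) * (r *: xv j w) 0 a = r * s1 w.
    by rewrite /s1 mulr_sumr; apply: eq_bigr => a _; rewrite !mxE mulrCA.
  have -> : \sum_a \sum_b Wn (H a b) (M w) * ((r *: xv j w) 0 a * (r *: xv j w) 0 b) = r ^+ 2 * s2 w.
    rewrite /s2 mulr_sumr; apply: eq_bigr => a _; rewrite mulr_sumr; apply: eq_bigr => b _.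
    by rewrite !mxE; ring.
  by ring.
have LR1 : L1 P R1.
  apply: (eq_L1 _ (L1B (L1B (L1B Lf1 Lf) (L1Z r Ls1)) (L1Z (2^-1 * r ^+ 2) Ls2))) => w.
  by rewrite e1; ring.
have LR2 : L1 P R2 by apply: L1B; [exact: L1B|exact: L1Z].
have Es1 : Ex P s1 = 0.
  rewrite /s1 Ex_sum// big1// => a _.
  exact: (xi_mart r j a (td_mG tdn a) (td_G tdn a)).
have Es2 : Ex P s2 = - \sum_a \sum_b Ex P (fun w => Wn (H a b) (M w) * qd a b j w).
  rewrite /s2 Ex_sum => [|a]; last by apply: L1_sum.
  rewrite -sumrN; apply: eq_bigr => a _; rewrite Ex_sum// -sumrN; apply: eq_bigr => b _.
  exact: (xi_qd r j a b (td_mH tdn a b) (td_H tdn a b)).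
have Es3 : Ex P s3 = \sum_a \sum_b walk_cov bs a b * Ex P (fun w => Wn (H a b) (M w)).
  rewrite /s3 Ex_sum => [|a]; last first.
    by apply: L1_sum => b _; apply: eq_L1 (L1Z (walk_cov bs a b) (LH a b)) => w; rewrite mulrC.
  apply: eq_bigr => a _; rewrite Ex_sum => [|b]; last first.
    by apply: eq_L1 (L1Z (walk_cov bs a b) (LH a b)) => w; rewrite mulrC.
  by apply: eq_bigr => b _; rewrite -ExZ//; apply: eq_Ex => w; rewrite mulrC.
have E1 : Ex P (fun w => Wn f (psum r j.+1 w)) = Ex P (fun w => Wn f (M w)) +
    2^-1 * r ^+ 2 * Ex P s2 + Ex P R1.
  have a1 := L1Z r Ls1; have a2 := L1Z (2^-1 * r ^+ 2) Ls2; have a3 := L1D Lf a1.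
  rewrite (eq_Ex P e1) (ExD (L1D a3 a2) LR1) (ExD a3 a2) (ExD Lf a1).
  by rewrite ExZ// ExZ// Es1 mulr0 addr0.
have E2 : Ex P (fun w => walk bs r (Wn f) (M w)) = Ex P (fun w => Wn f (M w)) +
    2^-1 * r ^+ 2 * Ex P s3 + Ex P R2.
  rewrite (@eq_Ex _ _ _ _ _ (fun w => Wn f (M w) + 2^-1 * r ^+ 2 * s3 w + R2 w)); last first.
    by move=> w; rewrite /R2; ring.
  have a1 := L1Z (2^-1 * r ^+ 2) Ls3.
  by rewrite (ExD (L1D Lf a1) LR2) (ExD Lf a1) ExZ.
have ED : \sum_a \sum_b Ex P (fun w => Wn (H a b) (M w) * (qd a b j w + Im a b)) =
    - Ex P s2 + Ex P s3 + \sum_a \sum_b (Im a b - walk_cov bs a b) * Ex P (fun w => Wn (H a b) (M w)).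
  rewrite Es2 opprK Es3 -!big_split/=; apply: eq_bigr => a _; rewrite -!big_split/=.
  apply: eq_bigr => b _.
  rewrite (@eq_Ex _ _ _ _ _ (fun w => Wn (H a b) (M w) * qd a b j w + Im a b * Wn (H a b) (M w))); last first.
    by move=> w; rewrite mulrDr [_ * Im _ _]mulrC.
  by rewrite ExD ?ExZ//; [ring|exact: L1Z].
set s4 := \sum_a \sum_b (Im a b - _) * _ in ED.
have s4b : `|s4| <= d%:R ^+ 2 * B * ic.
  rewrite /s4 (le_trans (ler_norm_sum _ _ _))//.
  have -> : d%:R ^+ 2 * B * ic = \sum_(a < d) \sum_(b < d) (ic * B).
    by rewrite !sumr_const !card_ord -!mulrnA -[RHS]mulr_natl natrM; ring.
  apply: ler_sum => a _; rewrite (le_trans (ler_norm_sum _ _ _))//; apply: ler_sum => b _.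
  rewrite normrM ler_pM// (le_trans (Ex_norm (LH a b)))// -(Exc P B).
  by apply: Ex_le; [exact: L1abs|exact: L1c|move=> w; exact: (td_H tdn)].
(* Each branch of the minimum is matched by one of the two remainder bounds, with r^2 factored
   out. *)
have R1b : `|Ex P R1| <= cr * r ^+ 2 * lam r.
  apply: (le_trans (Ex_norm LR1)).
  have mx := measurable_xv_norm j.
  have Lmin : L1 P (fun w => Num.min (`|xv j w| ^+ 2) (r * `|xv j w| ^+ 3)).
    apply: (L1_le _ (L1_xv2 j)) => [|w].
      apply: measurable_minr; first exact: measurable_funX.
      by apply: measurable_funM => //; exact: measurable_funX.
    rewrite ger0_norm ?ge_min ?lexx//.
    by rewrite le_min exprn_ge0//= mulr_ge0// exprn_ge0.
  apply: (@le_trans _ _ (Ex P (fun w => cr * r ^+ 2 * Num.min (`|xv j w| ^+ 2) (r * `|xv j w| ^+ 3)))).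
    apply: Ex_le; [exact: L1abs|exact: L1Z|move=> w].
    have h2 := rem_le2 tdn (M w) (r *: xv j w); have h3 := rem_le3 tdn (M w) (r *: xv j w).
    rewrite -/(R1 w) normrZ (ger0_norm r0) exprMn in h2 h3.
    by rewrite -mulrA /Num.min; case: ifP => _; [rewrite mulrA|];
       [move: h2; rewrite mulrA|move: h3; congr (_ <= _); ring].
  by rewrite ExZ// ler_wpM2l ?mulr_ge0 ?exprn_ge0//; exact: xi_min.
have R2b : `|Ex P R2| <= cr * r ^+ 3 * b3.
  apply: (le_trans (Ex_norm LR2)); rewrite -(Exc P (cr * r ^+ 3 * b3)).
  by apply: Ex_le; [exact: L1abs|exact: L1c|move=> w; by apply: (walk_drift tdn)].
rewrite -/(M _) /= -/Wn E1 E2 ED.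
have -> : Ex P (fun w => Wn f (M w)) + 2^-1 * r ^+ 2 * Ex P s2 + Ex P R1 -
    (Ex P (fun w => Wn f (M w)) + 2^-1 * r ^+ 2 * Ex P s3 + Ex P R2) +
    2^-1 * r ^+ 2 * (- Ex P s2 + Ex P s3 + s4) = Ex P R1 - Ex P R2 + 2^-1 * r ^+ 2 * s4 by ring.
have -> : r ^+ 2 * (2^-1 * d%:R ^+ 2 * B * ic + cr * lam r + cr * r * b3) =
   cr * r ^+ 2 * lam r + cr * r ^+ 3 * b3 + 2^-1 * r ^+ 2 * (d%:R ^+ 2 * B * ic) by ring.
rewrite (le_trans (ler_normD _ _))// lerD//.
  by rewrite (le_trans (ler_normB _ _))// lerD.
by rewrite normrM ger0_norm ?mulr_ge0 ?invr_ge0 ?exprn_ge0// ler_wpM2l// mulr_ge0 ?invr_ge0 ?exprn_ge0.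
Qed.

Theorem lindeberg (r dl : R) k m : 0 <= r -> (0 < m)%N -> 0 <= dl ->
  (forall j a b,
    Ex P (fun w => `|\sum_(l < m) (qd a b (j + l)%N w + Im a b)|) <= m%:R * dl) ->
  `|Ex P (fun w => f (psum r k w)) - iter k (walk bs r) f 0| <=
  k%:R * r ^+ 2 * (2^-1 * d%:R ^+ 2 * B * ic + cr * lam r + cr * r * b3) +
  2^-1 * d%:R ^+ 2 * r ^+ 2 * (k%:R * (m%:R * vcst r + B * dl) + m%:R * (B * c2)).
Proof.
move=> r0 m0 dl0 D_block.
(* Hybrids: j increments from the score, then k - j from the walk. The difference of the two ends
   telescopes. *)
pose V j := Ex P (fun w => iter (k - j) (walk bs r) f (psum r j w)).
pose hD a b j := Ex P (fun w => iter (k - j.+1) (walk bs r) (H a b) (psum r j w) *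
   (qd a b j w + Im a b)).
have V0 : V 0%N = iter k (walk bs r) f 0.
  by rewrite /V /psum subn0; under eq_fun do rewrite big_ord0 scaler0; rewrite Exc.
have Vk : V k = Ex P (fun w => f (psum r k w)) by rewrite /V subnn.
have b10 : 0 <= b1 by rewrite /avg mulr_ge0 ?invr_ge0// sumr_ge0.
have vc0 : 0 <= vcst r.
  by rewrite /vcst !mulr_ge0// addr_ge0// mulr_ge0.
rewrite -Vk -V0 -(telescope_sumr V (leq0n k)) big_mkord.
set e1 := 2^-1 * d%:R ^+ 2 * B * ic + cr * lam r + cr * r * b3.
have step (j : 'I_k) : `|V j.+1 - V j + 2^-1 * r ^+ 2 * \sum_a \sum_b hD a b j| <= r ^+ 2 * e1.
  have := lindeberg_step (k - j.+1) j r0.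
  by rewrite /V -subSn// subSS.
have -> : \sum_(j < k) (V j.+1 - V j) = \sum_(j < k) (V j.+1 - V j + 2^-1 * r ^+ 2 * \sum_a \sum_b hD a b j) -
   2^-1 * r ^+ 2 * \sum_a \sum_b \sum_(j < k) hD a b j.
  have -> : \sum_a \sum_b \sum_(j < k) hD a b j = \sum_(j < k) \sum_a \sum_b hD a b j.
    by rewrite [RHS]exchange_big/=; apply: eq_bigr => a _; rewrite exchange_big.
  by rewrite mulr_sumr [X in _ = X - _]big_split/= addrK.
rewrite (le_trans (ler_normB _ _))// lerD//.
  rewrite (le_trans (ler_norm_sum _ _ _))//.
  apply: (@le_trans _ _ (\sum_(j < k) r ^+ 2 * e1)); first by apply: ler_sum => j _.
  by rewrite sumr_const card_ord -[leLHS]mulr_natl mulrA.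
rewrite normrM ger0_norm ?mulr_ge0 ?invr_ge0 ?exprn_ge0//.
set Q := k%:R * _ + _.
have -> : 2^-1 * d%:R ^+ 2 * r ^+ 2 * Q = 2^-1 * r ^+ 2 * (\sum_(a < d) \sum_(b < d) Q).
  by rewrite !sumr_const !card_ord -!mulrnA -[Q *+ _]mulr_natl natrM; ring.
rewrite ler_wpM2l ?mulr_ge0 ?invr_ge0 ?exprn_ge0//.
rewrite (le_trans (ler_norm_sum _ _ _))//; apply: ler_sum => a _.
rewrite (le_trans (ler_norm_sum _ _ _))//; apply: ler_sum => b _.
apply: (block_sum (h := fun j w => iter (k - j.+1) (walk bs r) (H a b) (psum r j w))
  (D := fun j w => qd a b j w + Im a b)) => //.
- by move=> j; apply: coord_measurable_psum; exact: mHn.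
- by move=> j; apply: L2D => //; exact: L2c.
- by move=> j l; exact: hessian_variation.
Qed.

End Lindeberg.

(** * Smooth approximation by B-splines *)

Section Spline.
Context {R : realType}.
Implicit Types x v : R.

Definition ppart x : R := Num.max x 0.

Lemma ppart_cases x : (x <= 0 /\ ppart x = 0) \/ (0 <= x /\ ppart x = x).
Proof. by rewrite /ppart; case: leP => h; [left|right]; split => //; exact: ltW. Qed.

Lemma ppart_ge0 x : 0 <= ppart x.
Proof. by rewrite /ppart le_max lexx orbT. Qed.

Lemma ppart_lip x v : `|ppart (x + v) - ppart x| <= `|v|.
Proof.
have := ler_norm v; have := ler_norm (- v); rewrite normrN ler_norml.
by case: (ppart_cases x) => -[? ->]; case: (ppart_cases (x + v)) => -[? ->]; lra.
Qed.

Lemma ppart_lip2 x v : `|ppart (x + v) ^+ 2 - ppart x ^+ 2 - 2 * ppart x * v| <= `|v| ^+ 2.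
Proof.
rewrite real_normK ?num_real// ler_norml.
by case: (ppart_cases x) => -[? ->]; case: (ppart_cases (x + v)) => -[? ->]; nra.
Qed.

(** The cube of the positive part is twice differentiable with Lipschitz second derivative, exactly
    the regularity that [test_data] records; the spline estimates combine this bound with
    [ppart_lip2] and [ppart_lip]. *)
Lemma ppart_taylor x v :
  `|ppart (x + v) ^+ 3 - ppart x ^+ 3 - 3 * ppart x ^+ 2 * v - 3 * ppart x * v ^+ 2| <= `|v| ^+ 3.
Proof.
case: (ppart_cases x) => -[hx ->]; case: (ppart_cases (x + v)) => -[hy ->].
- by rewrite !expr0n/= !(mulr0, mul0r, subr0) normr0 exprn_ge0.
- rewrite !expr0n/= !(mulr0, mul0r, subr0) normrX lerXn2r ?nnegrE//.
  by rewrite !ger0_norm//; lra.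
- rewrite (_ : _ - _ - _ - _ = v ^+ 3 - (x + v) ^+ 3); last by rewrite expr0n/=; ring.
  rewrite -normrX.
  have v0 : v <= 0 by lra.
  have h1 : v ^+ 3 <= (x + v) ^+ 3.
    rewrite -subr_ge0 (_ : _ - _ = x * ((x + v) ^+ 2 + (x + v) * v + v ^+ 2)); last by ring.
    by rewrite mulr_ge0// !addr_ge0 ?sqr_ge0// -mulrNN mulr_ge0// oppr_ge0.
  have h2 : (x + v) ^+ 3 <= 0.
    by rewrite exprS mulr_le0_ge0 ?sqr_ge0.
  rewrite !ler0_norm; lra.
- by rewrite (_ : _ - _ - _ - _ = v ^+ 3) ?normrX//; ring.
Qed.

(** The cardinal cubic B-spline with knots 0, ..., 4 in truncated powers; [bspline1] and [bspline2]
    are its first two derivatives. *)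
Definition bspline x : R := 6^-1 * (ppart x ^+ 3 - 4 * ppart (x - 1) ^+ 3 +
  6 * ppart (x - 2) ^+ 3 - 4 * ppart (x - 3) ^+ 3 + ppart (x - 4) ^+ 3).
Definition bspline1 x : R := 2^-1 * (ppart x ^+ 2 - 4 * ppart (x - 1) ^+ 2 +
  6 * ppart (x - 2) ^+ 2 - 4 * ppart (x - 3) ^+ 2 + ppart (x - 4) ^+ 2).
Definition bspline2 x : R := ppart x - 4 * ppart (x - 1) +
  6 * ppart (x - 2) - 4 * ppart (x - 3) + ppart (x - 4).
(** The sum of [bspline] over x, x - 1, x - 2, ...; it is 0 up to 0 and 1 from 3 on, which makes the
    integer shifts a partition of unity. *)
Definition bstep x : R := 6^-1 * (ppart x ^+ 3 - 3 * ppart (x - 1) ^+ 3 +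
  3 * ppart (x - 2) ^+ 3 - ppart (x - 3) ^+ 3).

Let ppos x : 0 <= x -> ppart x = x. Proof. by rewrite /ppart => ?; rewrite max_l. Qed.
Let pneg x : x <= 0 -> ppart x = 0. Proof. by rewrite /ppart => ?; rewrite max_r. Qed.

Lemma bspline_ge0 x : 0 <= bspline x.
Proof.
rewrite /bspline mulr_ge0 ?invr_ge0//.
have [x0|x0] := leP x 0.
  have -> : ppart x = 0 by apply: pneg; lra.
  have -> : ppart (x - 1) = 0 by apply: pneg; lra.
  have -> : ppart (x - 2) = 0 by apply: pneg; lra.
  have -> : ppart (x - 3) = 0 by apply: pneg; lra.
  have -> : ppart (x - 4) = 0 by apply: pneg; lra.
  by rewrite expr0n/=; lra.
have [x1|x1] := leP x 1.
  have -> : ppart x = x by apply: ppos; lra.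
  have -> : ppart (x - 1) = 0 by apply: pneg; lra.
  have -> : ppart (x - 2) = 0 by apply: pneg; lra.
  have -> : ppart (x - 3) = 0 by apply: pneg; lra.
  have -> : ppart (x - 4) = 0 by apply: pneg; lra.
  by rewrite expr0n/=; have := exprn_ge0 3 (ltW x0); lra.
have [x2|x2] := leP x 2.
  have -> : ppart x = x by apply: ppos; lra.
  have -> : ppart (x - 1) = x - 1 by apply: ppos; lra.
  have -> : ppart (x - 2) = 0 by apply: pneg; lra.
  have -> : ppart (x - 3) = 0 by apply: pneg; lra.
  have -> : ppart (x - 4) = 0 by apply: pneg; lra.
  (* Here u lies in [0, 1] and six times the spline is 1 + 3u + 3u^2 - 3u^3; the next piece is the
     mirror image. *)
  rewrite expr0n/=; set u := x - 1; have -> : x = u + 1 by rewrite /u; ring.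
  have u0 : 0 <= u by rewrite /u; lra.
  have u1 : u <= 1 by rewrite /u; lra.
  rewrite (_ : _ + _ = 1 + 3 * u + 3 * u ^+ 2 - 3 * u ^+ 3); last by ring.
  have u3 : u ^+ 3 <= u by rewrite exprS ler_piMr// exprn_ile1.
  by have := sqr_ge0 u; lra.
have [x3|x3] := leP x 3.
  have -> : ppart x = x by apply: ppos; lra.
  have -> : ppart (x - 1) = x - 1 by apply: ppos; lra.
  have -> : ppart (x - 2) = x - 2 by apply: ppos; lra.
  have -> : ppart (x - 3) = 0 by apply: pneg; lra.
  have -> : ppart (x - 4) = 0 by apply: pneg; lra.
  rewrite expr0n/=; set u := 3 - x; have -> : x = 3 - u by rewrite /u; ring.
  have u0 : 0 <= u by rewrite /u; lra.
  have u1 : u <= 1 by rewrite /u; lra.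
  have u3 : u ^+ 3 <= u by rewrite exprS ler_piMr// exprn_ile1.
  rewrite (_ : _ + _ = 1 + 3 * u + 3 * u ^+ 2 - 3 * u ^+ 3); last by ring.
  by have := sqr_ge0 u; lra.
have [x4|x4] := leP x 4.
  have -> : ppart x = x by apply: ppos; lra.
  have -> : ppart (x - 1) = x - 1 by apply: ppos; lra.
  have -> : ppart (x - 2) = x - 2 by apply: ppos; lra.
  have -> : ppart (x - 3) = x - 3 by apply: ppos; lra.
  have -> : ppart (x - 4) = 0 by apply: pneg; lra.
  have h : 0 <= (4 - x) ^+ 3 by rewrite exprn_ge0; lra.
  by apply: le_trans h _; rewrite le_eqVlt; apply/orP; left; apply/eqP; rewrite expr0n/=; ring.
have -> : ppart x = x by apply: ppos; lra.
have -> : ppart (x - 1) = x - 1 by apply: ppos; lra.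
have -> : ppart (x - 2) = x - 2 by apply: ppos; lra.
have -> : ppart (x - 3) = x - 3 by apply: ppos; lra.
have -> : ppart (x - 4) = x - 4 by apply: ppos; lra.
by rewrite le_eqVlt; apply/orP; left; apply/eqP; ring.
Qed.

Lemma bspline_out x : x <= 0 \/ 4 <= x -> [/\ bspline x = 0, bspline1 x = 0 & bspline2 x = 0].
Proof.
rewrite /bspline /bspline1 /bspline2; case=> hx.
  have -> : ppart x = 0 by apply: pneg; lra.
  have -> : ppart (x - 1) = 0 by apply: pneg; lra.
  have -> : ppart (x - 2) = 0 by apply: pneg; lra.
  have -> : ppart (x - 3) = 0 by apply: pneg; lra.
  have -> : ppart (x - 4) = 0 by apply: pneg; lra.
  by rewrite !expr0n/= !mulr0 !(addr0, subr0, mulr0).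
have -> : ppart x = x by apply: ppos; lra.
have -> : ppart (x - 1) = x - 1 by apply: ppos; lra.
have -> : ppart (x - 2) = x - 2 by apply: ppos; lra.
have -> : ppart (x - 3) = x - 3 by apply: ppos; lra.
have -> : ppart (x - 4) = x - 4 by apply: ppos; lra.
by split; field.
Qed.

Lemma bspline_step x : bspline x = bstep x - bstep (x - 1).
Proof.
have e2 : x - 1 - 1 = x - 2 by ring.
have e3 : x - 1 - 2 = x - 3 by ring.
have e4 : x - 1 - 3 = x - 4 by ring.
by rewrite /bspline /bstep e2 e3 e4; ring.
Qed.

Lemma bstep0 x : x <= 0 -> bstep x = 0.
Proof.
move=> hx; rewrite /bstep.
have -> : ppart x = 0 by apply: pneg; lra.
have -> : ppart (x - 1) = 0 by apply: pneg; lra.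
have -> : ppart (x - 2) = 0 by apply: pneg; lra.
have -> : ppart (x - 3) = 0 by apply: pneg; lra.
by rewrite expr0n/= !mulr0 !(addr0, subr0, mulr0).
Qed.

Lemma bstep1 x : 3 <= x -> bstep x = 1.
Proof.
move=> hx; rewrite /bstep.
have -> : ppart x = x by apply: ppos; lra.
have -> : ppart (x - 1) = x - 1 by apply: ppos; lra.
have -> : ppart (x - 2) = x - 2 by apply: ppos; lra.
have -> : ppart (x - 3) = x - 3 by apply: ppos; lra.
by field.
Qed.

Let five (p : R -> R) (c : R) x : (forall i : nat, (i <= 4)%N -> `|p (x - i%:R)| <= c) ->
  `|p x - 4 * p (x - 1) + 6 * p (x - 2) - 4 * p (x - 3) + p (x - 4)| <= 16 * c.
Proof.
move=> h; have := h 0%N isT; have := h 1%N isT; have := h 2%N isT.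
have := h 3%N isT; have := h 4%N isT; rewrite subr0 !ler_norml; lra.
Qed.

(** The coefficients 1, 4, 6, 4, 1 have sum 16, and on the support every positive part is at most 4.
    The bounds are 16 * 64 / 6, 16 * 16 / 2 and 16 * 4, all below 171. *)
Lemma bspline_bound x : [/\ `|bspline x| <= 171, `|bspline1 x| <= 171 & `|bspline2 x| <= 171].
Proof.
have [x0|x0] := leP x 0.
  by have [-> -> ->] := bspline_out (or_introl x0); rewrite normr0; split; exact: ler0n.
have [x4|x4] := leP 4 x.
  by have [-> -> ->] := bspline_out (or_intror x4); rewrite normr0; split; exact: ler0n.
have b (i : nat) : 0 <= ppart (x - i%:R) <= 4.
  rewrite ppart_ge0 /ppart ge_max /=; have : 0 <= i%:R :> R by []; lra.
have bn (n i : nat) : `|ppart (x - i%:R) ^+ n| <= 4 ^+ n.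
  by case/andP: (b i) => h1 h2; rewrite normrX ger0_norm// lerXn2r ?nnegrE.
split.
- have h := @five (fun x => ppart x ^+ 3) (4 ^+ 3) x (fun i _ => bn 3%N i).
  rewrite /bspline normrM ger0_norm ?invr_ge0//; rewrite /= in h; lra.
- have h := @five (fun x => ppart x ^+ 2) (4 ^+ 2) x (fun i _ => bn 2%N i).
  rewrite /bspline1 normrM ger0_norm ?invr_ge0//; rewrite /= in h; lra.
- have h := @five ppart (4 ^+ 1) x (fun i _ => bn 1%N i).
  rewrite /bspline2; lra.
Qed.

Lemma bspline2_lip x v : `|bspline2 (x + v) - bspline2 x| <= 16 * `|v|.
Proof.
have h := @five (fun y => ppart (y + v) - ppart y) `|v| x (fun i _ => ppart_lip _ v).
rewrite /bspline2; move: h; rewrite /= !(addrAC x (- _) v); congr (`|_| <= _); ring.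
Qed.

Lemma bspline1_lip2 x v : `|bspline1 (x + v) - bspline1 x - bspline2 x * v| <= 8 * `|v| ^+ 2.
Proof.
have h := @five (fun y => ppart (y + v) ^+ 2 - ppart y ^+ 2 - 2 * ppart y * v) (`|v| ^+ 2) x
  (fun i _ => ppart_lip2 _ v).
rewrite /= !(addrAC x (- _) v) in h.
have two : 0 < 2 :> R by [].
rewrite -(ler_pM2l two) -{1}(ger0_norm (ltW two)) -normrM.
apply: le_trans (le_trans h _); last by lra.
rewrite le_eqVlt; apply/orP; left; apply/eqP; congr (`|_|).
by rewrite /bspline1 /bspline2; field.
Qed.

Lemma bspline_taylor x v :
  `|bspline (x + v) - bspline x - bspline1 x * v - 2^-1 * (bspline2 x * v ^+ 2)| <= 3 * `|v| ^+ 3.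
Proof.
have h := @five (fun y => ppart (y + v) ^+ 3 - ppart y ^+ 3 - 3 * ppart y ^+ 2 * v - 3 * ppart y * v ^+ 2)
  (`|v| ^+ 3) x (fun i _ => ppart_taylor _ v).
rewrite /= !(addrAC x (- _) v) in h.
have six : 0 < 6 :> R by [].
rewrite -(ler_pM2l six) -{1}(ger0_norm (ltW six)) -normrM.
apply: (@le_trans _ _ (16 * `|v| ^+ 3)).
  apply: le_trans h; rewrite le_eqVlt; apply/orP; left; apply/eqP; congr (`|_|).
  by rewrite /bspline /bspline1 /bspline2; field.
by have := exprn_ge0 3 (normr_ge0 v); lra.
Qed.

(** 342 = 2 * 171 settles |v| >= 1; for shorter v the Taylor bound gives the smaller constant 8 +
    171. [bspline_lip] uses the same split. *)
Lemma bspline1_lip x v : `|bspline1 (x + v) - bspline1 x| <= 342 * `|v|.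
Proof.
have [_ b1 b2] := bspline_bound x; have [_ b1' _] := bspline_bound (x + v).
have [v1|v1] := leP 1 `|v|.
  by rewrite (le_trans (ler_normB _ _))//; lra.
have h := bspline1_lip2 x v.
rewrite -[bspline1 (x + v) - bspline1 x](subrK (bspline2 x * v)).
rewrite (le_trans (ler_normD _ _))// normrM.
have h2 : `|bspline2 x| * `|v| <= 171 * `|v| by rewrite ler_wpM2r.
have h3 : `|v| ^+ 2 <= `|v| by rewrite expr2 ler_piMl// ltW.
by have := normr_ge0 v; lra.
Qed.

Lemma bspline_lip x v : `|bspline (x + v) - bspline x| <= 342 * `|v|.
Proof.
have [b0 b1 b2] := bspline_bound x; have [b0' _ _] := bspline_bound (x + v).
have [v1|v1] := leP 1 `|v|.
  by rewrite (le_trans (ler_normB _ _))//; lra.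
have h := bspline_taylor x v.
have -> : bspline (x + v) - bspline x =
  (bspline (x + v) - bspline x - bspline1 x * v - 2^-1 * (bspline2 x * v ^+ 2)) +
  (bspline1 x * v + 2^-1 * (bspline2 x * v ^+ 2)) by ring.
rewrite (le_trans (ler_normD _ _))//.
have h2 : `|bspline1 x * v + 2^-1 * (bspline2 x * v ^+ 2)| <= 171 * `|v| + 2^-1 * (171 * `|v|).
  apply: (le_trans (ler_normD _ _)); apply: lerD; first by rewrite normrM ler_wpM2r.
  rewrite normrM (ger0_norm (_ : 0 <= 2^-1)) ?invr_ge0// ler_wpM2l ?invr_ge0//.
  by rewrite normrM normrX ler_pM ?exprn_ge0// expr2 ler_piMl// ltW.
have h3 : `|v| ^+ 3 <= `|v| by rewrite exprS ler_piMr// exprn_ile1// ltW.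
by have := normr_ge0 v; lra.
Qed.

Lemma measurable_ppart d' (U : measurableType d') (f : U -> R) :
  measurable_fun setT f -> measurable_fun setT (fun w => ppart (f w)).
Proof. by move=> mf; exact: measurable_maxr. Qed.

Let measurable_five d' (U : measurableType d') (f : U -> R) n : measurable_fun setT f ->
  measurable_fun setT (fun w => ppart (f w) ^+ n - 4 * ppart (f w - 1) ^+ n +
  6 * ppart (f w - 2) ^+ n - 4 * ppart (f w - 3) ^+ n + ppart (f w - 4) ^+ n).
Proof.
move=> mf.
have mp c : measurable_fun setT (fun w => ppart (f w - c) ^+ n).
  by apply: measurable_funX; apply: measurable_ppart; exact: measurable_funB.
apply: measurable_funD => //; apply: measurable_funB; last exact: measurable_funM.
apply: measurable_funD; last exact: measurable_funM.
apply: measurable_funB; last exact: measurable_funM.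
by apply: measurable_funX; exact: measurable_ppart.
Qed.

Lemma measurable_bspline d' (U : measurableType d') (f : U -> R) :
  measurable_fun setT f -> [/\ measurable_fun setT (fun w => bspline (f w)),
   measurable_fun setT (fun w => bspline1 (f w)) & measurable_fun setT (fun w => bspline2 (f w))].
Proof.
move=> mf; split.
- by apply: measurable_funM => //; exact: (measurable_five 3).
- by apply: measurable_funM => //; exact: (measurable_five 2).
- exact: (measurable_five 1).
Qed.

End Spline.

Definition smooth_test {R : realType} {d : nat} (f : 'rV[R]_d -> R) : Prop :=
  exists B G H, test_data B f G H.

Section Smooth.
Context {R : realType} {d : nat}.
Implicit Types f h : 'rV[R]_d -> R.

Lemma smooth_cst (c : R) : smooth_test (fun _ : 'rV[R]_d => c).
Proof.
have B0 : 0 <= `|c| by [].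
have mc (c0 : R) : coord_measurable (fun _ : 'rV[R]_d => c0).
  by move=> d' U v mv; exact: measurable_cst.
exists `|c|, (fun _ _ => 0), (fun _ _ _ => 0); split.
- exact: mc.
- by move=> a; exact: mc.
- by move=> a b; exact: mc.
- by [].
- by move=> a x; rewrite normr0.
- by move=> a b x; rewrite normr0.
- by move=> x v; rewrite subrr normr0 mulr_ge0.
- by move=> a x v; rewrite subrr normr0 mulr_ge0.
- by move=> a b x v; rewrite subrr normr0 mulr_ge0.
- move=> x v _; rewrite subrr sub0r big1 => [|a _]; last by rewrite mul0r.
  rewrite oppr0 sub0r big1 ?mulr0 ?oppr0 ?normr0 ?mulr_ge0 ?exprn_ge0// => a _.
  by rewrite big1// => b _; rewrite mul0r.
Qed.

Lemma coord_measurable_comp (p : R -> R) (a : 'I_d) : measurable_fun setT p ->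
  coord_measurable (fun x : 'rV[R]_d => p (x 0 a)).
Proof.
move=> mp d' U v mv; rewrite (_ : (fun w => _) = fun w => p (v a w)).
  by apply: measurableT_comp => //; exact: mv.
by apply/funext => w; rewrite mxE.
Qed.

Lemma smooth_bspline (a : 'I_d) (c : R) :
  smooth_test (fun x : 'rV[R]_d => bspline (x 0 a + c)).
Proof.
have [m0 m1 m2] : [/\ measurable_fun setT (fun y : R => bspline (y + c)),
    measurable_fun setT (fun y : R => bspline1 (y + c)) &
    measurable_fun setT (fun y : R => bspline2 (y + c))].
  by apply: measurable_bspline; exact: measurable_funD.
pose B : R := 342.
have B0 : 0 <= B by rewrite ler0n.
have B171 : 171 <= B by rewrite /B ler_nat.
have B16 : 16 <= B by rewrite /B ler_nat.
have B3 : 3 <= B by rewrite /B ler_nat.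
have shift (x v : 'rV[R]_d) : (x + v) 0 a + c = x 0 a + c + v 0 a.
  by rewrite mxE addrAC.
exists B, (fun i x => if i == a then bspline1 (x 0 a + c) else 0),
  (fun i j x => if (i == a) && (j == a) then bspline2 (x 0 a + c) else 0); split.
- exact: (coord_measurable_comp a m0).
- move=> i; case: (i == a); last by move=> d' U v mv; exact: measurable_cst.
  exact: (coord_measurable_comp a m1).
- move=> i j; case: (_ && _); last by move=> d' U v mv; exact: measurable_cst.
  exact: (coord_measurable_comp a m2).
- by move=> x; have [h _ _] := bspline_bound (x 0 a + c); exact: le_trans h _.
- move=> i x; case: ifP => _; last by rewrite normr0.
  by have [_ h _] := bspline_bound (x 0 a + c); exact: le_trans h _.
- move=> i j x; case: ifP => _; last by rewrite normr0.
  by have [_ _ h] := bspline_bound (x 0 a + c); exact: le_trans h _.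
- move=> x v; rewrite shift; apply: (le_trans (bspline_lip _ _)).
  by rewrite ler_wpM2l// norm_entry.
- move=> i x v; case: ifP => _; last by rewrite subrr normr0 mulr_ge0.
  rewrite shift; apply: (le_trans (bspline1_lip _ _)).
  by rewrite ler_wpM2l// norm_entry.
- move=> i j x v; case: ifP => _; last by rewrite subrr normr0 mulr_ge0.
  rewrite shift; apply: (le_trans (bspline2_lip _ _)).
  by rewrite ler_pM// norm_entry.
- move=> x v _; rewrite shift.
  have -> : \sum_i (if i == a then bspline1 (x 0 a + c) else 0) * v 0 i =
      bspline1 (x 0 a + c) * v 0 a.
    by rewrite (bigD1 a)//= eqxx big1 ?addr0// => i /negbTE ->; rewrite mul0r.
  have -> : \sum_i \sum_j (if (i == a) && (j == a) then bspline2 (x 0 a + c) else 0) *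
      (v 0 i * v 0 j) = bspline2 (x 0 a + c) * v 0 a ^+ 2.
    rewrite (bigD1 a)//= [X in _ + X]big1 ?addr0 => [|i /negbTE ->]; last first.
      by rewrite big1// => j _; rewrite mul0r.
    rewrite (bigD1 a)//= eqxx big1 ?addr0 ?expr2// => j /negbTE ->.
    by rewrite mul0r.
  apply: (le_trans (bspline_taylor _ _)); apply: ler_pM => //.
  by rewrite lerXn2r ?nnegrE// norm_entry.
Qed.

Lemma smoothD f h : smooth_test f -> smooth_test h -> smooth_test (fun x => f x + h x).
Proof.
move=> [B [G [H t1]]] [B' [G' [H' t2]]].
have tri (c c' n x y : R) : `|x| <= c * n -> `|y| <= c' * n -> `|x + y| <= (c + c') * n.
  by move=> h1 h2; rewrite mulrDl (le_trans (ler_normD _ _))// lerD.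
have tri0 (c c' x y : R) : `|x| <= c -> `|y| <= c' -> `|x + y| <= (c + c').
  by move=> h1 h2; rewrite (le_trans (ler_normD _ _))// lerD.
exists (B + B'), (fun a x => G a x + G' a x), (fun a b x => H a b x + H' a b x); split.
- by move=> d' U v mv; apply: measurable_funD; [exact: (td_mf t1)|exact: (td_mf t2)].
- by move=> a d' U v mv; apply: measurable_funD; [exact: (td_mG t1)|exact: (td_mG t2)].
- by move=> a b d' U v mv; apply: measurable_funD; [exact: (td_mH t1)|exact: (td_mH t2)].
- by move=> x; apply: tri0; [exact: (td_f t1)|exact: (td_f t2)].
- by move=> a x; apply: tri0; [exact: (td_G t1)|exact: (td_G t2)].
- by move=> a b x; apply: tri0; [exact: (td_H t1)|exact: (td_H t2)].
- by move=> x v; rewrite opprD addrACA; apply: tri; [exact: (td_lipf t1)|exact: (td_lipf t2)].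
- by move=> a x v; rewrite opprD addrACA; apply: tri; [exact: (td_lipG t1)|exact: (td_lipG t2)].
- by move=> a b x v; rewrite opprD addrACA; apply: tri; [exact: (td_lip t1)|exact: (td_lip t2)].
- move=> x v v1.
  have e1 : \sum_a (G a x + G' a x) * v 0 a = \sum_a G a x * v 0 a + \sum_a G' a x * v 0 a.
    by rewrite -big_split; apply: eq_bigr => a _; rewrite mulrDl.
  have e2 : \sum_a \sum_b (H a b x + H' a b x) * (v 0 a * v 0 b) =
      \sum_a \sum_b H a b x * (v 0 a * v 0 b) + \sum_a \sum_b H' a b x * (v 0 a * v 0 b).
    rewrite -big_split; apply: eq_bigr => a _; rewrite -big_split.
    by apply: eq_bigr => b _; rewrite mulrDl.
  have h1 := td_taylor t1 x v1; have h2 := td_taylor t2 x v1.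
  rewrite e1 e2; apply: le_trans (tri _ _ _ _ _ h1 h2).
  by rewrite le_eqVlt; apply/orP; left; apply/eqP; congr (`|_|); ring.
Qed.

(** Multiplying two second-order expansions and removing the orders up to 2 leaves ten products of
    total order at least 3. [C] and [C'] absorb the number of coordinates, so each product is at
    most C C' |v|^3; hence the constant 10. *)
Lemma smoothM f h : smooth_test f -> smooth_test h -> smooth_test (fun x => f x * h x).
Proof.
move=> [B [G [H t1]]] [B' [G' [H' t2]]].
have B0 := td_B0 t1; have B0' := td_B0 t2.
pose C := (1 + d%:R + d%:R ^+ 2) * B; pose C' := (1 + d%:R + d%:R ^+ 2) * B'.
have d0 : 0 <= d%:R :> R by [].
have cge : 1 <= 1 + d%:R + d%:R ^+ 2 :> R by rewrite -addrA lerDl addr_ge0// exprn_ge0.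
have BC : B <= C by rewrite /C ler_peMl.
have BC' : B' <= C' by rewrite /C' ler_peMl.
have C0 : 0 <= C := le_trans B0 BC; have C0' : 0 <= C' := le_trans B0' BC'.
have CC0 : 0 <= C * C' by rewrite mulr_ge0.
have BB : B * B' <= C * C' by rewrite ler_pM.
have pr (x y : R) : `|x| <= B -> `|y| <= B' -> `|x * y| <= C * C'.
  by move=> h1 h2; rewrite normrM (le_trans _ BB)// ler_pM.
have prn (x y n : R) : 0 <= n -> `|x| <= B -> `|y| <= B' * n -> `|x * y| <= C * C' * n.
  move=> n0 h1 h2; rewrite normrM -mulrA ler_pM//; first exact: le_trans BC.
  by rewrite (le_trans h2)// ler_wpM2r.
have prn' (x y n : R) : 0 <= n -> `|x| <= B * n -> `|y| <= B' -> `|x * y| <= C * C' * n.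
  move=> n0 h1 h2; rewrite normrM mulrAC ler_pM//; last exact: le_trans BC'.
  by rewrite (le_trans h1)// ler_wpM2r.
have lipM (p q : 'rV[R]_d -> R) x v : (forall x, `|p x| <= B) -> (forall x, `|q x| <= B') ->
    (forall x v, `|p (x + v) - p x| <= B * `|v|) ->
    (forall x v, `|q (x + v) - q x| <= B' * `|v|) ->
    `|p (x + v) * q (x + v) - p x * q x| <= 2 * (C * C' * `|v|).
  move=> pB qB pl ql.
  have -> : p (x + v) * q (x + v) - p x * q x =
    p (x + v) * (q (x + v) - q x) + (p (x + v) - p x) * q x by ring.
  rewrite (le_trans (ler_normD _ _))// [leRHS]mulr_natl mulr2n lerD//.
    exact: prn.
  exact: prn'.
have fB := td_f t1; have gB := td_f t2; have GB := td_G t1; have GB' := td_G t2.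
have HB := td_H t1; have HB' := td_H t2.
have fl := td_lipf t1; have gl := td_lipf t2; have Gl := td_lipG t1; have Gl' := td_lipG t2.
have Hl := td_lip t1; have Hl' := td_lip t2.
exists (10 * (C * C')), (fun a x => f x * G' a x + G a x * h x),
  (fun a b x => f x * H' a b x + H a b x * h x + (G a x * G' b x + G b x * G' a x)).
have m1 := td_mf t1; have m2 := td_mf t2; have mG := td_mG t1; have mG' := td_mG t2.
have mH := td_mH t1; have mH' := td_mH t2.
split.
- by move=> d' U v mv; apply: measurable_funM; [exact: m1|exact: m2].
- move=> a d' U v mv; apply: measurable_funD; apply: measurable_funM;
    [exact: m1|exact: mG'|exact: mG|exact: m2].
- move=> a b d' U v mv; apply: measurable_funD; apply: measurable_funD; apply: measurable_funM;
    [exact: m1|exact: mH'|exact: mH|exact: m2|exact: mG|exact: mG'|exact: mG|exact: mG'].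
- by move=> x; have := pr _ _ (fB x) (gB x); lra.
- move=> a x; rewrite (le_trans (ler_normD _ _))//.
  by have := pr _ _ (fB x) (GB' a x); have := pr _ _ (GB a x) (gB x); lra.
- move=> a b x; rewrite (le_trans (ler_normD _ _))//.
  have := ler_normD (f x * H' a b x) (H a b x * h x).
  have := ler_normD (G a x * G' b x) (G b x * G' a x).
  have := pr _ _ (fB x) (HB' a b x); have := pr _ _ (HB a b x) (gB x).
  by have := pr _ _ (GB a x) (GB' b x); have := pr _ _ (GB b x) (GB' a x); lra.
- move=> x v; have := lipM f h x v fB gB fl gl; have := mulr_ge0 CC0 (normr_ge0 v).
  by rewrite -mulrA; lra.
- move=> a x v.
  have e : forall p q p' q' : R, p + q - (p' + q') = (p - p') + (q - q') by move=> *; ring.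
  rewrite e (le_trans (ler_normD _ _))//.
  have := lipM _ _ x v fB (GB' a) fl (Gl' a); have := lipM _ _ x v (GB a) gB (Gl a) gl.
  by have := mulr_ge0 CC0 (normr_ge0 v); rewrite -[10 * _ * _]mulrA; lra.
- move=> a b x v.
  have e : forall p q s t p' q' s' t' : R, p + q + (s + t) - (p' + q' + (s' + t')) =
    ((p - p') + (q - q')) + ((s - s') + (t - t')) by move=> *; ring.
  rewrite e (le_trans (ler_normD _ _))//.
  rewrite (le_trans (lerD (ler_normD _ _) (ler_normD _ _)))//.
  have := lipM _ _ x v fB (HB' a b) fl (Hl' a b); have := lipM _ _ x v (HB a b) gB (Hl a b) gl.
  have := lipM _ _ x v (GB a) (GB' b) (Gl a) (Gl' b).
  have := lipM _ _ x v (GB b) (GB' a) (Gl b) (Gl' a).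
  by have := mulr_ge0 CC0 (normr_ge0 v); rewrite -[10 * _ * _]mulrA; lra.
- move=> x v v1; set n := `|v| in v1 *; have n0 : 0 <= n by exact: normr_ge0.
  have n2 : n ^+ 2 <= n by rewrite expr2 ler_piMl.
  have n3 : n ^+ 3 <= n ^+ 2 by rewrite [leLHS]exprSr ler_piMr// exprn_ge0.
  pose D1 := \sum_a G a x * v 0 a; pose D1' := \sum_a G' a x * v 0 a.
  pose D2 := 2^-1 * \sum_a \sum_b H a b x * (v 0 a * v 0 b).
  pose D2' := 2^-1 * \sum_a \sum_b H' a b x * (v 0 a * v 0 b).
  pose r := f (x + v) - f x - D1 - D2; pose r' := h (x + v) - h x - D1' - D2'.
  have rB : `|r| <= C * n ^+ 3.
    by apply: (le_trans (td_taylor t1 x v1)); rewrite ler_wpM2r// exprn_ge0.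
  have rB' : `|r'| <= C' * n ^+ 3.
    by apply: (le_trans (td_taylor t2 x v1)); rewrite ler_wpM2r// exprn_ge0.
  have lin (b : R) (F : 'I_d -> R) : 0 <= b -> (forall a, `|F a| <= b) ->
      `|\sum_a F a * v 0 a| <= (1 + d%:R + d%:R ^+ 2) * b * n.
    move=> b0 Fb; rewrite (le_trans (ler_norm_sum _ _ _))//.
    apply: (@le_trans _ _ (\sum_(a < d) b * n)).
      by apply: ler_sum => a _; rewrite normrM ler_pM// norm_entry.
    rewrite sumr_const card_ord -[leLHS]mulr_natl mulrA !ler_wpM2r//.
    by have := exprn_ge0 2 d0; lra.
  have quad (b : R) (F : 'I_d -> 'I_d -> R) : 0 <= b -> (forall a c, `|F a c| <= b) ->
      `|2^-1 * \sum_a \sum_c F a c * (v 0 a * v 0 c)| <= (1 + d%:R + d%:R ^+ 2) * b * n ^+ 2.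
    move=> b0 Fb; rewrite normrM ger0_norm ?invr_ge0//.
    apply: (@le_trans _ _ (2^-1 * \sum_(a < d) \sum_(c < d) b * n ^+ 2)).
      rewrite ler_wpM2l ?invr_ge0// (le_trans (ler_norm_sum _ _ _))//.
      apply: ler_sum => a _; rewrite (le_trans (ler_norm_sum _ _ _))//.
      apply: ler_sum => c _; rewrite !normrM ler_pM ?mulr_ge0// expr2.
      by rewrite ler_pM// norm_entry.
    have -> : \sum_(a < d) \sum_(c < d) b * n ^+ 2 = d%:R ^+ 2 * (b * n ^+ 2).
      by rewrite !sumr_const !card_ord -mulrnA -[LHS]mulr_natl natrM expr2.
    rewrite -[leRHS]mulrA [leLHS]mulrA; apply: ler_wpM2r; first by rewrite mulr_ge0// exprn_ge0.
    by have := exprn_ge0 2 d0; lra.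
  have D1B : `|D1| <= C * n by apply: lin.
  have D1B' : `|D1'| <= C' * n by apply: lin.
  have D2B : `|D2| <= C * n ^+ 2 by apply: quad.
  have D2B' : `|D2'| <= C' * n ^+ 2 by apply: quad.
  have fC : `|f x| <= C := le_trans (fB x) BC.
  have hC : `|h x| <= C' := le_trans (gB x) BC'.
  have e1 : \sum_a (f x * G' a x + G a x * h x) * v 0 a = f x * D1' + D1 * h x.
    rewrite /D1 /D1' mulr_sumr mulr_suml -big_split; apply: eq_bigr => a _ /=; ring.
  have e2 : 2^-1 * \sum_a \sum_b (f x * H' a b x + H a b x * h x +
      (G a x * G' b x + G b x * G' a x)) * (v 0 a * v 0 b) =
      f x * D2' + D2 * h x + D1 * D1'.
    have s1 : \sum_a \sum_b (G a x * G' b x) * (v 0 a * v 0 b) = D1 * D1'.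
      rewrite /D1 /D1' big_distrlr/=; apply: eq_bigr => a _; apply: eq_bigr => b _; ring.
    have s2 : \sum_a \sum_b (G b x * G' a x) * (v 0 a * v 0 b) = D1 * D1'.
      rewrite mulrC /D1 /D1' big_distrlr/=; apply: eq_bigr => a _; apply: eq_bigr => b _; ring.
    have -> : D1 * D1' = 2^-1 * (\sum_a \sum_b (G a x * G' b x) * (v 0 a * v 0 b) +
        \sum_a \sum_b (G b x * G' a x) * (v 0 a * v 0 b)) by rewrite s1 s2; field.
    rewrite /D2 /D2' [f x * _]mulrCA -[2^-1 * _ * h x]mulrA -!mulrDr; congr (_ * _).
    rewrite mulr_sumr mulr_suml -!big_split/=; apply: eq_bigr => a _.
    rewrite mulr_sumr mulr_suml -!big_split/=; apply: eq_bigr => b _; ring.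
  rewrite e1 e2.
  have -> : f (x + v) * h (x + v) - f x * h x - (f x * D1' + D1 * h x) -
      (f x * D2' + D2 * h x + D1 * D1') =
      f x * r' + r * h x + D1 * D2' + D2 * D1' + D1 * r' + r * D1' + D2 * D2' +
      D2 * r' + r * D2' + r * r' by rewrite /r /r'; ring.
  have q (x1 y1 : R) (i j : nat) : (3 <= i + j)%N -> `|x1| <= C * n ^+ i -> `|y1| <= C' * n ^+ j ->
      `|x1 * y1| <= C * C' * n ^+ 3.
    move=> ij h1 h2; apply: (@le_trans _ _ (C * C' * n ^+ (i + j))).
      by rewrite normrM exprD mulrACA ler_pM.
    rewrite ler_wpM2l//; have -> : (i + j = 3 + (i + j - 3))%N by rewrite subnKC.
    by rewrite exprD ler_piMr ?exprn_ge0// exprn_ile1.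
  have fC0 : `|f x| <= C * n ^+ 0 by rewrite expr0 mulr1.
  have hC0 : `|h x| <= C' * n ^+ 0 by rewrite expr0 mulr1.
  have q1 := q _ _ 0%N 3%N isT fC0 rB'; have q2 := q _ _ 3%N 0%N isT rB hC0.
  have q3 := q _ _ 1%N 2%N isT D1B D2B'; have q4 := q _ _ 2%N 1%N isT D2B D1B'.
  have q5 := q _ _ 1%N 3%N isT D1B rB'; have q6 := q _ _ 3%N 1%N isT rB D1B'.
  have q7 := q _ _ 2%N 2%N isT D2B D2B'; have q8 := q _ _ 2%N 3%N isT D2B rB'.
  have q9 := q _ _ 3%N 2%N isT rB D2B'; have q10 := q _ _ 3%N 3%N isT rB rB'.
  have t (u w c c' : R) : `|u| <= c -> `|w| <= c' -> `|u + w| <= c + c'.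
    by move=> h1 h2; rewrite (le_trans (ler_normD _ _))// lerD.
  have := t _ _ _ _ (t _ _ _ _ (t _ _ _ _ (t _ _ _ _ (t _ _ _ _ (t _ _ _ _ (t _ _ _ _
    (t _ _ _ _ (t _ _ _ _ q1 q2) q3) q4) q5) q6) q7) q8) q9) q10.
  by move/le_trans; apply; rewrite le_eqVlt; apply/orP; left; apply/eqP; ring.
Qed.

Lemma smooth_sum {I : Type} (s : seq I) (F : I -> 'rV[R]_d -> R) :
  (forall i, smooth_test (F i)) -> smooth_test (fun x => \sum_(i <- s) F i x).
Proof.
move=> hF; elim: s => [|i s IH].
  by rewrite (_ : (fun x => _) = fun=> 0); [exact: smooth_cst|apply/funext => x; rewrite big_nil].
rewrite (_ : (fun x => _) = fun x => F i x + \sum_(j <- s) F j x); first exact: smoothD.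
by apply/funext => x; rewrite big_cons.
Qed.

Lemma smooth_prod {I : Type} (s : seq I) (F : I -> 'rV[R]_d -> R) :
  (forall i, smooth_test (F i)) -> smooth_test (fun x => \prod_(i <- s) F i x).
Proof.
move=> hF; elim: s => [|i s IH].
  by rewrite (_ : (fun x => _) = fun=> 1); [exact: smooth_cst|apply/funext => x; rewrite big_nil].
rewrite (_ : (fun x => _) = fun x => F i x * \prod_(j <- s) F j x); first exact: smoothM.
by apply/funext => x; rewrite big_cons.
Qed.

End Smooth.

Section Dilation.
Context {R : realType} {d : nat}.

(** Since |s v| may exceed 1 when |v| does not, the Taylor clause rests on the unrestricted bound
    [rem_le3], whence [cst_rem]. For s >= 1 the factor s^3 dominates the lower powers of the other
    clauses. *)
Lemma smooth_dilate (f : 'rV[R]_d -> R) (s : R) : 1 <= s -> smooth_test f ->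
  smooth_test (fun x => f (s *: x)).
Proof.
move=> s1 [B [G [H t]]]; have B0 := td_B0 t; have s0 : 0 <= s := le_trans ler01 s1.
have cB : B <= @cst_rem R d B := cst_rem_ge t.
have c0 : 0 <= @cst_rem R d B := le_trans B0 cB.
set C := @cst_rem R d B * s ^+ 3.
have s2 : s <= s ^+ 2 by rewrite expr2 ler_peMl.
have s3 : s ^+ 2 <= s ^+ 3 by rewrite [leRHS]exprSr ler_peMr// exprn_ge0.
have CB : B <= C.
  by rewrite (le_trans cB)// /C ler_peMr// (le_trans s1)// (le_trans s2).
have CBs : B * s <= C by rewrite /C ler_pM// (le_trans s2).
have CBs2 : B * s ^+ 2 <= C by rewrite /C ler_pM// exprn_ge0.
have CBs3 : B * s ^+ 3 <= C by rewrite /C ler_pM// exprn_ge0.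
have dil (h : 'rV[R]_d -> R) : coord_measurable h -> coord_measurable (fun x => h (s *: x)).
  move=> mh d' U v mv; have := mh _ U (fun i w => s * v i w).
  have -> : (fun w => h (\row_i (s * v i w))) = fun w => h (s *: \row_i v i w).
    by apply/funext => w; congr h; apply/rowP => k; rewrite !mxE.
  by apply => i; apply: measurable_funM => //; exact: mv.
have nZ (v : 'rV[R]_d) : `|s *: v| = s * `|v| by rewrite normrZ ger0_norm.
exists C, (fun a x => s * G a (s *: x)), (fun a b x => s ^+ 2 * H a b (s *: x)); split.
- exact: dil (td_mf t).
- by move=> a d' U v mv; apply: measurable_funM => //; exact: (dil _ (td_mG t a)).
- by move=> a b d' U v mv; apply: measurable_funM => //; exact: (dil _ (td_mH t a b)).
- by move=> x; exact: le_trans (td_f t _) CB.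
- by move=> a x; rewrite normrM ger0_norm// mulrC (le_trans _ CBs)// ler_wpM2r// (td_G t).
- move=> a b x; rewrite normrM ger0_norm ?exprn_ge0// mulrC (le_trans _ CBs2)//.
  by rewrite ler_wpM2r ?exprn_ge0// (td_H t).
- move=> x v; rewrite scalerDr; apply: (le_trans (td_lipf t _ _)).
  by rewrite nZ mulrA ler_wpM2r.
- move=> a x v; rewrite -mulrBr scalerDr normrM ger0_norm//.
  apply: (le_trans (ler_wpM2l s0 (td_lipG t _ _ _))).
  rewrite nZ; have -> : s * (B * (s * `|v|)) = B * s ^+ 2 * `|v| by ring.
  by rewrite ler_wpM2r.
- move=> a b x v; rewrite -mulrBr scalerDr normrM ger0_norm ?exprn_ge0//.
  apply: (le_trans (ler_wpM2l (exprn_ge0 2 s0) (td_lip t _ _ _ _))).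
  rewrite nZ; have -> : s ^+ 2 * (B * (s * `|v|)) = B * s ^+ 3 * `|v| by ring.
  by rewrite ler_wpM2r.
- move=> x v _; have := rem_le3 t (s *: x) (s *: v); rewrite /rem -scalerDr nZ exprMn mulrA -/C.
  congr (`|_ - _ - _ - _ * _| <= _).
    by apply: eq_bigr => a _; rewrite mxE; ring.
  by apply: eq_bigr => a _; apply: eq_bigr => b _; rewrite !mxE; ring.
Qed.

End Dilation.

Section Approximation.
Context {R : realType}.

(** Heine's theorem through the near-covering form of compactness. Only x is confined to the cube; y
    may lie outside, as grid nodes and values of the estimator may. *)
Lemma continuous_unif_bounded {d : nat} (f : 'rV[R]_d -> R) (A e : R) : continuous f -> 0 < e ->
  exists2 dl, 0 < dl & forall x y, `|x| <= A -> `|x - y| <= dl -> `|f x - f y| <= e.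
Proof.
move=> cf e0.
have cK : compact [set x : 'rV[R]_d | `|x| <= A].
  apply: bounded_closed_compact.
    by exists A; split; [exact: num_real|move=> B AB x /= xA; exact: le_trans xA (ltW AB)].
  rewrite (_ : mkset _ = (fun x : 'rV[R]_d => `|x|) @^-1` [set y | y <= A])//.
  by apply: preimage_closed; [move=> x _; exact: norm_continuous|exact: closed_le].
have /compact_near_coveringP nK := cK.
have := nK R 0^'+ (fun dl x => forall y, `|x - y| <= dl -> `|f x - f y| <= e) _.
have H : forall x, [set x : 'rV[R]_d | `|x| <= A] x ->
    \forall x' \near x & dl \near 0^'+, forall y, `|x' - y| <= dl -> `|f x' - f y| <= e.
  move=> x _.
  have e2 : 0 < e / 2 by rewrite divr_gt0.
  have /cvgrPdist_le/(_ _ e2) := cf x.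
  move=> /nbhs_ballP[r /= r0 hr].
  have r2 : 0 < r / 2 by rewrite divr_gt0.
  exists (ball x (r / 2), [set dl | dl < r / 2]) => /=.
    by split; [exact: nbhsx_ballx|exact: nbhs_right_lt].
  move=> [x' dl] [/= xx' dlr] y x'y.
  have h1 : ball x r x'.
    by apply: le_ball xx'; rewrite ler_pdivrMr// ler_peMr// ?ler1n// ltW.
  have h2 : ball x r y.
    rewrite -ball_normE/= in xx' *.
    rewrite -(subrKA x') (le_lt_trans (ler_normD _ _))//.
    by rewrite [ltRHS](splitr r) ltrD// (le_lt_trans x'y).
  have := hr _ h1; have := hr _ h2; rewrite /= => a1 a2.
  rewrite -(subrKA (f x)) (le_trans (ler_normD _ _))// (splitr e) lerD//.
  by rewrite distrC.
move=> /(_ _ H) [r/= r0 hr]; exists (r / 2); first by rewrite divr_gt0.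
move=> x y xA xy; apply: (hr (r / 2)) => //=; rewrite ?divr_gt0//.
by rewrite sub0r normrN gtr0_norm ?divr_gt0// ltr_pdivrMr// ltr_pMr// ltr1n.
Qed.

Lemma bstep_sum (z : R) n : \sum_(l < n) bspline (z - l%:R) = bstep z - bstep (z - n%:R).
Proof.
elim: n => [|n IH]; first by rewrite big_ord0 subr0 subrr.
rewrite big_ord_recr/= IH bspline_step.
have -> : z - n%:R - 1 = z - n.+1%:R by rewrite -natr1 opprD addrA.
by rewrite addrA subrK.
Qed.

Lemma bstep_mono (z : R) n : bstep (z - n%:R) <= bstep z.
Proof. by rewrite -subr_ge0 -bstep_sum sumr_ge0// => l _; exact: bspline_ge0. Qed.

(** Shifting the argument left by integers can only lower [bstep], and far to the left it is 0;
    [bstep_le1] compares with the value 1 far to the right. *)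
Lemma bstep_ge0 (z : R) : 0 <= bstep z.
Proof.
apply: le_trans (bstep_mono z (Num.truncn `|z|).+1); rewrite bstep0// subr_le0.
by rewrite (le_trans (ler_norm z))// ltW// truncnS_gt.
Qed.

Lemma bstep_le1 (z : R) : bstep z <= 1.
Proof.
have h := truncnS_gt (`|z| + 3); set n := (Num.truncn _).+1 in h.
have := bstep_mono (z + n%:R) n; rewrite addrK => /le_trans; apply.
rewrite bstep1//; have := ler_norm (- z); rewrite normrN; lra.
Qed.

(** Values of [f] on a grid are blended by tensor products of B-splines. The weights are nonnegative
    with sum at most 1, so the bound M holds everywhere; on the cube their sum is 1 and only nodes
    within [dl] of x count. *)
Lemma smooth_approx {d : nat} (f : 'rV[R]_d -> R) (M A e : R) : continuous f ->
  (forall x, `|f x| <= M) -> 0 < e ->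
  exists p, [/\ smooth_test p, forall x, `|p x| <= M &
    forall x, `|x| <= A -> `|f x - p x| <= e].
Proof.
move=> cf fM e0.
have [dl dl0 hdl] : exists2 dl, 0 < dl & forall x y, `|x| <= `|A| + 1 -> `|x - y| <= dl ->
    `|f x - f y| <= e.
  exact: continuous_unif_bounded.
(* In the variable x a spline has support of width 4 / s <= dl; the summand 1 ensures s >= 1 for
   [smooth_dilate]. *)
pose s : R := 1 + 4 / dl.
have q0 : 0 < 4 / dl by rewrite divr_gt0.
have s1 : 1 <= s by rewrite /s; lra.
have sp : 0 < s by lra.
have s4 : 4 / s <= dl.
  rewrite ler_pdivrMr// /s mulrDr mulr1 mulrC divfK ?gt_eqF//; lra.
(* As m exceeds s |A| + 3, in the cube s x + m is at least 3 and s x - m at most 0 in every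
   coordinate, where [bstep] is 1 and 0. *)
have hm := truncnS_gt (s * `|A| + 3); set m := (Num.truncn _).+1 in hm.
pose c (l : 'I_(m + m)) : R := m%:R - l%:R.
pose I := {ffun 'I_d -> 'I_(m + m)}.
pose node (i : I) : 'rV[R]_d := \row_a (- (c (i a)) / s).
pose psi (i : I) (x : 'rV[R]_d) : R := \prod_a bspline ((s *: x) 0 a + c (i a)).
pose p x := \sum_(i : I) f (node i) * psi i x.
have psi0 i x : 0 <= psi i x by apply: prodr_ge0 => a _; exact: bspline_ge0.
have sumE x : \sum_(i : I) psi i x = \prod_a (bstep ((s *: x) 0 a + m%:R) - bstep ((s *: x) 0 a - m%:R)).
  rewrite /psi -(bigA_distr_bigA (fun a l => bspline ((s *: x) 0 a + c l))).
  apply: eq_bigr => a _.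
  have := bstep_sum ((s *: x) 0 a + m%:R) (m + m).
  rewrite natrD opprD addrA addrK => <-; apply: eq_bigr => l _.
  by rewrite /c addrA.
have sum1 x : \sum_(i : I) psi i x <= 1.
  rewrite sumE; apply: (@le_trans _ _ (\prod_(a < d) (1 : R))); last by rewrite big1_eq.
  apply: ler_prod => a _.
  have := bstep_ge0 ((s *: x) 0 a - m%:R); have := bstep_le1 ((s *: x) 0 a + m%:R).
  have := bstep_mono ((s *: x) 0 a + m%:R) (m + m).
  by rewrite natrD opprD addrA addrK => h1 h2 h3; apply/andP; split; lra.
have M0 : 0 <= M := le_trans (normr_ge0 _) (fM 0).
exists p; split.
- apply: (smooth_dilate (f := fun y => \sum_(i : I) f (node i) * \prod_a bspline (y 0 a + c (i a)))) => //.
  apply: smooth_sum => i; apply: smoothM; first exact: smooth_cst.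
  by apply: smooth_prod => a; exact: smooth_bspline.
- move=> x; apply: (@le_trans _ _ (\sum_(i : I) M * psi i x)).
    rewrite (le_trans (ler_norm_sum _ _ _))//; apply: ler_sum => i _.
    by rewrite normrM (ger0_norm (psi0 _ _)) ler_wpM2r.
  by rewrite -mulr_sumr ler_piMr.
- move=> x xA.
  have xa a : `|(s *: x) 0 a| <= s * `|A|.
    rewrite mxE normrM (ger0_norm (ltW sp)) ler_wpM2l ?(ltW sp)//.
    by rewrite (le_trans (norm_entry _ _ _))// (le_trans xA)// ler_norm.
  have S1 : \sum_(i : I) psi i x = 1.
    rewrite sumE; apply: big1 => a _; rewrite bstep1 ?bstep0 ?subr0//.
      by have := xa a; rewrite ler_norml => /andP[]; lra.
    by have := xa a; rewrite ler_norml => /andP[]; lra.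
  have -> : f x - p x = \sum_(i : I) (f x - f (node i)) * psi i x.
    transitivity (f x * (\sum_(i : I) psi i x) - p x); first by rewrite S1 mulr1.
    rewrite mulr_sumr -sumrB.
    by apply: eq_bigr => i _; rewrite mulrBl.
  apply: (@le_trans _ _ (\sum_(i : I) e * psi i x)); last by rewrite -mulr_sumr S1 mulr1.
  rewrite (le_trans (ler_norm_sum _ _ _))//; apply: ler_sum => i _.
  rewrite normrM (ger0_norm (psi0 _ _)).
  have [->|ps] := eqVneq (psi i x) 0; first by rewrite !mulr0.
  rewrite ler_wpM2r// hdl//; first by rewrite (le_trans xA)// (le_trans (ler_norm A))//; lra.
  apply: norm_le_entries; first exact: ltW.
  move=> z a; rewrite (ord1 z) {z} !mxE.
  move/prodf_neq0 : ps => /(_ a isT).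
  have [lo|lo] := leP ((s *: x) 0 a + c (i a)) 0.
    by have [-> _ _] := bspline_out (or_introl lo); rewrite eqxx.
  have [hi|hi] := leP 4 ((s *: x) 0 a + c (i a)).
    by have [-> _ _] := bspline_out (or_intror hi); rewrite eqxx.
  move=> _; apply: le_trans s4; rewrite mxE in lo hi.
  rewrite ler_pdivlMr// -[X in _ * X](ger0_norm (ltW sp)) -normrM.
  rewrite mulrBl divfK ?gt_eqF// opprK [_ * s]mulrC ger0_norm; lra.
Qed.

End Approximation.

(** * Moments of the score along the chain *)

Lemma mule_lty_right {R : realType} (x y : \bar R) :
  (0 <= x)%E -> (0 <= y)%E -> x != 0%E -> (x * y < +oo)%E -> (y < +oo)%E.
Proof.
move=> x0 y0 xn0; have xp : (0 < x)%E by rewrite lt_neqAle eq_sym xn0.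
by case: y y0 => [r||]// _; rewrite ?ltry// gt0_muley.
Qed.

Section L1ge0.
Context {d} {T : measurableType d} {R : realType} (P : probability T R).

Lemma ge0_L1 (f : T -> R) : measurable_fun setT f -> (forall w, 0 <= f w) ->
  (\int[P]_w (f w)%:E < +oo)%E -> L1 P f.
Proof.
move=> mf f0 h; apply/integrableP; split; first exact/measurable_EFinP.
rewrite (_ : (fun x => _) = (fun w => (f w)%:E))//.
by apply/funext => w /=; rewrite ger0_norm.
Qed.

Lemma L1_lty (f : T -> R) : L1 P f -> (forall w, 0 <= f w) ->
  (\int[P]_w (f w)%:E < +oo)%E.
Proof.
by move=> lf f0; rewrite ltey_eq (integrable_fin_num measurableT lf).
Qed.

Lemma Ex_gt0_neq0 (f : T -> R) : 0 < Ex P f -> (\int[P]_w (f w)%:E)%E != 0%E.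
Proof. by rewrite ExE /Rintegral => h; apply/eqP => e; move: h; rewrite e ltxx. Qed.

(** Monotone convergence along [A n]: a moment bound free of n, proved where everything is bounded,
    passes to the untruncated function. *)
Lemma Ex_truncation_bound (f : T -> R) (A : nat -> set T) (C : R) :
  measurable_fun setT f -> (forall w, 0 <= f w) -> (forall n, measurable (A n)) ->
  (forall n m, (n <= m)%N -> A n `<=` A m) -> (forall w, exists n, A n w) ->
  (forall n, Ex P (fun w => \1_(A n) w * f w) <= C) ->
  (forall n, L1 P (fun w => \1_(A n) w * f w)) ->
  L1 P f /\ Ex P f <= C.
Proof.
move=> mf f0 mA ndA covA bA LA.
have h0 n w : 0 <= \1_(A n) w * f w by rewrite mulr_ge0// indicE ler0n.
have lim : (\int[P]_w (\1_(A n) w * f w)%:E)%E @[n --> \oo] --> (\int[P]_w (f w)%:E)%E.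
  have e : (fun w => (f w)%:E) = (fun w => limn (fun n => (\1_(A n) w * f w)%:E)).
    apply/funext => w; apply/esym/cvg_lim => //.
    apply: cvg_near_cst; have [N AN] := covA w; near=> n.
    rewrite indicE mem_set ?mul1r//; apply: (ndA N) => //; near: n; exact: nbhs_infty_ge.
  rewrite e; apply: (cvg_monotone_convergence measurableT).
  - by move=> n; apply/measurable_EFinP; exact: (L1_meas (LA n)).
  - by move=> n w _; rewrite lee_fin.
  - move=> w _ n m nm; rewrite lee_fin ler_wpM2r// !indicE ler_nat.
    by have [h|//] := boolP (w \in A n); rewrite mem_set//; apply: (ndA n) => //; rewrite inE in h.
have ub : (\int[P]_w (f w)%:E <= C%:E)%E.
  rewrite -(cvg_lim _ lim)//; apply: lime_le; first by apply/cvg_ex; eexists; exact: lim.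
  near=> n; have := bA n; rewrite -lee_fin; apply: le_trans.
  by rewrite -(expectation_fin (LA n)) unlock.
have Lf : L1 P f by apply: ge0_L1 => //; exact: le_lt_trans ub (ltry _).
by split => //; rewrite -lee_fin -(expectation_fin Lf) unlock.
Unshelve. all: by end_near. Qed.

End L1ge0.

Section Chain.
Context {dT} {T : measurableType dT} {R : realType} {d : nat}.
Variables (P : probability T R) (X : nat -> T -> R) (s g : R -> R).
Variables (a : 'I_d -> R -> R) (b : 'I_d -> 'I_d -> R -> R) (C : R).
Hypotheses (mX : forall j, measurable_fun setT (X j)) (ms : measurable_fun setT s).

(** Putting [X 0] in front of the noise makes [X j] a measurable function of the innovations 0, ...,
    j, so the past of the innovations contains that of the chain. *)
Definition innov (j : nat) : T -> R :=
  if j is 0 then X 0%N else fun w => X j w - s (X j.-1 w).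

Local Notation Y := innov.

Hypothesis ind : mutually_independent P Y.
Hypothesis dens : forall j, has_density P (Y j.+1) g.
Hypotheses (gpos : forall x, 0 < g x) (hg : Ck_R 3 g).
Hypotheses (ma : forall i, measurable_fun setT (a i)).
Hypotheses (mb : forall i k, measurable_fun setT (b i k)).

(** [xi] and [qd] are the gradient and the Hessian of the log-density, with [a] and [b] the first
    and second derivatives of S. Every term is a function of one innovation times a function of its
    past. *)
Definition xi (i : 'I_d) (j : nat) (w : T) : R := - (score g (Y j.+1 w) * a i (X j w)).
Definition qd (i k : 'I_d) (j : nat) (w : T) : R :=
  dscore g (Y j.+1 w) * (a i (X j w) * a k (X j w)) - score g (Y j.+1 w) * b i k (X j w).

Hypothesis xi2 : forall i j, L2 P (xi i j) /\ Ex P (fun w => xi i j w ^+ 2) <= C.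
Hypothesis qd2 : forall i k j, L2 P (qd i k j) /\ Ex P (fun w => qd i k j w ^+ 2) <= C.
Variable i0 : 'I_d.
Hypothesis nondeg : 0 < Ex P (fun w => xi i0 0 w ^+ 2).

Lemma innov_measurable j : measurable_fun setT (Y j).
Proof.
case: j => [|j] /=; first exact: mX.
by apply: measurable_funB => //; apply: measurableT_comp.
Qed.
Local Notation mY := innov_measurable.

Lemma past_X n j : (j < n)%N -> measurable_fun setT (X j : past Y n -> R).
Proof.
elim: j => [|j IH] jn; first exact: (past_coord (Y := Y) jn).
have -> : X j.+1 = fun w => Y j.+1 w + s (X j w).
  by apply/funext => w /=; rewrite subrK.
apply: measurable_funD; first exact: (past_coord (Y := Y) jn).
by apply: measurableT_comp => //; apply: IH; exact: ltnW.
Qed.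

Lemma past_comp n j (f : R -> R) : (j < n)%N -> measurable_fun setT f ->
  measurable_fun setT ((fun w => f (X j w)) : past Y n -> R).
Proof. by move=> jn mf; apply: measurableT_comp => //; exact: past_X. Qed.

Let mscore := measurable_score gpos hg.
Let mdscore := measurable_dscore gpos hg.

Let msc2 : measurable_fun setT (fun y => score g y ^+ 2).
Proof. exact: measurable_funX. Qed.

Let mds2 : measurable_fun setT (fun y => dscore g y ^+ 2).
Proof. exact: measurable_funX. Qed.

Let g0 x : 0 <= g x. Proof. exact: ltW. Qed.

Let mg : measurable_fun setT g.
Proof. by apply: continuous_measurable_fun; case: hg. Qed.

(** By independence the integral of the product is the product of the integrals; if it is finite and
    one factor is nonzero, the other factor is finite. *)
Lemma past_L1_right j (F : T -> R) (G : R -> R) :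
  measurable_fun setT (F : past Y j -> R) -> measurable_fun setT G ->
  (forall w, 0 <= F w) -> (forall y, 0 <= G y) ->
  (\int[P]_w (F w)%:E)%E != 0%E -> L1 P (fun w => F w * G (Y j w)) ->
  L1 P (fun w => G (Y j w)).
Proof.
move=> mF mG F0 G0 Fn0 LFG; apply: ge0_L1 => //.
  by apply: (measurableT_comp mG); exact: mY.
apply: (mule_lty_right (x := (\int[P]_w (F w)%:E)%E)) => //.
- by apply: integral_ge0 => w _; rewrite lee_fin.
- by apply: integral_ge0 => w _; rewrite lee_fin.
- rewrite -(past_integral_mul mY ind)//; apply: L1_lty => // w; exact: mulr_ge0.
Qed.

Lemma past_L1_left j (F : T -> R) (G : R -> R) :
  measurable_fun setT (F : past Y j -> R) -> measurable_fun setT G ->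
  (forall w, 0 <= F w) -> (forall y, 0 <= G y) ->
  (\int[P]_w (G (Y j w))%:E)%E != 0%E -> L1 P (fun w => F w * G (Y j w)) ->
  L1 P F.
Proof.
move=> mF mG F0 G0 Gn0 LFG; apply: ge0_L1 => //.
  exact: (past_measW mY mF).
apply: (mule_lty_right (x := (\int[P]_w (G (Y j w))%:E)%E)) => //.
- by apply: integral_ge0 => w _; rewrite lee_fin.
- by apply: integral_ge0 => w _; rewrite lee_fin.
- rewrite muleC -(past_integral_mul mY ind)//; apply: L1_lty => // w; exact: mulr_ge0.
Qed.

Lemma innov_Ex j (f : R -> R) : measurable_fun setT f -> L1 P (fun w => f (Y j.+1 w)) ->
  Ex P (fun w => f (Y j.+1 w)) = fine (\int[lebesgue_measure]_x (f x * g x)%:E)%E.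
Proof.
by move=> mf lf; have [_ ->] := integral_density (mY j.+1) (@dens j) mg g0 mf lf.
Qed.

Lemma innov_L1 j j' (f : R -> R) : measurable_fun setT f ->
  L1 P (fun w => f (Y j.+1 w)) -> L1 P (fun w => f (Y j'.+1 w)).
Proof.
move=> mf lf.
have mf' : measurable_fun setT (fun x => `|f x|) by exact: measurableT_comp.
apply: (@L1_le _ _ _ _ _ (fun w => `|f (Y j'.+1 w)|)) => //.
  by apply: (measurableT_comp mf); exact: mY.
apply: ge0_L1 => //; first by apply: (measurableT_comp mf'); exact: mY.
have law (A : set R) : measurable A -> P (Y j'.+1 @^-1` A) = P (Y j.+1 @^-1` A).
  by move=> mA; rewrite !dens.
have H i : (\int[P]_w (`|f (Y i.+1 w)|)%:E =
    \int[distribution P (mfun_Sub (mem_set (mY i.+1)))]_x (`|f x|)%:E)%E.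
  by rewrite ge0_integral_distribution//; exact/measurable_EFinP.
rewrite H (@eq_measure_integral _ _ _ _ (distribution P (mfun_Sub (mem_set (mY j.+1)))));
  last by move=> A mA _; exact: law.
rewrite -H; apply: L1_lty => //; exact: L1abs.
Qed.

(** The Fisher information of the location family of [g]. It depends on [g] alone, which makes the
    moment bounds uniform in the parameter. *)
Definition noise_info : R := fine (\int[lebesgue_measure]_x (score g x ^+ 2 * g x)%:E)%E.

Let a2score i j : L1 P (fun w => a i (X j w) ^+ 2 * score g (Y j.+1 w) ^+ 2).
Proof.
have [[_ h] _] := xi2 i j; apply: eq_L1 h => w.
by rewrite /xi; ring.
Qed.

Let a2_int_neq0 : (\int[P]_w (a i0 (X 0%N w) ^+ 2)%:E != 0)%E.
Proof.
have := Ex_gt0_neq0 nondeg; apply: contraNneq => e.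
rewrite (_ : (fun w => _) = (fun w => (a i0 (X 0%N w) ^+ 2 * score g (Y 1%N w) ^+ 2)%:E)); last first.
  by apply/funext => w; rewrite /xi; congr EFin; ring.
rewrite (past_integral_mul mY ind (n := 1%N) (F := fun w => a i0 (X 0%N w) ^+ 2)
  (G := fun y => score g y ^+ 2))//.
- by rewrite e mul0e.
- by apply: (past_comp (f := fun x => a i0 x ^+ 2)) => //; exact: measurable_funX.
- by move=> w; rewrite sqr_ge0.
- by move=> w; rewrite sqr_ge0.
Qed.

(** Second moments are assumed only for products of the score with [a]. By [nondeg] the second
    moment of [a i0] at time 0 is nonzero, so the noise factor separates there; equality of laws
    carries the result to every j. *)
Lemma score_L2 j : L2 P (fun w => score g (Y j.+1 w)).
Proof.
split; first by apply: (measurableT_comp mscore); exact: mY.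
apply: (@innov_L1 0 j (fun y => score g y ^+ 2)) => //.
apply: (past_L1_right (j := 1%N) (F := fun w => a i0 (X 0%N w) ^+ 2)
  (G := fun y => score g y ^+ 2)) => //.
- by apply: (past_comp (f := fun x => a i0 x ^+ 2)) => //; exact: measurable_funX.
- by move=> w; rewrite sqr_ge0.
- by move=> w; rewrite sqr_ge0.
Qed.

Lemma score_Ex2 j : Ex P (fun w => score g (Y j.+1 w) ^+ 2) = noise_info.
Proof. by apply: (innov_Ex (f := fun y => score g y ^+ 2)) => //; case: (score_L2 j). Qed.

Lemma noise_info_gt0 : 0 < noise_info.
Proof.
rewrite lt_neqAle -(score_Ex2 0) Ex_ge0 ?andbT; last by move=> w; rewrite sqr_ge0.
apply/negP => /eqP e.
have := nondeg; rewrite (@eq_Ex _ _ _ _ _ (fun w => a i0 (X 0%N w) ^+ 2 * score g (Y 1%N w) ^+ 2)); last first.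
  by move=> w; rewrite /xi; ring.
have [_ ls] := score_L2 0.
rewrite ExE /Rintegral (past_integral_mul mY ind (n := 1%N) (F := fun w => a i0 (X 0%N w) ^+ 2)
  (G := fun y => score g y ^+ 2))//.
- have := expectation_fin ls; rewrite unlock => ->; rewrite -e.
  by rewrite mule0 ltxx.
- by apply: (past_comp (f := fun x => a i0 x ^+ 2)) => //; exact: measurable_funX.
- by move=> w; rewrite sqr_ge0.
- by move=> w; rewrite sqr_ge0.
Qed.

Let score_int_neq0 j : (\int[P]_w (score g (Y j.+1 w) ^+ 2)%:E)%E != 0%E.
Proof. by apply: Ex_gt0_neq0; rewrite score_Ex2 noise_info_gt0. Qed.

Lemma a_L2 i j : L2 P (fun w => a i (X j w)).
Proof.
split; first by apply: measurableT_comp.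
apply: (past_L1_left (j := j.+1) (F := fun w => a i (X j w) ^+ 2)
  (G := fun y => score g y ^+ 2)) => //.
- by apply: (past_comp (f := fun x => a i x ^+ 2)) => //; exact: measurable_funX.
- by move=> w; rewrite sqr_ge0.
- by move=> w; rewrite sqr_ge0.
Qed.

Lemma a_Ex2 i j : Ex P (fun w => a i (X j w) ^+ 2) <= C / noise_info.
Proof.
have [_ h] := xi2 i j; rewrite ler_pdivlMr ?noise_info_gt0// -(score_Ex2 j).
rewrite -(past_ExM mY ind (n := j.+1) (F := fun w => a i (X j w) ^+ 2)
  (G := fun y => score g y ^+ 2))//.
- by apply: le_trans h; rewrite le_eqVlt; apply/orP; left; apply/eqP; apply: eq_Ex => w; rewrite /xi; ring.
- by apply: (past_comp (f := fun x => a i x ^+ 2)) => //; exact: measurable_funX.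
- by case: (a_L2 i j).
- by case: (score_L2 j).
Qed.

Lemma score_Ex j : Ex P (fun w => score g (Y j.+1 w)) = 0.
Proof.
rewrite innov_Ex//; last exact: L2_L1 (score_L2 j).
have [ls _] := integral_density (mY j.+1) (@dens j) mg g0 mscore (L2_L1 (score_L2 j)).
have e : (fun x => (score g x * g x)%:E) = EFin \o derive1 g.
  by apply/funext => x /=; rewrite score_g.
rewrite e in ls *; rewrite integral_derivative0//.
- by case: hg => _ [].
- by case: hg => _ [_ []].
- exact: (density_integrable (@dens j)).
Qed.

(** A weight for which wt, wt a^4 and wt b^2 are all at most 1: fourth moments of [a] and second
    moments of [b] are not yet available. *)
Let wt (x : R) : R := (1 + a i0 x ^+ 4 + b i0 i0 x ^+ 2)^-1.

Let wden x : 1 <= 1 + a i0 x ^+ 4 + b i0 i0 x ^+ 2.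
Proof.
rewrite -addrA lerDl addr_ge0 ?sqr_ge0//.
by rewrite (_ : 4 = 2 * 2)%N// exprM sqr_ge0.
Qed.

Let wt_gt0 x : 0 < wt x.
Proof. by rewrite invr_gt0; exact: lt_le_trans (wden x). Qed.

Let mwt : measurable_fun setT wt.
Proof.
rewrite (_ : wt = fun x => expR (- ln (1 + a i0 x ^+ 4 + b i0 i0 x ^+ 2))).
  apply: measurableT_comp => //; apply: measurable_funN; apply: measurableT_comp => //.
  by apply: measurable_funD; [apply: measurable_funD => //|]; exact: measurable_funX.
apply/funext => x; rewrite expRN lnK// posrE; exact: lt_le_trans (wden x).
Qed.

(** From qd = dscore a^2 - score b one gets wt a^4 dscore^2 <= 2 (qd^2 + score^2), which is
    integrable. The past factor wt a^4 has nonzero integral and is divided out by independence. *)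
Lemma dscore_L2 j : L2 P (fun w => dscore g (Y j.+1 w)).
Proof.
split; first by apply: (measurableT_comp mdscore); exact: mY.
apply: (@innov_L1 0 j (fun y => dscore g y ^+ 2)) => //.
have mF : measurable_fun setT (fun x => a i0 x ^+ 4 * wt x).
  by apply: measurable_funM => //; exact: measurable_funX.
have a4 x : 0 <= a i0 x ^+ 4 by rewrite (_ : 4 = 2 * 2)%N// exprM sqr_ge0.
apply: (past_L1_right (j := 1%N) (F := fun w => a i0 (X 0%N w) ^+ 4 * wt (X 0%N w))
  (G := fun y => dscore g y ^+ 2)) => //.
- by apply: (past_comp (f := fun x => a i0 x ^+ 4 * wt x)).
- by move=> w; rewrite mulr_ge0// ltW.
- by move=> w; rewrite sqr_ge0.
- (* the weighted fourth moment vanishes only if a does almost surely *)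
  apply/negP => /eqP e; move/eqP: a2_int_neq0; apply.
  have mFX : measurable_fun setT (fun w => (a i0 (X 0%N w) ^+ 4 * wt (X 0%N w))%:E).
    by apply/measurable_EFinP; apply: (measurableT_comp mF).
  have ae0 : ae_eq P setT (fun w => (a i0 (X 0%N w) ^+ 4 * wt (X 0%N w))%:E) (cst 0%E).
    apply/(ae_eq_integral_abs P measurableT mFX); rewrite -[RHS]e.
    by apply: eq_integral => w _; rewrite /= ger0_norm// mulr_ge0// ltW.
  rewrite -(integral0 P setT); apply: ae_eq_integral => //.
    apply/measurable_EFinP/measurable_funX; exact: measurableT_comp.
  apply: filterS ae0 => w /(_ I) [/eqP]; rewrite mulf_eq0 expf_eq0/= => h _.
  rewrite (_ : a i0 (X 0%N w) = 0) ?expr0n//.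
  by apply/eqP; case/orP: h => // /eqP h0; have := wt_gt0 (X 0%N w); rewrite h0 ltxx.
have [[mq lq] _] := qd2 i0 i0 0; have [_ ls] := score_L2 0.
apply: (L1_le _ (L1Z 2 (L1D lq ls))) => [|w].
  apply: measurable_funM; first by apply: (measurableT_comp mF).
  by apply: measurable_funX; apply: (measurableT_comp mdscore); exact: mY.
rewrite ger0_norm; last by rewrite mulr_ge0 ?sqr_ge0// mulr_ge0 ?a4// ltW.
rewrite -/(wt _) /qd; set A := a i0 _; set B := b i0 i0 _; set p := dscore g _; set r := score g _.
set W := wt _; have W0 : 0 < W by exact: wt_gt0.
have W1 : W * (1 + A ^+ 4 + B ^+ 2) = 1.
  by rewrite /W /wt mulVf// gt_eqF//; exact: lt_le_trans (wden _).
have A4 : 0 <= A ^+ 4 by exact: a4.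
have WA : W * A ^+ 4 <= 1 by have := mulr_ge0 (ltW W0) (sqr_ge0 B); nra.
have WB : W * B ^+ 2 <= 1 by have := mulr_ge0 (ltW W0) A4; nra.
have Wle : W <= 1 by have := mulr_ge0 (ltW W0) A4; have := mulr_ge0 (ltW W0) (sqr_ge0 B); nra.
set q := p * (A * A) - r * B.
have -> : A ^+ 4 * W * p ^+ 2 = W * (q + r * B) ^+ 2 by rewrite /q; ring.
have h1 : W * (q + r * B) ^+ 2 <= 2 * (W * q ^+ 2 + (W * B ^+ 2) * r ^+ 2).
  rewrite -subr_ge0 (_ : _ - _ = W * (q - r * B) ^+ 2); last by ring.
  by rewrite mulr_ge0 ?sqr_ge0// ltW.
apply: (le_trans h1); rewrite ler_wpM2l// lerD//.
  by rewrite ler_piMl ?sqr_ge0.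
by rewrite ler_piMl ?sqr_ge0.
Qed.

Lemma dscore_Ex j : Ex P (fun w => dscore g (Y j.+1 w)) = - noise_info.
Proof.
have ld := L2_L1 (dscore_L2 j); have [_ ls] := score_L2 j.
have mf : measurable_fun setT (fun y => dscore g y + score g y ^+ 2).
  exact: measurable_funD.
have lf : L1 P (fun w => dscore g (Y j.+1 w) + score g (Y j.+1 w) ^+ 2) by exact: L1D.
suff : Ex P (fun w => dscore g (Y j.+1 w) + score g (Y j.+1 w) ^+ 2) = 0.
  by rewrite ExD// score_Ex2 => /eqP; rewrite addr_eq0 => /eqP.
rewrite (innov_Ex mf)//.
have [lg _] := integral_density (mY j.+1) (@dens j) mg g0 mf lf.
have [lg' _] := integral_density (mY j.+1) (@dens j) mg g0 mscore (L2_L1 (score_L2 j)).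
have e : (fun x => ((dscore g x + score g x ^+ 2) * g x)%:E) = EFin \o derive1 (derive1 g).
  by apply/funext => x /=; rewrite dscore_g.
have e' : (fun x => (score g x * g x)%:E) = EFin \o derive1 g.
  by apply/funext => x /=; rewrite score_g.
rewrite e in lg *; rewrite e' in lg'; rewrite integral_derivative0//.
- by case: hg => _ [_ [_ []]].
- by case: hg => _ [_ [_ [_ []]]].
Qed.

(** Let y be the mean of a^4 over the set where a^2 + b^2 <= n, and J = [noise_info]. Testing
    [qd i i] against a^2 on that set kills the score term and gives - J y, so J^2 y^2 <= y C by
    Cauchy-Schwarz. The bound C / J^2 is free of n, which removes the truncation, and of the
    parameter. *)
Lemma a_fourth i j : L2 P (fun w => a i (X j w) ^+ 2) /\
  Ex P (fun w => (a i (X j w) ^+ 2) ^+ 2) <= C / noise_info ^+ 2.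
Proof.
pose A n : set T := [set w | a i (X j w) ^+ 2 + b i i (X j w) ^+ 2 <= n%:R].
pose AR n : set R := [set x | a i x ^+ 2 + b i i x ^+ 2 <= n%:R].
have mAR n : measurable (AR n).
  rewrite -[X in measurable X]setTI; apply: measurable_fun_ler => //.
  by apply: measurable_funD; apply: measurable_funX; [exact: ma|exact: mb].
have mA n : measurable (A n).
  by rewrite -[X in measurable X]setTI; exact: (mX j measurableT (mAR n)).
have ind1 n w : \1_(A n) w = \1_(AR n) (X j w) :> R.
  by rewrite !indicE; congr (_%:R); congr nat_of_bool; apply/idP/idP; rewrite !inE.
have pA n : measurable_fun setT ((\1_(A n) : T -> R) : past Y j.+1 -> R).
  rewrite (_ : \1_(A n) = fun w => \1_(AR n) (X j w)); last by apply/funext => w; exact: ind1.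
  by apply: (past_comp (f := \1_(AR n))) => //; exact: measurable_indic.
have mf : measurable_fun setT (fun w => (a i (X j w) ^+ 2) ^+ 2).
  by do 2 apply: measurable_funX; apply: measurableT_comp.
have bd n w : \1_(A n) w * a i (X j w) ^+ 2 <= n%:R.
  rewrite indicE; have [h|_] := boolP (w \in A n); last by rewrite mul0r.
  by rewrite inE in h; rewrite mul1r (le_trans _ h)// lerDl sqr_ge0.
have bdb n w : `|\1_(A n) w * b i i (X j w)| <= 1 + n%:R.
  rewrite indicE; have [h|_] := boolP (w \in A n); last by rewrite mul0r normr0 addr_ge0.
  rewrite inE /A/= in h; rewrite mul1r.
  have := sqr_ge0 (a i (X j w)); have := sqr_ge0 (1 - `|b i i (X j w)|).
  by rewrite -[b i i (X j w) ^+ 2]real_normK ?num_real// in h; have := normr_ge0 (b i i (X j w)); nra.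
have i01 n w : 0 <= (\1_(A n) w : R) <= 1.
  by rewrite indicE ler0n lern1 leq_b1.
have sq1 n w (x : R) : (\1_(A n) w * x) ^+ 2 = \1_(A n) w * x ^+ 2.
  by rewrite exprMn indicE -natrX; case: (_ \in _).
have LA n : L1 P (fun w => \1_(A n) w * (a i (X j w) ^+ 2) ^+ 2).
  apply: (@L1_bounded _ _ _ _ _ (n%:R ^+ 2)).
    by apply: measurable_funM => //; exact: measurable_indic.
  move=> w; have -> : \1_(A n) w * (a i (X j w) ^+ 2) ^+ 2 = (\1_(A n) w * a i (X j w) ^+ 2) ^+ 2.
    by rewrite sq1.
  have [h1 h2] := andP (i01 n w).
  by rewrite normrX lerXn2r ?nnegrE ?normr_ge0 ?ler0n// ger0_norm ?bd// mulr_ge0 ?sqr_ge0.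
have Lq1 n : L2 P (fun w => \1_(A n) w * a i (X j w) ^+ 2).
  split.
    by apply: measurable_funM; [exact: measurable_indic|apply: measurable_funX; exact: measurableT_comp].
  by apply: eq_L1 (LA n) => w; rewrite sq1.
have noise0 := noise_info_gt0.
have key n : Ex P (fun w => \1_(A n) w * (a i (X j w) ^+ 2) ^+ 2) <= C / noise_info ^+ 2.
  set y := Ex P _; have y0 : 0 <= y.
    by apply: Ex_ge0 => w; rewrite mulr_ge0 ?sqr_ge0//; have [] := andP (i01 n w).
  have [lq hq] := qd2 i i j.
  have e2 : Ex P (fun w => (\1_(A n) w * a i (X j w) ^+ 2) ^+ 2) = y.
    by apply: eq_Ex => w; rewrite sq1.
  have := Ex_CS (Lq1 n) lq; rewrite e2.
  have L1b : L1 P (fun w => (\1_(A n) w * a i (X j w) ^+ 2) * b i i (X j w)).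
    apply: (@L1_bounded _ _ _ _ _ (n%:R * (1 + n%:R))).
      apply: measurable_funM; first by case: (Lq1 n).
      exact: measurableT_comp.
    move=> w; have -> : (\1_(A n) w * a i (X j w) ^+ 2) * b i i (X j w) =
        (\1_(A n) w * a i (X j w) ^+ 2) * (\1_(A n) w * b i i (X j w)).
      by rewrite indicE; case: (_ \in _); rewrite ?mul1r ?mul0r.
    rewrite normrM ler_pM// ger0_norm//.
    by rewrite mulr_ge0 ?sqr_ge0//; have [] := andP (i01 n w).
  have pF : measurable_fun setT ((fun w => \1_(A n) w * (a i (X j w) ^+ 2) ^+ 2) : past Y j.+1 -> R).
    apply: measurable_funM => //; apply: (past_comp (f := fun x => (a i x ^+ 2) ^+ 2)) => //.
    by do 2 apply: measurable_funX.
  have pG : measurable_fun setT ((fun w => (\1_(A n) w * a i (X j w) ^+ 2) * b i i (X j w)) : past Y j.+1 -> R).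
    apply: measurable_funM; last exact: (past_comp (f := b i i)).
    by apply: measurable_funM => //; apply: (past_comp (f := fun x => a i x ^+ 2)) => //; exact: measurable_funX.
  have l1 := past_L1M mY ind pF mdscore (LA n) (L2_L1 (dscore_L2 j)).
  have l2 := past_L1M mY ind pG mscore L1b (L2_L1 (score_L2 j)).
  have -> : Ex P (fun w => \1_(A n) w * a i (X j w) ^+ 2 * qd i i j w) = - (noise_info * y).
    rewrite (@eq_Ex _ _ _ _ _ (fun w => (\1_(A n) w * (a i (X j w) ^+ 2) ^+ 2) * dscore g (Y j.+1 w) -
       (\1_(A n) w * a i (X j w) ^+ 2) * b i i (X j w) * score g (Y j.+1 w))); last first.
      by move=> w; rewrite /qd; ring.
    rewrite ExB// (past_ExM mY ind pF mdscore (LA n) (L2_L1 (dscore_L2 j))).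
    rewrite (past_ExM mY ind pG mscore L1b (L2_L1 (score_L2 j))).
    by rewrite /comp dscore_Ex score_Ex mulr0 subr0 -/y; ring.
  rewrite sqrrN exprMn => h.
  have {}h : noise_info ^+ 2 * y ^+ 2 <= y * C.
    by apply: (le_trans h); rewrite ler_wpM2l.
  have n2 : 0 < noise_info ^+ 2 by rewrite exprn_gt0.
  rewrite ler_pdivlMr//; have [->|yn0] := eqVneq y 0.
    rewrite mul0r; apply: le_trans hq; apply: Ex_ge0 => w; exact: sqr_ge0.
  have yp : 0 < y by rewrite lt_neqAle eq_sym yn0.
  by rewrite -(ler_pM2l yp) (le_trans _ h)//; rewrite le_eqVlt; apply/orP; left; apply/eqP; ring.
have ndA m p : (m <= p)%N -> A m `<=` A p.
  by move=> mp w /le_trans; apply; rewrite ler_nat.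
have cA w : exists m, A m w.
  by exists (Num.truncn (a i (X j w) ^+ 2 + b i i (X j w) ^+ 2)).+1; exact/ltW/truncnS_gt.
have [L Eb] := Ex_truncation_bound mf (fun w => sqr_ge0 _) mA ndA cA key LA.
split => //; split => //; apply: measurable_funX; exact: measurableT_comp.
Qed.

Lemma aa_L2 i k j : L2 P (fun w => a i (X j w) * a k (X j w)).
Proof.
apply: (L2_le _ (L2D (a_fourth i j).1 (a_fourth k j).1)) => [|w].
  by apply: measurable_funM; exact: measurableT_comp.
set x := a i _; set y := a k _.
rewrite [leRHS]ger0_norm ?addr_ge0 ?sqr_ge0// ler_norml.
have := sqr_ge0 (x - y); have := sqr_ge0 (x + y); have := sqr_ge0 x; have := sqr_ge0 y.
nra.
Qed.

Lemma b_L2 i k j : L2 P (fun w => b i k (X j w)).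
Proof.
split; first exact: measurableT_comp.
have mb2 : measurable_fun setT (fun x => b i k x ^+ 2) by exact: measurable_funX.
apply: (past_L1_left (j := j.+1) (F := fun w => b i k (X j w) ^+ 2)
  (G := fun y => score g y ^+ 2)) => //.
- exact: (past_comp (f := fun x => b i k x ^+ 2)).
- by move=> w; rewrite sqr_ge0.
- by move=> w; rewrite sqr_ge0.
have maa : measurable_fun setT (fun x => (a i x * a k x) ^+ 2).
  by apply: measurable_funX; exact: measurable_funM.
have paa := past_comp (ltnSn j) maa.
have l1 := past_L1M mY ind paa mds2 (aa_L2 i k j).2 (dscore_L2 j).2.
have [[_ lq] _] := qd2 i k j.
apply: (L1_le _ (L1Z 2 (L1D l1 lq))) => [|w].
  apply: measurable_funM; first by apply: (measurableT_comp mb2).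
  by apply: (measurableT_comp msc2); exact: mY.
rewrite ger0_norm; last by apply: mulr_ge0; exact: sqr_ge0.
rewrite /qd.
set x := a i _ * _; set y := b i k _; set p := dscore g _; set r := score g _.
have -> : y ^+ 2 * r ^+ 2 = (p * x - (p * x - r * y)) ^+ 2 by ring.
have := sqr_ge0 (p * x + (p * x - r * y)); set z := p * x - r * y.
by rewrite -[x ^+ 2 * p ^+ 2]exprMn [x * p]mulrC; set v := p * x; nra.
Qed.

Lemma xi_Ex0 j i (F : T -> R) : measurable_fun setT (F : past Y j.+1 -> R) ->
  L2 P F -> Ex P (fun w => F w * xi i j w) = 0.
Proof.
move=> pF lF.
have pFa : measurable_fun setT ((fun w => F w * a i (X j w)) : past Y j.+1 -> R).
  by apply: measurable_funM => //; exact: (past_comp (f := a i)).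
have lFa := L2M lF (a_L2 i j).
rewrite (@eq_Ex _ _ _ _ _ (fun w => (- 1) * ((F w * a i (X j w)) * score g (Y j.+1 w)))); last first.
  by move=> w; rewrite /xi; ring.
have ls := L2_L1 (score_L2 j).
rewrite ExZ; last exact: (past_L1M mY ind pFa mscore lFa ls).
by rewrite (past_ExM mY ind pFa mscore lFa ls) /comp score_Ex !mulr0.
Qed.

(* the information identity, conditionally on the past *)
Lemma xi_qd_Ex0 j i k (F : T -> R) (M : R) : measurable_fun setT (F : past Y j.+1 -> R) ->
  (forall w, `|F w| <= M) ->
  Ex P (fun w => F w * (xi i j w * xi k j w)) = - Ex P (fun w => F w * qd i k j w).
Proof.
move=> pF FM; have mF := past_measW mY pF.
have lF (G : T -> R) : L1 P G -> L1 P (fun w => F w * G w).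
  move=> lG; apply: (L1_le _ (L1Z M (L1abs lG))) => [|w].
    by apply: measurable_funM => //; exact: (L1_meas lG).
  by rewrite normrM ler_wpM2r.
have pFa : measurable_fun setT ((fun w => F w * (a i (X j w) * a k (X j w))) : past Y j.+1 -> R).
  by do 2 apply: measurable_funM => //; [exact: (past_comp (f := a i))|exact: (past_comp (f := a k))].
have pFb : measurable_fun setT ((fun w => F w * b i k (X j w)) : past Y j.+1 -> R).
  by apply: measurable_funM => //; exact: (past_comp (f := b i k)).
have lFa := lF _ (L2_L1 (aa_L2 i k j)); have lFb := lF _ (L2_L1 (b_L2 i k j)).
have ls := L2_L1 (score_L2 j); have ld := L2_L1 (dscore_L2 j); have ls2 := (score_L2 j).2.
rewrite (@eq_Ex _ _ _ _ _ (fun w => (F w * (a i (X j w) * a k (X j w))) * score g (Y j.+1 w) ^+ 2)); last first.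
  by move=> w; rewrite /xi; ring.
rewrite (past_ExM mY ind pFa msc2 lFa ls2) /comp score_Ex2.
rewrite (@eq_Ex _ _ _ _ (fun w => F w * qd i k j w) (fun w => (F w * (a i (X j w) * a k (X j w))) * dscore g (Y j.+1 w) -
   (F w * b i k (X j w)) * score g (Y j.+1 w))); last first.
  by move=> w; rewrite /qd; ring.
rewrite ExB; [|exact: (past_L1M mY ind pFa mdscore lFa ld)|exact: (past_L1M mY ind pFb mscore lFb ls)].
rewrite (past_ExM mY ind pFa mdscore lFa ld) (past_ExM mY ind pFb mscore lFb ls).
by rewrite /comp dscore_Ex score_Ex mulr0 subr0 mulrN opprK.
Qed.

Lemma past_xi n i j : (j.+1 < n)%N -> measurable_fun setT (xi i j : past Y n -> R).
Proof.
move=> jn; apply: measurable_funN; apply: measurable_funM.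
  by apply: (measurableT_comp mscore); exact: (past_coord (Y := Y) jn).
by apply: (past_comp (f := a i)) => //; exact: ltnW.
Qed.

Lemma past_psum (h : 'rV[R]_d -> R) r j : coord_measurable h ->
  measurable_fun setT ((fun w => h (psum xi r j w)) : past Y j.+1 -> R).
Proof.
move=> mh; have := mh _ (past Y j.+1) (fun i w => r * \sum_(l < j) xi i l w).
have -> : (fun w => h (\row_i (r * \sum_(l < j) xi i l w))) = fun w => h (psum xi r j w).
  apply/funext => w; congr h; apply/rowP => k; rewrite !mxE summxE; congr (_ * _).
  by apply: eq_bigr => l _; rewrite mxE.
apply => i; apply: measurable_funM => //; apply: measurable_sum => l.
by apply: past_xi; rewrite ltnS.
Qed.

(** The partial sum up to k lies in the past of [xi i k], so cross terms vanish and variances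
    add. *)
Lemma xi_sum_Ex2 i k : L2 P (fun w => \sum_(l < k) xi i l w) /\
  Ex P (fun w => (\sum_(l < k) xi i l w) ^+ 2) <= k%:R * C.
Proof.
have LS j : L2 P (fun w => \sum_(l < j) xi i l w) by apply: L2_sum => l; have [] := xi2 i l.
split; first exact: LS.
elim: k => [|k IH].
  rewrite (@eq_Ex _ _ _ _ _ (fun=> 0)) ?Exc ?mul0r// => w.
  by rewrite big_ord0 expr0n.
have [lx ex] := xi2 i k.
rewrite (@eq_Ex _ _ _ _ _ (fun w => (\sum_(l < k) xi i l w) ^+ 2 +
   2 * ((\sum_(l < k) xi i l w) * xi i k w) + xi i k w ^+ 2)); last first.
  by move=> w; rewrite big_ord_recr/=; ring.
have a1 := L1Z 2 (L2M (LS k) lx).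
rewrite (ExD (L1D (LS k).2 a1) lx.2) (ExD (LS k).2 a1) ExZ; last exact: L2M.
rewrite xi_Ex0//; last by apply: measurable_sum => l; apply: past_xi; rewrite ltnS.
by rewrite mulr0 addr0 -natr1 mulrDl mul1r lerD.
Qed.

(** The tail of the second moment of the noise score, again a function of [g] alone: one truncation
    level serves every parameter, as a uniform Lindeberg condition requires. *)
Definition noise_tail (A : R) : R :=
  fine (\int[lebesgue_measure]_x ((score g x ^+ 2 * \1_[set y | A < `|score g y|] x) * g x)%:E)%E.

Let mtail (A : R) : measurable_fun setT
  (fun y => score g y ^+ 2 * \1_[set y | A < `|score g y|] y).
Proof.
apply: measurable_funM => //; apply: measurable_indic.
rewrite -[X in measurable X]setTI; apply: measurable_fun_ltr => //.
exact: measurableT_comp.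
Qed.

Lemma noise_tail_L1 (A : R) j :
  L1 P (fun w => score g (Y j.+1 w) ^+ 2 * \1_[set y | A < `|score g y|] (Y j.+1 w)).
Proof.
apply: (L1_le _ (score_L2 j).2) => [|w].
  by apply: (measurableT_comp (mtail A)); exact: mY.
rewrite ger0_norm; last by apply: mulr_ge0; [exact: sqr_ge0|rewrite indicE ler0n].
by rewrite indicE; case: (_ \in _); rewrite ?mulr1 ?mulr0 ?sqr_ge0.
Qed.

Lemma noise_tail_Ex (A : R) j :
  Ex P (fun w => score g (Y j.+1 w) ^+ 2 * \1_[set y | A < `|score g y|] (Y j.+1 w)) = noise_tail A.
Proof. by apply: (innov_Ex (mtail A)); exact: noise_tail_L1. Qed.

Lemma noise_tail_cvg (e : R) : 0 < e -> exists2 A : R, 0 <= A & noise_tail A <= e.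
Proof.
move=> e0.
pose F (n : nat) w := (score g (Y 1%N w) ^+ 2 * \1_[set y | n%:R < `|score g y|] (Y 1%N w))%:E.
have := @dominated_convergence _ _ _ P setT measurableT F (cst 0%E)
  (fun w => (score g (Y 1%N w) ^+ 2)%:E) _ _ _ (score_L2 0).2 _.
case.
- by move=> n; apply/measurable_EFinP; exact: (L1_meas (noise_tail_L1 n%:R 0)).
- exact: measurable_cst.
- apply: aeW => w _; apply: cvg_near_cst; near=> n.
  rewrite /F indicE memNset ?mulr0// => /=; apply/negP; rewrite -leNgt.
  near: n; exact: nbhs_infty_ger.
- apply: aeW => w n _; rewrite /F gee0_abs; last first.
    by rewrite lee_fin; apply: mulr_ge0; [exact: sqr_ge0|rewrite indicE ler0n].
  by rewrite lee_fin indicE; case: (_ \in _); rewrite ?mulr1 ?mulr0 ?sqr_ge0.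
move=> _ _; rewrite integral0 => /fine_cvgP[_] /cvgrPdist_le/(_ e e0)[N _ /(_ N (leqnn N))].
rewrite sub0r normrN /= => h; exists N%:R => //.
rewrite -(noise_tail_Ex N%:R 0) (le_trans (ler_norm _))// /Ex unlock; exact: h.
Unshelve. all: by end_near. Qed.

(** Where the noise score is at most A, the cubic term is used, with |a|^3 <= 1 + |a|^4 and the
    fourth moments of [a]; elsewhere the quadratic term is used and independence splits off
    [noise_tail A]. *)
Lemma xi_min (A r : R) j : 0 <= A -> 0 <= r ->
  Ex P (fun w => Num.min (`|xv xi j w| ^+ 2) (r * `|xv xi j w| ^+ 3)) <=
  d%:R * (C / noise_info * noise_tail A) +
  r * (A ^+ 3 * (1 + d%:R * (C / noise_info ^+ 2))).
Proof.
move=> A0 r0.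
pose tl w := score g (Y j.+1 w) ^+ 2 * \1_[set y | A < `|score g y|] (Y j.+1 w).
have tl0 w : 0 <= tl w by apply: mulr_ge0; [exact: sqr_ge0|rewrite indicE ler0n].
pose F w := \sum_i a i (X j w) ^+ 2 * tl w + r * (A ^+ 3 * (1 + \sum_i (a i (X j w) ^+ 2) ^+ 2)).
have ma2 i : measurable_fun setT (fun x => a i x ^+ 2) by exact: measurable_funX.
have pa2 i := past_comp (ltnSn j) (ma2 i).
have la2 i : L1 P (fun w => a i (X j w) ^+ 2) by case: (a_L2 i j).
have lt i : L1 P (fun w => a i (X j w) ^+ 2 * tl w).
  exact: (past_L1M mY ind (pa2 i) (mtail A) (la2 i) (noise_tail_L1 A j)).
have l4 i : L1 P (fun w => (a i (X j w) ^+ 2) ^+ 2) by case: (a_fourth i j) => -[].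
have l4s : L1 P (fun w => 1 + \sum_i (a i (X j w) ^+ 2) ^+ 2).
  by apply: L1D; [exact: L1c|apply: L1_sum].
have lts : L1 P (fun w => \sum_i a i (X j w) ^+ 2 * tl w) by apply: L1_sum.
have l4r : L1 P (fun w => r * (A ^+ 3 * (1 + \sum_i (a i (X j w) ^+ 2) ^+ 2))).
  by do 2 apply: L1Z.
have mn : measurable_fun setT (fun w => `|xv xi j w|).
  by apply: measurable_xv_norm => i l; exact: (xi2 i l).1.
have bound w : Num.min (`|xv xi j w| ^+ 2) (r * `|xv xi j w| ^+ 3) <= F w.
  pose av : 'rV[R]_d := \row_i a i (X j w).
  have S2 : `|av| ^+ 2 <= \sum_i a i (X j w) ^+ 2.
    have S0 : 0 <= \sum_i a i (X j w) ^+ 2 by apply: sumr_ge0 => i _; exact: sqr_ge0.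
    rewrite -[leRHS]sqr_sqrtr// lerXn2r ?nnegrE ?sqrtr_ge0//.
    apply: norm_le_entries => [|z i]; first exact: sqrtr_ge0.
    rewrite mxE -sqrtr_sqr ler_wsqrtr// (bigD1 i)//= lerDl.
    by apply: sumr_ge0 => l _; exact: sqr_ge0.
  have S4 : (`|av| ^+ 2) ^+ 2 <= \sum_i (a i (X j w) ^+ 2) ^+ 2.
    have S0 : 0 <= \sum_i (a i (X j w) ^+ 2) ^+ 2 by apply: sumr_ge0 => i _; exact: sqr_ge0.
    have [/eqP av0|avp] := boolP (`|av| == 0); first by rewrite av0 !expr0n.
    have [[z i] /= e] := mx_norm_neq0 avp; rewrite -[`|av|]/(mx_norm av) e mxE.
    rewrite real_normK ?num_real// (bigD1 i)//= lerDl.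
    by apply: sumr_ge0 => l _; exact: sqr_ge0.
  set p := score g (Y j.+1 w).
  have xa : `|xv xi j w| <= `|p| * `|av|.
    apply: norm_le_entries => [|z i]; first by rewrite mulr_ge0.
    rewrite mxE /xi normrN normrM ler_wpM2l//.
    by have := norm_entry av 0 i; rewrite mxE.
  have s20 : 0 <= \sum_i a i (X j w) ^+ 2 * tl w.
    by apply: sumr_ge0 => i _; rewrite mulr_ge0// sqr_ge0.
  have [pA|pA] := leP `|p| A.
    apply: (@le_trans _ _ (r * `|xv xi j w| ^+ 3)); first by rewrite ge_min lexx orbT.
    rewrite /F -[leLHS]add0r lerD// ler_wpM2l//.
    apply: (@le_trans _ _ ((A * `|av|) ^+ 3)).
      by rewrite lerXn2r ?nnegrE ?mulr_ge0// (le_trans xa)// ler_wpM2r.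
    rewrite exprMn ler_wpM2l ?exprn_ge0//.
    have h : `|av| ^+ 3 <= 1 + (`|av| ^+ 2) ^+ 2.
      have := sqr_ge0 (`|av| ^+ 2 - `|av|); have := sqr_ge0 (`|av| - 1).
      have := sqr_ge0 (`|av| ^+ 2 - 1); have := normr_ge0 av; set v := `|av|; nra.
    by apply: (le_trans h); rewrite lerD2l.
  apply: (@le_trans _ _ (`|xv xi j w| ^+ 2)); first by rewrite ge_min lexx.
  rewrite /F -[leLHS]addr0 lerD//; last first.
    rewrite mulr_ge0// mulr_ge0 ?exprn_ge0// addr_ge0// sumr_ge0// => i _; exact: sqr_ge0.
  rewrite -mulr_suml /tl indicE mem_set// mulr1.
  apply: (@le_trans _ _ ((`|p| * `|av|) ^+ 2)); first by rewrite lerXn2r ?nnegrE ?mulr_ge0.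
  by rewrite exprMn real_normK ?num_real// mulrC ler_wpM2r// sqr_ge0.
apply: (@le_trans _ _ (Ex P F)).
  apply: Ex_le; [|by apply: L1D|exact: bound].
  apply: (L1_le _ (L1D lts l4r)) => [|w].
    apply: measurable_minr; first exact: measurable_funX.
    by apply: measurable_funM => //; exact: measurable_funX.
  rewrite ger0_norm; first exact: bound.
  by rewrite le_min exprn_ge0//= mulr_ge0// exprn_ge0.
have noise0 := noise_info_gt0.
have tail0 : 0 <= noise_tail A by rewrite -(noise_tail_Ex A j); exact: Ex_ge0.
rewrite /F ExD// lerD//.
  rewrite Ex_sum// (@le_trans _ _ (\sum_(i < d) C / noise_info * noise_tail A))//; last first.
    by rewrite sumr_const card_ord -[leLHS]mulr_natl.
  apply: ler_sum => i _.
  rewrite (past_ExM mY ind (pa2 i) (mtail A) (la2 i) (noise_tail_L1 A j)) [_ \o _]/comp noise_tail_Ex.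
  by rewrite ler_wpM2r// a_Ex2.
rewrite ExZ; last exact: L1Z.
rewrite ExZ// ler_wpM2l// ler_wpM2l ?exprn_ge0//.
rewrite ExD; [|exact: L1c|exact: L1_sum].
rewrite Exc lerD2l Ex_sum// (@le_trans _ _ (\sum_(i < d) C / noise_info ^+ 2))//; last first.
  by rewrite sumr_const card_ord -[leLHS]mulr_natl.
by apply: ler_sum => i _; have [_] := a_fourth i j.
Qed.

End Chain.

(** * Square roots of matrices *)

Section Roots.
Context {R : realType} {d : nat}.
Implicit Types (A B C : 'M[R]_d) (v w : 'rV[R]_d).

Lemma sqnorm_eq0 v : (v *m v^T) 0 0 = 0 -> v = 0.
Proof.
rewrite mxE => h; apply/rowP => i; rewrite mxE.
have /allP/(_ i (mem_index_enum i)) : all (fun j => true ==> (v 0 j * v^T j 0 == 0)) (index_enum 'I_d).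
  by rewrite -psumr_eq0 ?h// => j _; rewrite mxE -expr2 sqr_ge0.
by rewrite /= mxE -expr2 sqrf_eq0 => /eqP.
Qed.

Lemma sqnorm_ge0 v : 0 <= (v *m v^T) 0 0.
Proof. by rewrite mxE sumr_ge0// => i _; rewrite mxE -expr2 sqr_ge0. Qed.

Let mxD (M N : 'M[R]_1) : (M + N) 0 0 = M 0 0 + N 0 0. Proof. by rewrite mxE. Qed.
Let mxZ (s : R) (M : 'M[R]_1) : (s *: M) 0 0 = s * M 0 0. Proof. by rewrite mxE. Qed.

(** With w = v B, a = w w^T and b = w B w^T, positivity at v + s w reads 0 <= 2 s a + s^2 b, and a
    small negative s forces a = 0. The choice s = - a / (1 + b) covers b = 0 as well. *)
Lemma psd_kernel B v : B^T = B -> psd B -> (v *m B *m v^T) 0 0 = 0 -> v *m B = 0.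
Proof.
move=> Bs Bp v0; apply: sqnorm_eq0.
set w := v *m B.
have wv : w *m B *m v^T = w *m w^T by rewrite /w !trmx_mul Bs !mulmxA.
have q (s : R) : 0 <= 2 * s * (w *m w^T) 0 0 + s ^+ 2 * (w *m B *m w^T) 0 0.
  have := Bp (v + s *: w); rewrite linearD linearZ /= !mulmxDl !mulmxDr -!scalemxAl -!scalemxAr.
  by rewrite !(mxD, mxZ) v0 wv -/w; set x := (w *m w^T) 0 0; set y := (_ *m _) 0 0; lra.
have a0 := sqnorm_ge0 w.
have b0 : 0 <= (w *m B *m w^T) 0 0 by exact: Bp.
move: q a0 b0; set a := (w *m w^T) 0 0; set b := (w *m B *m w^T) 0 0 => q a0 b0.
have c0 : 0 < 1 + b by lra.
have e : (a / (1 + b)) * (1 + b) = a by rewrite divfK// gt_eqF.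
have := q (- (a / (1 + b))); rewrite sqrrN; move: e.
set i := a / (1 + b) => e; rewrite -[in X in _ * X]e.
have i0 : 0 <= i by rewrite divr_ge0// ltW.
move=> h; have : i ^+ 2 * (2 + b) <= 0 by nra.
rewrite pmulr_lle0; last by lra.
move=> s2; have /eqP : i ^+ 2 = 0 by apply/le_anti; rewrite s2 sqr_ge0.
by rewrite sqrf_eq0 -e => /eqP ->; rewrite mul0r.
Qed.

Lemma unitmx_root A B : A \in unitmx -> B *m B = A -> B \in unitmx.
Proof. by move=> uA e; move: uA; rewrite -e unitmx_mul andbb. Qed.

Lemma mxtrace_rows A : \tr A = \sum_i (uvec i *m A *m (uvec i)^T) 0 0.
Proof.
by apply: eq_bigr => i _; rewrite /uvec trmx_delta -rowE -colE !mxE.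
Qed.

(** With D = B - C, the identity B D = - D C makes the traces of D B D and D C D opposite. Both are
    nonnegative, hence zero, so every row of D is annihilated by B, which is invertible. *)
Lemma psd_root_unique A B C : A \in unitmx -> B^T = B -> psd B -> B *m B = A ->
  C^T = C -> psd C -> C *m C = A -> B = C.
Proof.
move=> uA Bs Bp BA Cs Cp CA; set D := B - C.
have uB := unitmx_root uA BA.
have Ds : D^T = D by rewrite /D linearB /= Bs Cs.
have BD : B *m D = - (D *m C).
  by rewrite /D mulmxBr mulmxBl BA CA opprB.
have tr0 : \tr (D *m B *m D) + \tr (D *m C *m D) = 0.
  have -> : \tr (D *m B *m D) = - \tr (D *m (D *m C)) by rewrite -mulmxA BD mulmxN linearN.
  by rewrite mxtrace_mulC addNr.
have pos (M : 'M[R]_d) i : psd M -> 0 <= (uvec i *m (D *m M *m D) *m (uvec i)^T) 0 0.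
  by move=> Mp; have := Mp (uvec i *m D); rewrite trmx_mul Ds !mulmxA.
have z i : (uvec i *m (D *m B *m D) *m (uvec i)^T) 0 0 = 0.
  have /eqP := tr0; rewrite paddr_eq0; last 2 first.
    by rewrite mxtrace_rows sumr_ge0// => j _; exact: pos.
  - by rewrite mxtrace_rows sumr_ge0// => j _; exact: pos.
  case/andP => + _; rewrite mxtrace_rows psumr_eq0; last by move=> j _; exact: pos.
  by move=> /allP/(_ i (mem_index_enum i))/= /eqP.
suff D0 : D = 0 by apply/eqP; rewrite -subr_eq0 -/D D0.
apply/row_matrixP => i; rewrite row0 rowE -[delta_mx _ _]/(uvec i).
have h : uvec i *m D *m B = 0.
  by apply: psd_kernel => //; have := z i; rewrite trmx_mul Ds !mulmxA.
by have := mulmxK uB (uvec i *m D); rewrite h mul0mx => <-.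
Qed.

Lemma psd_invmx B : B \in unitmx -> B^T = B -> psd B ->
  (invmx B)^T = invmx B /\ psd (invmx B).
Proof.
move=> uB Bs Bp; have s : (invmx B)^T = invmx B by rewrite trmx_inv Bs.
split=> // v; have := Bp (v *m invmx B).
by rewrite trmx_mul s mulmxKV// mulmxA.
Qed.

Lemma invmx_root A B : A \in unitmx -> B *m B = A -> invmx B *m invmx B = invmx A.
Proof.
move=> uA e; have uB := unitmx_root uA e.
have h : invmx B *m invmx B *m A = 1%:M by rewrite -e !mulmxA mulmxKV// mulVmx.
by rewrite -[LHS](mulmxK uA) h mul1mx.
Qed.

(* If A has no psd square root, neither has its inverse, and both sides are 0. *)
Lemma msqrt_invmx A : A \in unitmx -> msqrt A *m invmx A = msqrt (invmx A).
Proof.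
move=> uA; have uVA : invmx A \in unitmx by rewrite unitmx_inv.
rewrite /msqrt; set S := [set B | _]; set S' := [set B | _].
have SS' (M N : 'M[R]_d) B : M \in unitmx -> invmx M = N ->
    B^T = B /\ psd B /\ B *m B = M ->
    (invmx B)^T = invmx B /\ psd (invmx B) /\ invmx B *m invmx B = N.
  move=> uM <- [Bs [Bp BM]]; have [h1 h2] := psd_invmx (unitmx_root uM BM) Bs Bp.
  by split=> //; split=> //; exact: invmx_root.
case: xgetP => [B _ SB|S0].
- case: xgetP => [C _ [C1 [C2 C3]]|S'0].
    have [h1 [h2 h3]] := SS' _ _ _ uA erefl SB.
    rewrite (psd_root_unique uVA C1 C2 C3 h1 h2 h3) -h3.
    by rewrite mulmxA mulmxV ?mul1mx// (unitmx_root uA SB.2.2).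
  by exfalso; apply: (S'0 (invmx B)); exact: SS' uA erefl SB.
- rewrite mul0mx; case: xgetP => [C _ SC|//].
  by exfalso; apply: (S0 (invmx C)); apply: SS' uVA (invmxK A) SC.
Qed.

End Roots.

(** * The Newton step *)

Section Norms.
Context {R : realType} {d : nat}.
Implicit Types (A J : 'M[R]_d) (u v w : 'rV[R]_d).

Lemma norm_enorm v : `|v| <= enorm v.
Proof.
apply: norm_le_entries => [|z i]; first exact: sqrtr_ge0.
rewrite [z]ord1 -sqrtr_sqr ler_wsqrtr// (bigD1 i)//= lerDl.
by apply: sumr_ge0 => l _; exact: sqr_ge0.
Qed.

Lemma enorm_norm v : enorm v <= d%:R * `|v|.
Proof.
have dv : 0 <= d%:R * `|v| by rewrite mulr_ge0.
rewrite -[leRHS]ger0_norm// -sqrtr_sqr ler_wsqrtr//.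
apply: (@le_trans _ _ (\sum_(i < d) `|v| ^+ 2)).
  apply: ler_sum => i _; rewrite -[leLHS]real_normK ?num_real//.
  by rewrite lerXn2r ?nnegrE// norm_entry.
rewrite sumr_const card_ord -[leLHS]mulr_natl exprMn ler_wpM2r ?sqr_ge0//.
rewrite -natrX ler_nat; case: (d) => [//|n]; exact: leq_pmulr.
Qed.

Lemma norm_mulmx v A : `|v *m A| <= d%:R * (`|v| * `|A|).
Proof.
apply: norm_le_entries => [|z i]; first by rewrite !mulr_ge0.
rewrite mxE (le_trans (ler_norm_sum _ _ _))//.
apply: (@le_trans _ _ (\sum_(j < d) `|v| * `|A|)); last first.
  by rewrite sumr_const card_ord mulr_natl.
by apply: ler_sum => j _; rewrite normrM ler_pM// norm_entry.
Qed.

Section Nondegenerate.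
Variables (J : 'M[R]_d) (c : R).
Hypothesis c0 : 0 < c.
Hypothesis Jc : forall lam, enorm lam = 1 -> c <= (lam *m J *m lam^T) 0 0.

Lemma nondeg_quad v : c * `|v| ^+ 2 <= (v *m J *m v^T) 0 0.
Proof.
have [/eqP v0|vn] := boolP (enorm v == 0).
  have : `|v| <= 0 by rewrite -v0 norm_enorm.
  by rewrite normr_le0 => /eqP ->; rewrite normr0 expr0n mulr0 mul0mx mul0mx mxE.
have ep : 0 < enorm v by rewrite lt_neqAle eq_sym vn sqrtr_ge0.
have e1 : enorm ((enorm v)^-1 *: v) = 1.
  rewrite {1}/enorm (eq_bigr (fun i => (enorm v)^-1 ^+ 2 * v 0 i ^+ 2)); last first.
    by move=> i _; rewrite mxE exprMn.
  rewrite -mulr_sumr sqrtrM ?sqr_ge0// sqrtr_sqr ger0_norm ?invr_ge0 ?sqrtr_ge0//.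
  by rewrite -/(enorm v) mulVf.
have := Jc e1; rewrite linearZ /= -!scalemxAl -scalemxAr scalerA mxE -expr2 exprVn.
rewrite mulrC ler_pdivlMr ?exprn_gt0//; apply: le_trans.
by rewrite ler_pM2l// lerXn2r ?nnegrE ?sqrtr_ge0// norm_enorm.
Qed.

Lemma nondeg_norm v : c * `|v| <= d%:R * `|v *m J|.
Proof.
have [->|vn] := eqVneq v 0; first by rewrite mul0mx !normr0 !mulr0.
have vp : 0 < `|v| by rewrite normr_gt0.
rewrite -(ler_pM2r vp) -mulrA -expr2; apply: (le_trans (nondeg_quad v)).
rewrite mxE (le_trans (ler_norm _))// (le_trans (ler_norm_sum _ _ _))//.
apply: (@le_trans _ _ (\sum_(j < d) `|v *m J| * `|v|)); last first.
  by rewrite sumr_const card_ord -[leLHS]mulr_natl mulrA.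
by apply: ler_sum => j _; rewrite normrM [v^T _ _]mxE ler_pM// norm_entry.
Qed.

Lemma nondeg_unit : J \in unitmx.
Proof.
rewrite -row_free_unit -kermx_eq0; apply/eqP/row_matrixP => i; rewrite row0.
have : row i (kermx J) *m J = 0 by rewrite -row_mul mulmx_ker row0.
move=> h; have := nondeg_norm (row i (kermx J)); rewrite h normr0 mulr0.
by rewrite pmulr_rle0// normr_le0 => /eqP.
Qed.

Lemma nondeg_invmx v : `|v *m invmx J| <= d%:R / c * `|v|.
Proof.
have := nondeg_norm (v *m invmx J); rewrite mulmxKV ?nondeg_unit// => h.
by rewrite mulrAC ler_pdivlMr// mulrC.
Qed.

End Nondegenerate.

(** [D] and [D'] stand for the scores at t and t + u, [Q] for the centred second derivative, [q] for
    sqrt k. The Newton correction cancels q u J; what survives is a multiple of J' - J, the term in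
    [Q] or the Taylor remainder. *)
Lemma onestep_expansion (q K0 : R) (u D D' r : 'rV[R]_d) (Q J J' : 'M[R]_d) :
  0 < q -> J \in unitmx -> J' \in unitmx -> 0 <= K0 ->
  (forall v, `|v *m invmx J| <= K0 * `|v|) -> (forall v, `|v *m invmx J'| <= K0 * `|v|) ->
  D' = D + u *m Q - q *: (u *m J) + r ->
  `|q *: (u + q^-1 *: (D' *m invmx J')) - D *m invmx J| <=
  K0 * (q * (d%:R * (`|u| * `|J' - J|)) + d%:R * (`|u| * `|Q|) + `|r| +
        d%:R * (K0 * `|D| * `|J' - J|)).
Proof.
move=> q0 uJ uJ' K00 kJ kJ' ->.
have -> : q *: (u + q^-1 *: ((D + u *m Q - q *: (u *m J) + r) *m invmx J')) - D *m invmx J =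
   (q *: (u *m (J' - J)) + u *m Q + r - (D *m invmx J) *m (J' - J)) *m invmx J'.
  rewrite scalerDr scalerA divff ?gt_eqF// scale1r.
  apply: (can_inj (mulmxK uJ')) ; rewrite /= mulmxKV// mulmxBl mulmxDl mulmxKV//.
  rewrite !mulmxBr mulmxKV// -!scalemxAl scalerBr.
  by apply/rowP => i; rewrite !mxE; ring.
apply: (le_trans (kJ' _)); rewrite ler_wpM2l//.
rewrite (le_trans (ler_normB _ _))// lerD//; last first.
  apply: (le_trans (norm_mulmx _ _)); rewrite ler_wpM2l// ler_wpM2r//; exact: kJ.
rewrite (le_trans (ler_normD _ _))// lerD// (le_trans (ler_normD _ _))// lerD//.
  by rewrite normrZ (gtr0_norm q0) ler_pM2l// norm_mulmx.
exact: norm_mulmx.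
Qed.

End Norms.

Section Asymptotics.
Context {R : realType}.

Lemma near_powR (a M : R) : 0 < a -> \forall n \near \oo, M <= n%:R `^ a.
Proof.
move=> a0; near=> n.
apply: (le_trans (ler_norm M)).
have -> : `|M| = (`|M| `^ a^-1) `^ a by rewrite -powRrM mulVf ?gt_eqF// powRr1.
apply: ge0_ler_powR; rewrite ?nnegrE ?powR_ge0//; first exact: ltW.
near: n; exact: nbhs_infty_ger.
Unshelve. all: by end_near. Qed.

Lemma near_kidx (s : R) (m : nat) : 0 < s -> \forall n \near \oo, (m <= kidx s n)%N.
Proof.
move=> s0; near=> n.
have sn : m%:R <= s * n%:R.
  rewrite mulrC -ler_pdivrMr//; near: n; exact: nbhs_infty_ger.
by rewrite /kidx truncn_ge_nat// (le_trans _ sn).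
Unshelve. all: by end_near. Qed.

Lemma kidx_le (s : R) n : 0 < s <= 1 -> (kidx s n <= n)%N.
Proof.
move=> /andP[s0 s1]; rewrite -(ler_nat R) /kidx.
have h : 0 <= s * n%:R by rewrite mulr_ge0// ltW.
by apply: le_trans (_ : s * n%:R <= _); rewrite ?truncn_le// ler_piMl.
Qed.

Lemma Nsize_ge (dl : R) n : 0 < dl -> (0 < n)%N -> (n%:R : R) `^ dl <= 2 * (Nsize dl n)%:R.
Proof.
move=> dl0 n0; rewrite /Nsize; set x := _ `^ _.
have x1 : 1 <= x.
  by rewrite -(powRr0 n%:R) ler_powR ?ler1n// ltW.
have t1 : 1 <= (Num.truncn x)%:R :> R by rewrite ler1n truncn_gt0.
have := truncnS_gt x; rewrite -natr1; lra.
Qed.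

Lemma near_Nsize (dl M : R) : 0 < dl -> \forall n \near \oo, M <= (Nsize dl n)%:R.
Proof.
move=> dl0; near=> n.
have h : 2 * M <= (n%:R : R) `^ dl by near: n; exact: near_powR.
have := @Nsize_ge dl n dl0; have -> : (0 < n)%N by near: n; exact: nbhs_infty_gt.
move=> /(_ isT); lra.
Unshelve. all: by end_near. Qed.

(** The place where an exponent above 1/4 acts: sqrt k is at most n^(1/2), negligible against N^2 of
    order n^(2 dl). It controls the error sqrt k / N^2 left by the second Newton step. *)
Lemma near_sqrt_kidx (s dl e : R) : 0 < s <= 1 -> 1 / 4 < dl -> 0 < e ->
  \forall n \near \oo, Num.sqrt (kidx s n)%:R <= e * (Nsize dl n)%:R ^+ 2.
Proof.
move=> s01 dl4 e0; have a0 : 0 < 2 * dl - 2^-1 by lra.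
near=> n.
have n0 : (0 < n)%N by near: n; exact: nbhs_infty_gt.
have dl0 : 0 < dl by lra.
apply: (@le_trans _ _ ((n%:R : R) `^ 2^-1)).
  by rewrite powR12_sqrt// ler_wsqrtr// ler_nat kidx_le.
have h : 4 / e <= (n%:R : R) `^ (2 * dl - 2^-1) by near: n; exact: near_powR.
have := Nsize_ge dl0 n0; have := powR_ge0 (n%:R : R) dl.
have E : (n%:R : R) `^ 2^-1 * n%:R `^ (2 * dl - 2^-1) = (n%:R `^ dl) ^+ 2.
  rewrite -powRD; last by rewrite pnatr_eq0 -lt0n n0 implybT.
  by rewrite -powR_mulrn ?powR_ge0// -powRrM; congr (_ `^ _); ring.
move: E; set x := _ `^ 2^-1; set y := _ `^ (_ - _); set z := _ `^ dl; set N := (Nsize _ _)%:R.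
move=> E z0 zN.
have x0 : 0 <= x by exact: powR_ge0.
have ey : 4 <= e * y by rewrite mulrC -ler_pdivrMr.
have zN2 : z ^+ 2 <= 4 * N ^+ 2.
  have -> : 4 * N ^+ 2 = (2 * N) ^+ 2 by ring.
  by rewrite lerXn2r ?nnegrE// (le_trans z0).
have : 4 * x <= e * (4 * N ^+ 2).
  apply: (@le_trans _ _ (e * (x * y))); last by rewrite E ler_pM2l.
  have -> : e * (x * y) = (e * y) * x by ring.
  by rewrite ler_wpM2r.
by rewrite (_ : e * (4 * _) = 4 * (e * N ^+ 2)) ?ler_pM2l//; ring.
Unshelve. all: by end_near. Qed.

Lemma near_sqrt (M : R) : \forall k \near \oo, M <= Num.sqrt k%:R.
Proof.
near=> k; apply: (le_trans (ler_norm M)); rewrite -sqrtr_sqr ler_wsqrtr//.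
near: k; exact: nbhs_infty_ger.
Unshelve. all: by end_near. Qed.

End Asymptotics.

(* The first Newton step turns an error of order [a] = N^(-1/2) into one of order q^(-1) + a^2,
   where q = sqrt k; the second one is then exact up to the order q^(-1) + q a^4. *)
Lemma two_newton_steps {R : realType} (K C e : R) : 0 <= K -> 0 <= C -> 0 < e ->
  exists2 h : R, 0 < h & forall a q u0 u1 m0 m1 : R, 0 < a <= h -> 0 < q -> q^-1 <= h ->
    q * a ^+ 4 <= h -> 0 <= u0 <= C * a -> 0 <= u1 ->
    m0 <= K * (u0 + q * u0 ^+ 2) -> q * u1 <= C + m0 ->
    m1 <= K * (u1 + q * u1 ^+ 2) -> u1 <= e /\ m1 <= e.
Proof.
move=> K0 C0 e0.
(* The constants of the intermediate bound u1 <= c1 q^(-1) + c2 a^2; [D] collects those of the two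
   final bounds, both at most D h. *)
pose c1 := C + K * C; pose c2 := K * C ^+ 2.
pose D := 1 + (c1 + c2) + K * ((c1 + c2) + 2 * c1 ^+ 2 + 2 * c2 ^+ 2).
have c10 : 0 <= c1 by rewrite addr_ge0// mulr_ge0.
have c20 : 0 <= c2 by apply: mulr_ge0 => //; exact: sqr_ge0.
have s10 : 0 <= c1 ^+ 2 by exact: sqr_ge0.
have s20 : 0 <= c2 ^+ 2 by exact: sqr_ge0.
have D1 : 1 <= D.
  rewrite /D -addrA lerDl addr_ge0 ?addr_ge0// mulr_ge0// !addr_ge0// mulr_ge0//.
have D0 : 0 < D by lra.
pose h := Num.min 1 (e / D).
have h0 : 0 < h by rewrite lt_min ltr01 divr_gt0.
have h1 : h <= 1 by rewrite ge_min lexx.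
have he : D * h <= e by rewrite mulrC -ler_pdivlMr// ge_min lexx orbT.
exists h => // a q u0 u1 m0 m1 /andP[a0 ah] q0 qh qa /andP[u00 u0C] u10 m0K u1q m1K.
have p0 : 0 < q^-1 by rewrite invr_gt0.
have pq : q^-1 * q = 1 by rewrite mulVf// gt_eqF.
move: p0 pq qh; set p := q^-1 => p0 pq ph.
have a1 : a <= 1 by lra.
have aa : a ^+ 2 <= h by rewrite expr2; nra.
have u02 : u0 ^+ 2 <= C ^+ 2 * a ^+ 2.
  by rewrite -exprMn lerXn2r ?nnegrE// mulr_ge0// ltW.
have m0b : m0 <= K * C + c2 * (q * a ^+ 2).
  apply: (le_trans m0K); rewrite mulrDr lerD//.
    by rewrite ler_wpM2l// (le_trans u0C)// ler_piMr.
  rewrite /c2 -mulrA ler_wpM2l// (mulrCA (C ^+ 2)) ler_pM2l//.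
have u1b : u1 <= c1 * p + c2 * a ^+ 2.
  have -> : u1 = p * (q * u1) by rewrite mulrA pq mul1r.
  have -> : c1 * p + c2 * a ^+ 2 = p * (c1 + c2 * (q * a ^+ 2)).
    by rewrite -[c2 * a ^+ 2]mulr1 -pq; ring.
  by rewrite ler_pM2l// (le_trans u1q)// /c1 -addrA lerD2l.
have u1h : u1 <= (c1 + c2) * h.
  by apply: (le_trans u1b); rewrite [leRHS]mulrDl lerD// ler_wpM2l.
have qu1 : q * u1 ^+ 2 <= (2 * c1 ^+ 2 + 2 * c2 ^+ 2) * h.
  have sq : u1 ^+ 2 <= 2 * (c1 * p) ^+ 2 + 2 * (c2 * a ^+ 2) ^+ 2.
    apply: (@le_trans _ _ ((c1 * p + c2 * a ^+ 2) ^+ 2)).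
      by rewrite lerXn2r ?nnegrE// (le_trans u10).
    have := sqr_ge0 (c1 * p - c2 * a ^+ 2); set x := c1 * p; set y := c2 * _; nra.
  apply: (@le_trans _ _ (q * (2 * (c1 * p) ^+ 2 + 2 * (c2 * a ^+ 2) ^+ 2))).
    by rewrite ler_pM2l.
  have -> : q * (2 * (c1 * p) ^+ 2 + 2 * (c2 * a ^+ 2) ^+ 2) =
     2 * c1 ^+ 2 * (p * (p * q)) + 2 * c2 ^+ 2 * (q * a ^+ 4) by ring.
  by rewrite pq mulr1 [leRHS]mulrDl lerD// ler_wpM2l// mulr_ge0.
split.
  apply: (le_trans u1h); apply: le_trans he; rewrite ler_wpM2r ?(ltW h0)// /D.
  have : 0 <= K * ((c1 + c2) + 2 * c1 ^+ 2 + 2 * c2 ^+ 2).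
    by rewrite mulr_ge0// !addr_ge0// mulr_ge0.
  lra.
apply: (le_trans m1K).
apply: (@le_trans _ _ (K * ((c1 + c2) + 2 * c1 ^+ 2 + 2 * c2 ^+ 2) * h)).
  by rewrite -mulrA ler_wpM2l// -addrA [leRHS]mulrDl lerD// addrC.
apply: le_trans he; rewrite ler_wpM2r ?(ltW h0)// /D; lra.
Qed.

(** * The autoregressive model *)

Lemma closed_cube_compact {R : realType} {d : nat} (t0 : 'rV[R]_d) (r : R) :
  compact [set t | `|t - t0| <= r].
Proof.
apply: bounded_closed_compact.
  exists (`|t0| + r); split; first exact: num_real.
  move=> M rM t /= tr; rewrite -(subrK t0 t) (le_trans (ler_normD _ _))//; lra.
rewrite (_ : [set t | _] = closed_ball_ (fun x : 'rV[R]_d => `|x|) t0 r).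
  exact: closed_closed_ball_.
by apply/seteqP; split => t /=; rewrite distrC.
Qed.

Lemma open_cube {R : realType} {d : nat} (U : set 'rV[R]_d) t0 : open U -> U t0 ->
  exists2 r : R, 0 < r & [set t | `|t - t0| <= r] `<=` U.
Proof.
move=> oU Ut; have /nbhs_ballP[r /= r0 rU] := open_nbhs_nbhs (conj oU Ut).
exists (r / 2); first by rewrite divr_gt0.
move=> t /= tr; apply: rU; rewrite -ball_normE /= distrC (le_lt_trans tr)//; lra.
Qed.

Lemma quarter_bound {R : realType} (x e y : R) : 0 <= x -> 0 < e ->
  y <= e / (4 * (x + 1)) -> x * y <= e / 4.
Proof.
move=> x0 e0 h; apply: (@le_trans _ _ ((x + 1) * (e / (4 * (x + 1))))).
  by apply: (le_trans (ler_wpM2l x0 h)); rewrite ler_wpM2r ?lerDl// ltW// divr_gt0//; lra.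
have x1 : x + 1 != 0 by rewrite gt_eqF//; lra.
by rewrite (_ : _ * _ = e / 4)//; field.
Qed.

Section Model.
Context {R : realType} {d : nat} {dO : measure_display} {Omega : measurableType dO}.
Variables (Theta : set 'rV[R]_d) (S : 'rV[R]_d -> R -> R) (g : R -> R)
  (P : 'rV[R]_d -> probability Omega R) (X : nat -> Omega -> R).
Hypothesis oT : open Theta.
Hypothesis mX : forall j, measurable_fun setT (X j).
Hypothesis mS : forall t, Theta t -> measurable_fun setT (S t).
Hypothesis ind : forall t, Theta t ->
  mutually_independent (P t) (fun j => if j is 0 then X 0%N else eps S X t j).
Hypothesis dens : forall t j, Theta t -> (0 < j)%N -> has_density (P t) (eps S X t j) g.
Hypothesis stat : forall t, Theta t -> strictly_stationary (P t) X.
Hypothesis hS : forall x, Ck_on 3 Theta (fun t => S t x).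
Hypotheses (gpos : forall x, 0 < g x) (hg : Ck_R 3 g).
Variables (R1 R2 R3 : R -> R -> R) (C : R).
Hypothesis hR : forall t x x', Theta t ->
  [/\ `|dl1 S g t x x'| <= R1 x x', `|dl2 S g t x x'| <= R2 x x' &
      forall i j k, `|dl3 S g t x x' i j k| <= R3 x x'].
Hypothesis mR : forall j, (0 < j)%N ->
  [/\ measurable_fun setT (fun w => R1 (X j.-1 w) (X j w)),
      measurable_fun setT (fun w => R2 (X j.-1 w) (X j w)) &
      measurable_fun setT (fun w => R3 (X j.-1 w) (X j w))].
Hypothesis ER : forall t j, Theta t -> (0 < j)%N ->
  [/\ (expectation (P t) (fun w => `|R1 (X j.-1 w) (X j w)| ^+ 2)%R < C%:E)%E,
      (expectation (P t) (fun w => `|R2 (X j.-1 w) (X j w)| ^+ 2)%R < C%:E)%E &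
      (expectation (P t) (fun w => `|R3 (X j.-1 w) (X j w)| ^+ 2)%R < C%:E)%E].
Variable c : R.
Hypothesis c0 : 0 < c.
Hypothesis nondeg : forall t (lam : 'rV[R]_d), Theta t -> enorm lam = 1 ->
  c <= (lam *m fisher P X S g t *m lam^T) 0 0.
Variable i0 : 'I_d.

Local Notation I := (fisher P X S g).

Definition xit (t : 'rV[R]_d) (i : 'I_d) (j : nat) (w : Omega) : R :=
  dl1 S g t (X j w) (X j.+1 w) 0 i.
Definition qdt (t : 'rV[R]_d) (i k : 'I_d) (j : nat) (w : Omega) : R :=
  dl2 S g t (X j w) (X j.+1 w) i k.

Lemma dominated_L2 (p : probability Omega R) (f h : Omega -> R) :
  measurable_fun setT f -> measurable_fun setT h -> (forall w, `|f w| <= h w) ->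
  (expectation p (fun w => `|h w| ^+ 2)%R < C%:E)%E ->
  L2 p f /\ Ex p (fun w => f w ^+ 2) <= C.
Proof.
move=> mf mh fh Eh.
have le w : f w ^+ 2 <= `|h w| ^+ 2.
  rewrite -[leLHS]real_normK ?num_real// lerXn2r ?nnegrE//.
  exact: le_trans (fh w) (ler_norm _).
have Lh : L1 p (fun w => `|h w| ^+ 2).
  apply: ge0_L1 => [|w|]; first by apply: measurable_funX; exact: measurableT_comp.
    exact: sqr_ge0.
  by rewrite unlock in Eh; exact: lt_le_trans Eh (leey _).
have Lf : L1 p (fun w => f w ^+ 2).
  apply: (L1_le _ Lh) => [|w]; first exact: measurable_funX.
  by rewrite ger0_norm ?sqr_ge0.
split; first by split.
apply: (le_trans (Ex_le Lf Lh le)); rewrite ltW// -lte_fin -expectation_fin//.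
Qed.

Lemma C_gt0 t : Theta t -> 0 < C.
Proof.
move=> Tt; have [+ _ _] := ER Tt (ltn0Sn 0); rewrite -lte_fin; apply: le_lt_trans.
by apply: expectation_ge0 => w; exact: sqr_ge0.
Qed.

Section Fixed.
Variable t : 'rV[R]_d.
Hypothesis Tt : Theta t.

Lemma xit_L2 i j : L2 (P t) (xit t i j) /\ Ex (P t) (fun w => xit t i j w ^+ 2) <= C.
Proof.
have [m1 _ _] := mR (ltn0Sn j); have [e1 _ _] := ER Tt (ltn0Sn j).
apply: (dominated_L2 _ m1) e1 => [|w].
  by apply: (measurable_dl1 oT hS gpos hg mS).
have [h _ _] := hR (X j w) (X j.+1 w) Tt.
exact: le_trans (norm_entry _ _ _) h.
Qed.

Lemma qdt_L2 i k j : L2 (P t) (qdt t i k j) /\ Ex (P t) (fun w => qdt t i k j w ^+ 2) <= C.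
Proof.
have [_ m1 _] := mR (ltn0Sn j); have [_ e1 _] := ER Tt (ltn0Sn j).
apply: (dominated_L2 _ m1) e1 => [|w].
  by apply: (measurable_dl2 oT hS gpos hg mS).
have [_ h _] := hR (X j w) (X j.+1 w) Tt.
exact: le_trans (norm_entry _ _ _) h.
Qed.

Lemma fisher_entry i k : I t i k = Ex (P t) (fun w => xit t i 0 w * xit t k 0 w).
Proof. by rewrite mxE. Qed.

Lemma fisher_sym : (I t)^T = I t.
Proof.
by apply/matrixP => i k; rewrite mxE !fisher_entry; apply: eq_Ex => w; rewrite mulrC.
Qed.

Lemma fisher_norm i k : `|I t i k| <= C.
Proof.
have [li ei] := xit_L2 i 0; have [lk ek] := xit_L2 k 0.
rewrite fisher_entry (le_trans (Ex_norm (L2M li lk)))//.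
apply: (@le_trans _ _ (Ex (P t) (fun w => 2^-1 * (xit t i 0 w ^+ 2 + xit t k 0 w ^+ 2)))).
  apply: Ex_le; [exact: L1abs (L2M li lk)|exact: L1Z (L1D li.2 lk.2)|move=> w].
  rewrite normrM; have := sqr_ge0 (`|xit t i 0 w| - `|xit t k 0 w|).
  rewrite -(real_normK (num_real (xit t i 0 w))) -(real_normK (num_real (xit t k 0 w))).
  set x := `|xit t i 0 w|; set y := `|_|; nra.
rewrite (ExZ _ (L1D li.2 lk.2)) (ExD li.2 lk.2); lra.
Qed.

Lemma fisher_unit : I t \in unitmx.
Proof. exact: nondeg_unit c0 (fun lam => nondeg Tt (lam := lam)). Qed.

Lemma fisher_invmx (v : 'rV[R]_d) : `|v *m invmx (I t)| <= d%:R / c * `|v|.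
Proof. exact: nondeg_invmx c0 (fun lam => nondeg Tt (lam := lam)) v. Qed.

Lemma xit_nondeg : 0 < Ex (P t) (fun w => xit t i0 0 w ^+ 2).
Proof.
have e1 : enorm (uvec i0 : 'rV[R]_d) = 1.
  rewrite /enorm (bigD1 i0)//= big1 ?addr0; first by rewrite mxE !eqxx expr1n sqrtr1.
  by move=> i /negPf ii; rewrite mxE ii andbF expr0n.
have := lt_le_trans c0 (nondeg Tt e1).
rewrite /uvec trmx_delta -rowE -colE !mxE.
by congr (0 < _); apply: eq_Ex => w; rewrite expr2.
Qed.

Lemma qdt_centered_L2 i k j : L2 (P t) (fun w => qdt t i k j w + I t i k) /\
  Ex (P t) (fun w => (qdt t i k j w + I t i k) ^+ 2) <= (1 + 2 * C + 2 * C ^+ 2) ^+ 2.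
Proof.
have [lq eq] := qdt_L2 i k j; have C0 := C_gt0 Tt.
have l2 : L2 (P t) (fun w => qdt t i k j w + I t i k) by apply: L2D => //; exact: L2c.
split=> //; have C20 := sqr_ge0 C.
(* The second moment is at most 2C + 2C^2. Adding 1 gives a number below its own square, the form in
   which the Lindeberg lemmas take moment bounds. *)
apply: (@le_trans _ _ (1 + 2 * C + 2 * C ^+ 2)); last by rewrite [leRHS]expr2 ler_peMl//; lra.
apply: (@le_trans _ _ (Ex (P t) (fun w => 2 * qdt t i k j w ^+ 2 + 2 * C ^+ 2))).
  apply: Ex_le; [exact: l2.2|apply: L1D; [exact: L1Z lq.2|exact: L1c]|move=> w].
  have : I t i k ^+ 2 <= C ^+ 2.
    by rewrite -[leLHS]real_normK ?num_real// lerXn2r ?nnegrE ?(ltW C0)// fisher_norm.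
  have := sqr_ge0 (qdt t i k j w - I t i k); set x := qdt _ _ _ _ _; set y := I t i k; nra.
by rewrite ExD ?Exc ?ExZ//; [lra|exact: lq.2|exact: L1Z lq.2|exact: L1c].
Qed.

Let a := dS S t.
Let b := ddS S t.

Lemma xiE : xi X (S t) g a = xit t.
Proof.
apply/funext => i; apply/funext => j; apply/funext => w.
by rewrite /xit (dl1E hS gpos hg).
Qed.

Lemma qdE : qd X (S t) g a b = qdt t.
Proof.
apply/funext => i; apply/funext => k; apply/funext => j; apply/funext => w.
by rewrite /qdt (dl2E oT hS gpos hg).
Qed.

Let ma i : measurable_fun setT (a i).
Proof. exact: (measurable_dS oT hS mS). Qed.
Let mb i k : measurable_fun setT (b i k).
Proof. exact: (measurable_ddS oT hS mS). Qed.

Let innovE : innov X (S t) = (fun j => if j is 0 then X 0%N else eps S X t j).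
Proof. by apply/funext => -[|j]. Qed.

Let ind' : mutually_independent (P t) (innov X (S t)).
Proof. by rewrite innovE; exact: ind. Qed.
Let dens' j : has_density (P t) (innov X (S t) j.+1) g.
Proof. by rewrite innovE; exact: dens. Qed.
Let xi2' i j : L2 (P t) (xi X (S t) g a i j) /\ Ex (P t) (fun w => xi X (S t) g a i j w ^+ 2) <= C.
Proof. by rewrite xiE; exact: xit_L2. Qed.
Let qd2' i k j : L2 (P t) (qd X (S t) g a b i k j) /\
  Ex (P t) (fun w => qd X (S t) g a b i k j w ^+ 2) <= C.
Proof. by rewrite qdE; exact: qdt_L2. Qed.
Let nd' : 0 < Ex (P t) (fun w => xi X (S t) g a i0 0 w ^+ 2).
Proof. by rewrite xiE; exact: xit_nondeg. Qed.

Let pp h r j : coord_measurable h ->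
  measurable_fun setT ((fun w => h (psum (xit t) r j w)) : past (innov X (S t)) j.+1 -> R).
Proof. by move=> mh; rewrite -xiE; exact: (past_psum (mS Tt) gpos hg ma r (j := j) mh). Qed.

Let mp h r j : coord_measurable h -> measurable_fun setT (fun w => h (psum (xit t) r j w)).
Proof. by move=> mh; apply: coord_measurable_psum => // i l; exact: (xit_L2 i l).1. Qed.

Lemma xit_mart h r j i (M : R) : coord_measurable h -> (forall x, `|h x| <= M) ->
  Ex (P t) (fun w => h (psum (xit t) r j w) * xit t i j w) = 0.
Proof.
move=> mh hM.
have := xi_Ex0 mX (mS Tt) ind' dens' gpos hg ma xi2' nd' i (@pp h r j mh).
rewrite xiE; apply; split; first exact: mp.
apply: (@L1_bounded _ _ _ _ _ (M ^+ 2)) => [|w]; first exact: measurable_funX (@mp h r j mh).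
by rewrite normrX lerXn2r ?nnegrE// (le_trans _ (hM 0)).
Qed.

Lemma xit_qdt h r j i k (M : R) : coord_measurable h -> (forall x, `|h x| <= M) ->
  Ex (P t) (fun w => h (psum (xit t) r j w) * (xit t i j w * xit t k j w)) =
  - Ex (P t) (fun w => h (psum (xit t) r j w) * qdt t i k j w).
Proof.
move=> mh hM.
have := xi_qd_Ex0 mX (mS Tt) ind' dens' gpos hg ma mb xi2' qd2' nd' i k (@pp h r j mh) (M := M).
by rewrite xiE qdE; apply => w; exact: hM.
Qed.

Lemma xit_sum_Ex2 i k : L2 (P t) (fun w => \sum_(l < k) xit t i l w) /\
  Ex (P t) (fun w => (\sum_(l < k) xit t i l w) ^+ 2) <= k%:R * C.
Proof. by have := xi_sum_Ex2 mX (mS Tt) ind' dens' gpos hg ma xi2' nd' i k; rewrite xiE. Qed.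

Lemma noise_gt0 : 0 < noise_info g.
Proof. exact: (noise_info_gt0 mX (mS Tt) ind' dens' gpos hg ma xi2' nd'). Qed.

Lemma tail_cvg (e : R) : 0 < e -> exists2 A : R, 0 <= A & noise_tail g A <= e.
Proof. exact: (noise_tail_cvg mX (mS Tt) ind' dens' gpos hg ma xi2' nd'). Qed.

Lemma xit_min (A r : R) j : 0 <= A -> 0 <= r ->
  Ex (P t) (fun w => Num.min (`|xv (xit t) j w| ^+ 2) (r * `|xv (xit t) j w| ^+ 3)) <=
  d%:R * (C / noise_info g * noise_tail g A) +
  r * (A ^+ 3 * (1 + d%:R * (C / noise_info g ^+ 2))).
Proof.
by have := @xi_min _ _ _ _ _ _ _ _ _ _ _ mX (mS Tt) ind' dens' gpos hg ma mb xi2' qd2' _ nd' A r j;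
  rewrite xiE.
Qed.

Lemma pair_block_shift (F : R -> R -> R) m j :
  (forall l, measurable_fun setT
    (fun v : g_sigma_algebraType (@cyl R) => F (v l) (v l.+1))) ->
  Ex (P t) (fun w => `|\sum_(l < m) F (X (j + l)%N w) (X (j + l).+1 w)|) =
  Ex (P t) (fun w => `|\sum_(l < m) F (X l w) (X l.+1 w)|).
Proof.
move=> mF; pose f (v : nat -> R) := `|\sum_(l < m) F (v l) (v l.+1)|.
have mf : measurable_fun setT (f : g_sigma_algebraType (@cyl R) -> R).
  by apply: measurableT_comp => //; apply: measurable_sum => l; exact: mF.
have -> : (fun w => `|\sum_(l < m) F (X (j + l)%N w) (X (j + l).+1 w)|) =
  (fun w => f (fun n => X (j + n)%N w)).
  by apply/funext => w; rewrite /f; congr Num.norm; apply: eq_bigr => l _; rewrite addnS.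
by rewrite (stationary_Ex mX (stat Tt) j mf) => [|v]; last exact: normr_ge0.
Qed.

Lemma qdt_block_shift i k m j :
  Ex (P t) (fun w => `|\sum_(l < m) (qdt t i k (j + l)%N w + I t i k)|) =
  Ex (P t) (fun w => `|\sum_(l < m) (qdt t i k l w + I t i k)|).
Proof.
apply: (pair_block_shift (F := fun x y => dl2 S g t x y i k + I t i k)) => l.
apply: measurable_funD => //.
by apply: (measurable_dl2 oT hS gpos hg mS _ _ _ _ Tt); exact: cyl_coord.
Qed.

End Fixed.
Lemma sum_pairs {V : nmodType} (F : R -> R -> V) n w :
  \sum_(1 <= j < n.+1) F (X j.-1 w) (X j w) = \sum_(l < n) F (X l w) (X l.+1 w).
Proof. by rewrite big_add1 big_mkord. Qed.

Lemma Delta_psum k t w : DeltaK S g X k t w = psum (xit t) (Num.sqrt k%:R)^-1 k w.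
Proof.
rewrite /DeltaK (sum_pairs (fun x y => dl1 S g t x y)) /psum; congr (_ *: _).
by apply: eq_bigr => l _; apply/rowP => i; rewrite [RHS]mxE.
Qed.

Definition info_fluct (n : nat) (t : 'rV[R]_d) (w : Omega) : 'M[R]_d :=
  (Num.sqrt n%:R)^-1 *: \sum_(1 <= j < n.+1) (dl2 S g t (X j.-1 w) (X j w) + I t).

Hypothesis tight2 : tight_unif_compacts Theta P info_fluct.

Lemma info_fluctE n t w i k : info_fluct n t w i k =
  (Num.sqrt n%:R)^-1 * \sum_(l < n) (qdt t i k l w + I t i k).
Proof.
rewrite /info_fluct (sum_pairs (fun x y => dl2 S g t x y + I t)) mxE summxE.
by congr (_ * _); apply: eq_bigr => l _; rewrite [LHS]mxE.
Qed.

Lemma measurable_info_fluct n t : Theta t -> measurable_fun setT (fun w => `|info_fluct n t w|).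
Proof.
move=> Tt; apply: measurable_mxnorm => i k.
rewrite (_ : (fun w => _) = fun w => (Num.sqrt n%:R)^-1 * \sum_(l < n) (qdt t i k l w + I t i k)).
  apply: measurable_funM => //; apply: measurable_sum => l.
  by apply: measurable_funD => //; have [[]] := qdt_L2 Tt i k l.
by apply/funext => w; rewrite info_fluctE.
Qed.

(** By tightness a sum of m centred second derivatives is at most sqrt m M off an event of
    probability at most e^2, with M free of m and t; on the event Cauchy-Schwarz gives m c2 e = m
    eta / 2. A large m makes sqrt m M at most m eta / 2, and stationarity moves the block to any
    j. *)
Lemma block_uniform (K : set 'rV[R]_d) (eta : R) : compact K -> K `<=` Theta -> 0 < eta ->
  exists2 m : nat, (0 < m)%N & forall t j i k, K t ->
    Ex (P t) (fun w => `|\sum_(l < m) (qdt t i k (j + l)%N w + I t i k)|) <= m%:R * eta.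
Proof.
move=> cK KT eta0.
have [->|/set0P[t1 Kt1]] := eqVneq K set0; first by exists 1%N.
have C0 := C_gt0 (KT _ Kt1).
pose c2 := 1 + 2 * C + 2 * C ^+ 2.
have c20 : 0 < c2 by have := sqr_ge0 C; rewrite /c2; lra.
pose e := eta / (2 * c2).
have e0 : 0 < e by rewrite divr_gt0// mulr_gt0.
have [M [M0 tM]] := tight2 cK KT (exprn_gt0 2 e0).
have [m [m0 Mm]] : exists m : nat, (0 < m)%N /\ 2 * M / eta <= Num.sqrt m%:R.
  have [N _ hN] := near_sqrt (2 * M / eta).
  by exists N.+1; split => //; apply: hN => /=.
exists m => // t j i k Kt; have Tt := KT _ Kt.
rewrite qdt_block_shift//.
pose f l w := qdt t i k l w + I t i k.
pose A := [set w | M < `|info_fluct m t w|].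
have mA : measurable A.
  rewrite -[A]setTI; apply: measurable_fun_ltr => //; exact: measurable_info_fluct.
have sm : 0 < Num.sqrt m%:R :> R by rewrite sqrtr_gt0 ltr0n.
have bd w : `|\sum_(l < m) f l w| <=
    Num.sqrt m%:R * M + \sum_(l < m) `|f l w| * `|\1_A w|.
  have [Aw|nAw] := pselect (A w).
    rewrite indicE mem_set// normr1 -mulr_suml mulr1.
    by rewrite (le_trans (ler_norm_sum _ _ _))// lerDr mulr_ge0// ltW.
  rewrite indicE memNset// normr0 -mulr_suml mulr0 addr0.
  have : `|info_fluct m t w i k| <= M.
    by apply: (le_trans (norm_entry _ _ _)); rewrite leNgt; apply/negP.
  by rewrite info_fluctE normrM [`|_^-1|]ger0_norm ?invr_ge0 ?sqrtr_ge0// ler_pdivrMl.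
have Lf l : L2 (P t) (f l) by have [] := qdt_centered_L2 Tt i k l.
have LA : L2 (P t) \1_A.
  split; first exact: measurable_indic.
  apply: (@eq_L1 _ _ _ _ \1_A) (L1_indic _ mA) => w.
  by rewrite indicE; case: (_ \in _); rewrite ?expr1n ?expr0n.
have LfA l : L1 (P t) (fun w => `|f l w| * `|\1_A w|) by apply: L2M; exact: L2abs.
apply: (@le_trans _ _ (Ex (P t) (fun w => Num.sqrt m%:R * M + \sum_(l < m) `|f l w| * `|\1_A w|))).
  apply: Ex_le => //; last by apply: L1D; [exact: L1c|by apply: L1_sum => l _; exact: LfA].
  by apply: L1abs; apply: L1_sum => l _; exact: L2_L1 (Lf l).
rewrite ExD; [|exact: L1c|by apply: L1_sum => l _; exact: LfA]; rewrite Exc Ex_sum//.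
apply: (@le_trans _ _ (Num.sqrt m%:R * M + \sum_(l < m) c2 * e)).
  rewrite lerD2l; apply: ler_sum => l _; apply: Ex_CS_norm => //; try exact: ltW.
    by have [] := qdt_centered_L2 Tt i k l.
  rewrite (@eq_Ex _ _ _ _ _ \1_A); last first.
    by move=> w; rewrite indicE; case: (_ \in _); rewrite ?expr1n ?expr0n.
  by rewrite -lee_fin Ex_indic//; exact: tM.
rewrite sumr_const card_ord -[c2 * e *+ m]mulr_natl.
have -> : c2 * e = eta / 2 by rewrite /e; field; rewrite gt_eqF.
have -> : m%:R * eta = m%:R * (eta / 2) + m%:R * (eta / 2) by field.
rewrite lerD2r -[in leRHS](sqr_sqrtr (ler0n R m)) expr2 -mulrA ler_pM2l//.
by move: Mm; rewrite ler_pdivrMr//; lra.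
Qed.

Hypothesis lln : forall t, Theta t ->
  cvg_in_prob (P t)
    (fun n w => (n%:R)^-1 *: \sum_(1 <= j < n.+1)
       ((dl1 S g t (X j.-1 w) (X j w))^T *m dl1 S g t (X j.-1 w) (X j w))) (I t).
Variable L : R.
Hypothesis L0 : 0 <= L.
Hypothesis lipI : forall t1 t2, Theta t1 -> Theta t2 -> `|I t1 - I t2| <= L * `|t1 - t2|.

(** For large n the bad event has probability below 1, so some trajectory avoids it; its score
    values, equally weighted, are the steps of the walk. *)
Lemma covariance_sample t (e : R) : Theta t -> 0 < e ->
  exists (N : nat) (bs : 'I_N -> 'rV[R]_d), (0 < N)%N /\
    forall i k, `|I t i k - walk_cov bs i k| <= e.
Proof.
move=> Tt e0.
have /fine_cvgP[fin cv] := lln Tt e0.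
have : \forall n \near \oo, (0 < n)%N /\
   exists w, `|(n%:R)^-1 *: \sum_(1 <= j < n.+1)
       ((dl1 S g t (X j.-1 w) (X j w))^T *m dl1 S g t (X j.-1 w) (X j w)) - I t| <= e.
  near=> n; split; first by near: n; exact: nbhs_infty_gt.
  apply/not_existsP => h.
  have : `|fine (P t [set w | e < `|(n%:R)^-1 *: \sum_(1 <= j < n.+1)
       ((dl1 S g t (X j.-1 w) (X j w))^T *m dl1 S g t (X j.-1 w) (X j w)) - I t|])| < 1.
    rewrite -normrN -[- _]add0r; near: n; move/cvgrPdist_lt : cv; exact.
  rewrite (_ : [set w | _] = setT) ?probability_setT/= ?normr1 ?ltxx//.
  by apply/seteqP; split=> // w _ /=; have /negP := h w; rewrite -ltNge.
case=> N _ /(_ N (leqnn N))[N0 [w hw]].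
exists N, (fun l => xv (xit t) l w); split=> // i k.
apply: le_trans hw; rewrite distrC.
set M := _ *: _; have -> : walk_cov (fun l : 'I_N => xv (xit t) l w) i k = M i k.
  rewrite /M (sum_pairs (fun x y => (dl1 S g t x y)^T *m dl1 S g t x y)) mxE summxE.
  rewrite /walk_cov /avg; congr (_ * _); apply: eq_bigr => l _.
  by rewrite /xv [in RHS]mxE big_ord1 [X in _ = X * _]mxE [X in X * _ = _]mxE [X in _ * X = _]mxE.
have := norm_entry (M - I t) i k; by rewrite !mxE.
Unshelve. all: by end_near. Qed.

(** The walk is fixed at [t0], and the Lipschitz property of I carries its covariance to nearby t.
    The error e has four quarters: covariance mismatch, score tail, block average, and all that is
    proportional to r = 1 / sqrt k. *)
Lemma lindeberg_uniform t0 (p : 'rV[R]_d -> R) (e : R) : Theta t0 -> smooth_test p -> 0 < e ->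
  exists (rho : R) (k0 : nat) (T : nat -> R), [/\ 0 < rho, [set t | `|t - t0| <= rho] `<=` Theta &
    forall k t, (k0 <= k)%N -> `|t - t0| <= rho ->
      `|Ex (P t) (fun w => p (DeltaK S g X k t w)) - T k| <= e].
Proof.
move=> Tt0 [B [G [H td]]] e0.
have B0 := td_B0 td; have C0 := C_gt0 Tt0; have Ig0 := noise_gt0 Tt0.
have cr0 : 0 <= @cst_rem R d B by exact: le_trans B0 (cst_rem_ge td).
pose b1 := 2^-1 * d%:R ^+ 2 * B.
have b10 : 0 <= b1 by rewrite /b1 !mulr_ge0// exprn_ge0.
pose b2 := @cst_rem R d B * (d%:R * (C / noise_info g)).
have b20 : 0 <= b2 by rewrite /b2 !mulr_ge0// ?invr_ge0 ltW.
(* Used twice with coefficient [b1]: as covariance mismatch and as the bound [dl] for block means.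
   Half of the mismatch is spent on sampling at [t0], half on the variation of I over the cube. *)
pose ic := e / (4 * (b1 + 1)).
have ic0 : 0 < ic by rewrite /ic divr_gt0//; lra.
have [N [bs [N0 hbs]]] := covariance_sample Tt0 (divr_gt0 ic0 (ltr0n R 2)).
have [r0 r00 r0T] := open_cube oT Tt0.
pose rho := Num.min r0 (ic / 2 / (L + 1)).
have L10 : 0 < L + 1 by rewrite ltr_wpDl.
have rho0 : 0 < rho by rewrite lt_min r00/= (divr_gt0 (divr_gt0 ic0 (ltr0n R 2)) L10).
have rhoT : [set t | `|t - t0| <= rho] `<=` Theta.
  by move=> t /= tr; apply: r0T => /=; rewrite (le_trans tr)// ge_min lexx.
have ib2 : 0 < e / (4 * (b2 + 1)) by rewrite divr_gt0// mulr_gt0// ltr_wpDl.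
have [A A0 tA] := tail_cvg Tt0 ib2.
have [m m0 hm] := block_uniform (@closed_cube_compact _ _ t0 rho) rhoT ic0.
pose c2 := 1 + 2 * C + 2 * C ^+ 2.
have c20 : 0 <= c2 by have := sqr_ge0 C; rewrite /c2; lra.
pose c1 := 1 + C.
pose Lc := A ^+ 3 * (1 + d%:R * (C / noise_info g ^+ 2)).
pose V := B * c2 * (d%:R * c1 + avg (fun i => `|bs i|)).
(* Coefficients of all terms that vanish with r; the last one enters with r^2 <= r. *)
pose W := @cst_rem R d B * Lc + @cst_rem R d B * avg (fun i => `|bs i| ^+ 3) +
  2^-1 * d%:R ^+ 2 * (m%:R * V) + 2^-1 * d%:R ^+ 2 * (m%:R * (B * c2)).
have [k0 _ hk0] := near_sqrt (Num.max 1 (4 * W / e)).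
exists rho, k0, (fun k => iter k (walk bs (Num.sqrt k%:R)^-1) p 0); split=> // k t kk tr.
have Tt := rhoT _ tr.
have := hk0 k kk; rewrite /= ge_max => /andP[k1 kW].
set r := (Num.sqrt k%:R)^-1.
have s0 : 0 < Num.sqrt k%:R :> R by apply: lt_le_trans k1.
have rp : 0 < r by rewrite invr_gt0.
have r1 : r <= 1 by rewrite invf_le1.
have kr : k%:R * r ^+ 2 = 1.
  by rewrite /r exprVn sqr_sqrtr// mulfV// pnatr_eq0 -lt0n -(ltr0n R) -sqrtr_gt0.
have rW : r * W <= e / 4.
  have : r * (4 * W) <= r * (Num.sqrt k%:R * e) by rewrite ler_pM2l// -ler_pdivrMr.
  have -> : r * (Num.sqrt k%:R * e) = e by rewrite mulrA /r mulVf ?mul1r// gt_eqF.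
  lra.
have icov a b : `|I t a b - walk_cov bs a b| <= ic.
  rewrite -[I t a b](subrK (I t0 a b)) -addrA (le_trans (ler_normD _ _))//.
  have h1 : `|I t a b - I t0 a b| <= ic / 2.
    have := norm_entry (I t - I t0) a b; rewrite mxE [X in _ + X]mxE => /le_trans; apply.
    apply: (le_trans (lipI Tt Tt0)); apply: (@le_trans _ _ ((L + 1) * rho)).
      by rewrite ler_pM// lerDl.
    by rewrite mulrC -ler_pdivlMr ?ge_min ?lexx ?orbT//; lra.
  by have := hbs a b; lra.
have C2 : C <= c1 ^+ 2 by rewrite /c1; nra.
have Llim := lindeberg (lam := fun r => d%:R * (C / noise_info g * noise_tail g A) + r * Lc)
  (_ : 0 <= c1) c20 (fun i j => (xit_L2 Tt i j).1) (fun i j => le_trans (xit_L2 Tt i j).2 C2)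
  (fun i k j => (qdt_L2 Tt i k j).1) (fun i k j => (qdt_centered_L2 Tt i k j).2)
  (fun h r j i M => @xit_mart _ Tt h r j i M) (fun h r j i k M => @xit_qdt _ Tt h r j i k M)
  (fun r j => @xit_min _ Tt A r j A0) td N0 icov k (ltW rp) m0 (ltW ic0)
  (fun j a b => hm t j a b tr).
rewrite (_ : (fun w => p (DeltaK S g X k t w)) = fun w => p (psum (xit t) r k w)); last first.
  by apply/funext => w; rewrite Delta_psum.
have {}Llim := Llim _; apply: le_trans (Llim _) _; first by rewrite /c1; lra.
rewrite kr !mul1r.
have -> : 2^-1 * d%:R ^+ 2 * r ^+ 2 * (k%:R * (m%:R * vcst c1 c2 B bs r + B * ic) + m%:R * (B * c2)) =
  2^-1 * d%:R ^+ 2 * (k%:R * r ^+ 2) * (m%:R * (r * V) + B * ic) + 2^-1 * d%:R ^+ 2 * (m%:R * (B * c2)) * r ^+ 2.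
  by rewrite /vcst /V; ring.
rewrite kr mulr1.
have q1 : b1 * ic <= e / 4 by exact: quarter_bound.
have q2 : b2 * noise_tail g A <= e / 4 by exact: quarter_bound.
have r2 : 2^-1 * d%:R ^+ 2 * (m%:R * (B * c2)) * r ^+ 2 <= 2^-1 * d%:R ^+ 2 * (m%:R * (B * c2)) * r.
  by rewrite ler_wpM2l ?mulr_ge0 ?exprn_ge0// expr2 ler_piMr// ltW.
move: q1 q2 r2 rW; rewrite /b1 /b2 /W.
set x1 := 2^-1 * d%:R ^+ 2 * (m%:R * (B * c2)); set x2 := avg _; set x3 := @cst_rem R d B.
set x4 := d%:R ^+ 2; set x5 := C / _; nra.
Qed.

Lemma Delta_equicontinuous t0 (p : 'rV[R]_d -> R) (e : R) : Theta t0 -> smooth_test p -> 0 < e ->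
  exists (rho : R) (k0 : nat), 0 < rho /\
    forall k t, (k0 <= k)%N -> `|t - t0| <= rho ->
      `|Ex (P t) (fun w => p (DeltaK S g X k t w)) -
        Ex (P t0) (fun w => p (DeltaK S g X k t0 w))| <= e.
Proof.
move=> Tt0 sp e0; have [rho [k0 [T [rho0 _ h]]]] := lindeberg_uniform Tt0 sp (divr_gt0 e0 (ltr0n R 2)).
exists rho, k0; split=> // k t kk tr.
have h1 := h k t kk tr; have h2 : `|t0 - t0| <= rho by rewrite subrr normr0 ltW.
have {}h2 := h k t0 kk h2.
set x := Ex _ _ in h1 *; set y := Ex _ _ in h2 *.
have -> : x - y = (x - T k) - (y - T k) by ring.
by rewrite (le_trans (ler_normB _ _))//; lra.
Qed.

Local Notation K0 := (d%:R / c).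

(** Pathwise: where score, information fluctuation and mean of [R3] are at most M, the error of a
    Newton step has the form K (|u| + sqrt k |u|^2) that [two_newton_steps] iterates. *)
Lemma onestep_bound t u w k (M : R) : (forall t', `|t' - t| <= `|u| -> Theta t') ->
  (0 < k)%N -> `|DeltaK S g X k t w| <= M -> `|info_fluct k t w| <= M ->
  k%:R^-1 * \sum_(l < k) R3 (X l w) (X l.+1 w) <= M ->
  `|Num.sqrt k%:R *: (onestep P S g X k (t + u) w - t) - DeltaK S g X k t w *m invmx (I t)|
  <= K0 * (d%:R * L + d%:R * M + d%:R ^+ 2 * M + d%:R * (K0 * M * L)) *
     (`|u| + Num.sqrt k%:R * `|u| ^+ 2).
Proof.
move=> Tu k0 DM QM RM.
have Tt : Theta t by apply: Tu; rewrite subrr normr0.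
have Ttu : Theta (t + u) by apply: Tu; rewrite addrAC subrr add0r.
have M0 : 0 <= M by exact: le_trans (normr_ge0 _) DM.
have K00 : 0 <= K0 by rewrite divr_ge0// ltW.
set q := Num.sqrt k%:R.
have q0 : 0 < q by rewrite sqrtr_gt0 ltr0n.
have qq : q ^+ 2 = k%:R by rewrite sqr_sqrtr.
pose D := DeltaK S g X k t w; pose D' := DeltaK S g X k (t + u) w.
(* Transposed because expanding the i-th score contracts u with the column index of [dl2]. *)
pose Q := (info_fluct k t w)^T.
pose r := D' - D - u *m Q + q *: (u *m I t).
have rE i : r 0 i = q^-1 * \sum_(l < k) (dl1 S g (t + u) (X l w) (X l.+1 w) 0 i -
    dl1 S g t (X l w) (X l.+1 w) 0 i - \sum_j u 0 j * dl2 S g t (X l w) (X l.+1 w) i j).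
  have e1 : D' 0 i = q^-1 * \sum_(l < k) dl1 S g (t + u) (X l w) (X l.+1 w) 0 i.
    by rewrite /D' /DeltaK (sum_pairs (fun x y => dl1 S g (t + u) x y)) mxE summxE.
  have e2 : D 0 i = q^-1 * \sum_(l < k) dl1 S g t (X l w) (X l.+1 w) 0 i.
    by rewrite /D /DeltaK (sum_pairs (fun x y => dl1 S g t x y)) mxE summxE.
  have e3 : (u *m Q) 0 i = q^-1 * \sum_(l < k) \sum_j u 0 j * dl2 S g t (X l w) (X l.+1 w) i j +
     q * \sum_j u 0 j * I t i j.
    rewrite mxE exchange_big /= !mulr_sumr -big_split/=; apply: eq_bigr => j _.
    rewrite [Q _ _]mxE info_fluctE -/q big_split /= sumr_const card_ord -[I t i j *+ k]mulr_natl -qq.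
    rewrite (_ : \sum_(l < k) u 0 j * _ = u 0 j * \sum_(l < k) qdt t i j l w).
      by field; rewrite gt_eqF.
    by rewrite mulr_sumr.
  have e4 : (u *m I t) 0 i = \sum_j u 0 j * I t i j.
    by rewrite mxE; apply: eq_bigr => j _; rewrite -[in LHS](fisher_sym t) [in LHS]mxE.
  have -> : r 0 i = D' 0 i - D 0 i - (u *m Q) 0 i + q * (u *m I t) 0 i.
    by rewrite /r !(mxE, scalemxAl).
  rewrite e1 e2 e3 e4 !sumrB; ring.
have rb : `|r| <= q * (d%:R ^+ 2 * M * `|u| ^+ 2).
  apply: norm_le_entries => [|z i]; first by rewrite !mulr_ge0 ?exprn_ge0// ltW.
  rewrite [z]ord1 rE normrM gtr0_norm ?invr_gt0// ler_pdivrMl// mulrA -expr2 qq.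
  apply: (le_trans (ler_norm_sum _ _ _)).
  apply: (@le_trans _ _ (\sum_(l < k) d%:R ^+ 2 * R3 (X l w) (X l.+1 w) * `|u| ^+ 2)).
    apply: ler_sum => l _.
    apply: (dl1_taylor oT hS gpos hg) => // t' i' j' k' tu.
    by have [_ _] := hR (X l w) (X l.+1 w) (Tu _ tu); apply.
  rewrite -mulr_suml -mulr_sumr [leRHS]mulrA ler_wpM2r ?exprn_ge0// [leRHS]mulrCA ler_wpM2l ?exprn_ge0//.
  by move: RM; rewrite ler_pdivrMl ?ltr0n.
have dI : `|I (t + u) - I t| <= L * `|u|.
  by apply: (le_trans (lipI Ttu Tt)); rewrite [t + u]addrC addrK.
have QM' : `|Q| <= M.
  apply: norm_le_entries => // i j; rewrite mxE; exact: le_trans (norm_entry _ _ _) QM.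
have D'E : D' = D + u *m Q - q *: (u *m I t) + r.
  have gen (x y v z : 'rV[R]_d) : x = y + v - z + (x - y - v + z).
    by apply/rowP => i; rewrite !mxE; ring.
  exact: gen.
have step := onestep_expansion q0 (fisher_unit Tt) (fisher_unit Ttu) K00
  (fun v => fisher_invmx Tt v) (fun v => fisher_invmx Ttu v) D'E.
have -> : onestep P S g X k (t + u) w - t = u + q^-1 *: (D' *m invmx (I (t + u))).
  by rewrite /onestep addrAC [t + u]addrC addrK [u + t]addrC.
apply: (le_trans step); rewrite -[leRHS]mulrA ler_wpM2l//.
have u0 := normr_ge0 u; have d0 : 0 <= d%:R :> R by [].
set U := `|u| in step rb dI u0 *.
have t1 : q * (d%:R * (U * `|I (t + u) - I t|)) <= d%:R * L * (q * U ^+ 2).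
  rewrite (_ : d%:R * L * (q * U ^+ 2) = q * (d%:R * (U * (L * U)))); last by ring.
  by rewrite ler_pM2l// ler_wpM2l// ler_wpM2l.
have t2 : d%:R * (U * `|Q|) <= d%:R * M * U.
  by rewrite -[leRHS]mulrA ler_wpM2l// [leRHS]mulrC ler_wpM2l.
have t4 : d%:R * (K0 * `|D| * `|I (t + u) - I t|) <= d%:R * (K0 * M * L) * U.
  rewrite -[leRHS]mulrA ler_wpM2l// -[leRHS]mulrA; apply: ler_pM => //.
    exact: mulr_ge0.
  exact: ler_wpM2l.
have s1 : 0 <= d%:R * L * U by rewrite !mulr_ge0.
have s2 : 0 <= d%:R * M * (q * U ^+ 2) by rewrite !mulr_ge0 ?exprn_ge0// ltW.
have s3 : 0 <= d%:R ^+ 2 * M * U by rewrite !mulr_ge0 ?exprn_ge0.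
have k0ml : 0 <= K0 * M * L by apply: mulr_ge0 => //; exact: mulr_ge0.
have s4 : 0 <= d%:R * (K0 * M * L) * (q * U ^+ 2).
  by apply: mulr_ge0; apply: mulr_ge0 => //; [exact: ltW|exact: sqr_ge0].
have -> : (d%:R * L + d%:R * M + d%:R ^+ 2 * M + d%:R * (K0 * M * L)) * (U + q * U ^+ 2) =
  d%:R * L * (q * U ^+ 2) + d%:R * M * U + q * (d%:R ^+ 2 * M * U ^+ 2) + d%:R * (K0 * M * L) * U +
  (d%:R * L * U + d%:R * M * (q * U ^+ 2) + d%:R ^+ 2 * M * U + d%:R * (K0 * M * L) * (q * U ^+ 2)) by ring.
apply: ler_wpDr; first by rewrite !addr_ge0.
by rewrite !lerD.
Qed.

Variables (est : nat -> (nat -> R) -> 'rV[R]_d) (delta s : R).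
Hypothesis mest : forall N (i : 'I_d),
  measurable_fun setT (fun w => est N (fun j => X j w) 0 i).
Definition est_error (N : nat) (t : 'rV[R]_d) (w : Omega) : 'rV[R]_d :=
  Num.sqrt N%:R *: (est N (fun j => X j w) - t).
Hypothesis tight1 : tight_unif_compacts Theta P est_error.
Hypothesis delta4 : 1 / 4 < delta.
Hypothesis s01 : 0 < s <= 1.

Definition scaled_error (n : nat) (t : 'rV[R]_d) (w : Omega) : 'rV[R]_d :=
  Num.sqrt (kidx s n)%:R *: (two_step P S g X est delta s n w - t).

Lemma measurable_est_error N t : measurable_fun setT (fun w => `|est_error N t w|).
Proof.
apply: measurable_mxnorm => i k; rewrite [i]ord1.
rewrite (_ : (fun w => _) = fun w => Num.sqrt N%:R * (est N (fun j => X j w) 0 k - t 0 k)).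
  by apply: measurable_funM => //; apply: measurable_funB.
by apply/funext => w; rewrite mxE [X in _ * X]mxE [X in _ + X]mxE.
Qed.

Lemma Delta_entry k t w i :
  DeltaK S g X k t w 0 i = (Num.sqrt k%:R)^-1 * \sum_(l < k) xit t i l w.
Proof. by rewrite /DeltaK (sum_pairs (fun x y => dl1 S g t x y)) mxE summxE. Qed.

Lemma measurable_Delta k t i : Theta t -> measurable_fun setT (fun w => DeltaK S g X k t w 0 i).
Proof.
move=> Tt; rewrite (_ : (fun w => _) = fun w => (Num.sqrt k%:R)^-1 * \sum_(l < k) xit t i l w).
  by apply: measurable_funM => //; have [[]] := xit_sum_Ex2 Tt i k.
by apply/funext => w; rewrite Delta_entry.
Qed.

Lemma markov_tail (p : probability Omega R) (F : Omega -> R) (D e : R) : L1 p F ->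
  (forall w, 0 <= F w) -> Ex p F <= D -> 0 < e ->
  (p [set w | (D / e + 1 < F w)%R] <= e%:E)%E.
Proof.
move=> LF F0 FD e0; have D0 : 0 <= D by exact: le_trans (Ex_ge0 _ F0) FD.
have M0 : 0 < D / e + 1 by rewrite ltr_wpDl// divr_ge0// ltW.
apply: (le_trans (Ex_markov LF F0 M0)); rewrite lee_fin ler_pdivrMr//.
by rewrite (le_trans FD)// mulrDr mulr1 mulrCA mulfV ?gt_eqF// mulr1 lerDl ltW.
Qed.

(** Orthogonality of the score increments bounds second moments by C uniformly in k and t, which a
    central limit theorem at each t does not. The extra 1 passes from the norm to its square: z > 1
    + y gives z^2 > y. *)
Lemma Delta_tight k t (e : R) : Theta t -> 0 < e ->
  (P t [set w | (1 + (d%:R * C / e + 1) < `|DeltaK S g X k t w|)%R] <= e%:E)%E.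
Proof.
move=> Tt e0; have C0 := C_gt0 Tt.
pose F w := \sum_i DeltaK S g X k t w 0 i ^+ 2.
have LF i : L2 (P t) (fun w => DeltaK S g X k t w 0 i) /\
    Ex (P t) (fun w => DeltaK S g X k t w 0 i ^+ 2) <= C.
  have [l1 h1] := xit_sum_Ex2 Tt i k.
  have E : (fun w => DeltaK S g X k t w 0 i) = fun w => (Num.sqrt k%:R)^-1 * \sum_(l < k) xit t i l w.
    by apply/funext => w; rewrite Delta_entry.
  rewrite E; split; first exact: L2Z.
  rewrite (@eq_Ex _ _ _ _ _ (fun w => (Num.sqrt k%:R)^-1 ^+ 2 * (\sum_(l < k) xit t i l w) ^+ 2)); last first.
    by move=> w; rewrite Delta_entry exprMn.
  rewrite ExZ; last exact: l1.2.
  rewrite exprVn sqr_sqrtr//; have [->|k0] := posnP k; first by rewrite invr0 mul0r ltW.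
  by rewrite ler_pdivrMl ?ltr0n.
have F0 w : 0 <= F w by apply: sumr_ge0 => i _; exact: sqr_ge0.
have LFs : L1 (P t) F by apply: L1_sum => i _; exact: (LF i).1.2.
have EF : Ex (P t) F <= d%:R * C.
  rewrite Ex_sum => [|i]; last exact: (LF i).1.2.
  apply: (@le_trans _ _ (\sum_(i < d) C)); first by apply: ler_sum => i _; exact: (LF i).2.
  by rewrite sumr_const card_ord -[leLHS]mulr_natl.
apply: le_trans (markov_tail LFs F0 EF e0); apply: le_measure; rewrite ?inE.
- rewrite -[X in measurable X]setTI; apply: measurable_fun_ltr => //.
  by apply: measurable_mxnorm => i j; rewrite [i]ord1; exact: measurable_Delta.
- by rewrite -[X in measurable X]setTI; apply: measurable_fun_ltr => //; exact: L1_meas LFs.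
move=> w /= h.
have M0 : 0 <= d%:R * C / e by rewrite !mulr_ge0// ?invr_ge0 ltW.
have : `|DeltaK S g X k t w| ^+ 2 <= F w.
  rewrite -[leRHS]sqr_sqrtr// lerXn2r ?nnegrE ?sqrtr_ge0//; exact: norm_enorm.
apply: lt_le_trans; move: h M0; set x := `|_|; set y := _ / e; nra.
Qed.

Lemma R3_ge0 t x x' : Theta t -> 0 <= R3 x x'.
Proof. by move=> Tt; have [_ _ h] := hR x x' Tt; exact: le_trans (h i0 i0 i0). Qed.

Lemma R3_tight k t (e : R) : Theta t -> 0 < e ->
  (P t [set w | ((1 + C) / e + 1 < k%:R^-1 * \sum_(l < k) R3 (X l w) (X l.+1 w))%R] <= e%:E)%E.
Proof.
move=> Tt e0; have C0 := C_gt0 Tt.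
have h l : L2 (P t) (fun w => R3 (X l w) (X l.+1 w)) /\
    Ex (P t) (fun w => R3 (X l w) (X l.+1 w) ^+ 2) <= C.
  have [_ _ m1] := mR (ltn0Sn l); have [_ _ e1] := ER Tt (ltn0Sn l).
  by apply: (dominated_L2 m1 m1) e1 => w; rewrite ger0_norm//; exact: R3_ge0 Tt.
have L1R l : L1 (P t) (fun w => R3 (X l w) (X l.+1 w)) by exact: L2_L1 (h l).1.
apply: markov_tail => //.
- by apply: L1Z; apply: L1_sum.
- move=> w; rewrite mulr_ge0 ?invr_ge0// sumr_ge0// => l _; exact: R3_ge0 Tt.
rewrite ExZ; last exact: L1_sum.
rewrite Ex_sum//.
have [->|k0] := posnP k; first by rewrite invr0 mul0r addr_ge0// ltW.
rewrite ler_pdivrMl ?ltr0n//.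
apply: (@le_trans _ _ (\sum_(l < k) (1 + C))); last by rewrite sumr_const card_ord -[leLHS]mulr_natl.
apply: ler_sum => l _.
apply: (@le_trans _ _ (Ex (P t) (fun w => 1 + R3 (X l w) (X l.+1 w) ^+ 2))).
  apply: Ex_le => //; first by apply: L1D; [exact: L1c|exact: (h l).1.2].
  move=> w; have := sqr_ge0 (R3 (X l w) (X l.+1 w) - 1); set x := R3 _ _; nra.
by rewrite ExD; [rewrite Exc lerD2l; exact: (h l).2|exact: L1c|exact: (h l).1.2].
Qed.

(** The order of the quantifiers matters: M depends on [ep] only, so a test function can be fitted
    on the cube of radius M before the accuracy [ec] is chosen. The event A is built from measurable
    bounds; the estimator enters only through a pathwise inequality on A. *)
Lemma remainder t0 : Theta t0 -> exists rho : R,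
  [/\ 0 < rho, [set t | `|t - t0| <= rho] `<=` Theta &
   forall ep : R, 0 < ep -> exists2 M : R, 0 <= M &
   forall ec : R, 0 < ec -> \forall n \near \oo, forall t, `|t - t0| <= rho ->
   exists A : set Omega, [/\ measurable A, (P t (~` A) <= ep%:E)%E &
     forall w, A w -> `|DeltaK S g X (kidx s n) t w| <= M /\
       `|scaled_error n t w - DeltaK S g X (kidx s n) t w *m invmx (I t)| <= ec]].
Proof.
move=> Tt0; have [r r0 rT] := open_cube oT Tt0.
have C0 := C_gt0 Tt0; have K00 : 0 <= K0 by rewrite divr_ge0// ltW.
have K1T : [set t | `|t - t0| <= r / 2] `<=` Theta.
  by move=> t /= tr; apply: rT => /=; lra.
exists (r / 2); split=> [||ep ep0]; [by rewrite divr_gt0|exact: K1T|].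
pose e4 := ep / 4; have e40 : 0 < e4 by rewrite divr_gt0.
have cK := @closed_cube_compact _ _ t0 (r / 2).
have [M1 [M10 tM1]] := tight1 cK K1T e40.
have [M3 [M30 tM3]] := tight2 cK K1T e40.
pose M2 := 1 + (d%:R * C / e4 + 1); pose M4 := (1 + C) / e4 + 1.
have M20 : 0 <= M2 by rewrite !addr_ge0// divr_ge0 ?mulr_ge0// ltW.
have M40 : 0 <= M4 by rewrite addr_ge0// divr_ge0 ?addr_ge0// ltW.
pose M := M1 + M2 + M3 + M4.
have M0 : 0 <= M by rewrite /M; lra.
exists M => // ec ec0.
pose K1 := K0 * (d%:R * L + d%:R * M + d%:R ^+ 2 * M + d%:R * (K0 * M * L)).
have K10 : 0 <= K1.
  apply: mulr_ge0 => //; apply: addr_ge0; last first.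
    by apply: mulr_ge0 => //; apply: mulr_ge0 => //; exact: mulr_ge0.
  apply: addr_ge0; last by apply: mulr_ge0 => //; exact: exprn_ge0.
  by apply: addr_ge0; exact: mulr_ge0.
have Cn0 : 0 <= M + K0 * M by rewrite addr_ge0// mulr_ge0.
(* The bound r / 2 keeps the intermediate estimate in the cube where derivatives are controlled; the
   threshold for a is lowered next, for the same reason at the preliminary estimate. *)
have e0 : 0 < Num.min ec (r / 2) by rewrite lt_min ec0 divr_gt0.
have [h h0 newton] := two_newton_steps K10 Cn0 e0.
have M10' : 0 < M + 1 by rewrite ltr_wpDl.
have h'0 : 0 < Num.min h (r / 2 / (M + 1)) by rewrite lt_min h0 !divr_gt0.
pose b := (Num.min h (r / 2 / (M + 1)))^-1.
have b0 : 0 < b by rewrite invr_gt0.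
have [k1 _ hk1] := near_sqrt h^-1.
have delta0 : 0 < delta by apply: lt_trans delta4; lra.
have s0 : 0 < s by case/andP: s01.
near=> n.
have k0 : (0 < kidx s n)%N by near: n; exact: near_kidx.
have bN : b ^+ 2 <= ((Nsize delta n)%:R : R) by near: n; exact: near_Nsize.
have k1k : (k1 <= kidx s n)%N by near: n; exact: near_kidx.
have qhN : Num.sqrt (kidx s n)%:R <= h * (Nsize delta n)%:R ^+ 2 by near: n; exact: near_sqrt_kidx.
move=> t tr; have Tt := K1T _ tr.
move: k0 bN k1k qhN; set k := kidx s n; set N := Nsize delta n.
move=> k0 bN k1k qhN.
pose A := [set w | `|est_error N t w| <= M] `&` [set w | `|DeltaK S g X k t w| <= M] `&`
  [set w | `|info_fluct k t w| <= M] `&`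
  [set w | k%:R^-1 * \sum_(l < k) R3 (X l w) (X l.+1 w) <= M].
exists A.
have mle (f : Omega -> R) : measurable_fun setT f -> measurable [set w | f w <= M].
  by move=> mf; rewrite -[X in measurable X]setTI; exact: measurable_fun_ler.
have mlt (f : Omega -> R) : measurable_fun setT f -> measurable [set w | M < f w].
  by move=> mf; rewrite -[X in measurable X]setTI; exact: measurable_fun_ltr.
have m1 := measurable_est_error N t.
have m2 : measurable_fun setT (fun w => `|DeltaK S g X k t w|).
  by apply: measurable_mxnorm => i j; rewrite [i]ord1; exact: measurable_Delta.
have m3 := measurable_info_fluct k Tt.
have m4 : measurable_fun setT (fun w => k%:R^-1 * \sum_(l < k) R3 (X l w) (X l.+1 w)).
  apply: measurable_funM => //; apply: measurable_sum => l.
  by have [_ _] := mR (ltn0Sn l).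
split.
- by apply: measurableI; [apply: measurableI; [apply: measurableI|]|]; exact: mle.
- have pb (f : Omega -> R) (M' : R) : measurable_fun setT f -> M' <= M ->
      (P t [set w | (M' < f w)%R] <= e4%:E)%E -> (P t [set w | (M < f w)%R] <= e4%:E)%E.
    move=> mf MM; apply: le_trans; apply: le_measure; rewrite ?inE; [exact: mlt| |].
      by rewrite -[X in measurable X]setTI; exact: measurable_fun_ltr.
    by move=> w /=; exact: le_lt_trans.
  have cE (f : Omega -> R) : ~` [set w | f w <= M] = [set w | M < f w].
    by apply/seteqP; split => w /=; [move/negP; rewrite -ltNge|rewrite ltNge => /negP].
  rewrite /A !setCI !cE.
  apply: (le_trans (measureU2 (P t) _ _)) => /=; [by apply: measurableU; [apply: measurableU|]; exact: mlt|exact: mlt|].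
  apply: (@le_trans _ _ (e4 + e4 + e4 + e4)%:E); last by rewrite lee_fin /e4; lra.
  rewrite !EFinD; apply: leeD; last first.
    by apply: pb m4 _ (R3_tight _ Tt e40); rewrite /M /M4; lra.
  apply: (le_trans (measureU2 (P t) _ _)) => /=; [by apply: measurableU; exact: mlt|exact: mlt|].
  apply: leeD; last by apply: pb m3 _ (tM3 _ _ tr); rewrite /M; lra.
  apply: (le_trans (measureU2 (P t) _ _)) => /=; [exact: mlt|exact: mlt|].
  apply: leeD; first by apply: pb m1 _ (tM1 _ _ tr); rewrite /M; lra.
  by apply: pb m2 _ (Delta_tight _ Tt e40); rewrite /M /M2; lra.
move=> w [[[/= A1 A2] A3] A4]; split=> //.
pose q : R := Num.sqrt k%:R.
have q0 : 0 < q by rewrite sqrtr_gt0 ltr0n.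
have bs : b <= Num.sqrt N%:R.
  by rewrite -[b]ger0_norm ?(ltW b0)// -sqrtr_sqr ler_wsqrtr.
(* The order of the preliminary error; q a^4 is then sqrt k / N^2. *)
pose a : R := (Num.sqrt N%:R)^-1.
have sN0 : 0 < (Num.sqrt N%:R : R) by exact: lt_le_trans bs.
have a0 : 0 < a by rewrite invr_gt0.
have ab : a <= Num.min h (r / 2 / (M + 1)) by rewrite -[leRHS]invrK lef_pV2.
have [ah ar] : a <= h /\ a <= r / 2 / (M + 1) by apply/andP; rewrite -le_min.
have qh : q^-1 <= h.
  rewrite -[h]invrK lef_pV2 ?posrE ?invr_gt0//; exact: hk1.
have qa : q * a ^+ 4 <= h.
  have -> : a ^+ 4 = (N%:R ^+ 2)^-1.
    by rewrite /a exprVn (exprM _ 2 2) sqr_sqrtr.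
  by rewrite ler_pdivrMr// exprn_gt0// -sqrtr_gt0.
pose u0 := est N (fun j => X j w) - t.
have u0M : `|u0| <= M * a.
  rewrite -ler_pdivrMr// invrK mulrC -[X in X * _](gtr0_norm sN0) -normrZ; exact: A1.
have u0r : `|u0| <= r / 2.
  apply: (le_trans u0M); move: ar; rewrite ler_pdivlMr// => ar.
  by apply: le_trans ar; rewrite mulrDr mulr1 mulrC lerDl ltW.
have cube (v : 'rV[R]_d) : `|v| <= r / 2 -> forall t', `|t' - t| <= `|v| -> Theta t'.
  move=> vr t' tt'; apply: rT => /=.
  rewrite (_ : t' - t0 = (t' - t) + (t - t0)); last by rewrite addrA subrK.
  by apply: (le_trans (ler_normD _ _)); move: tr; rewrite /=; lra.
pose th2 := onestep P S g X k (t + u0) w; pose u1 := th2 - t.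
have b1 := onestep_bound (cube _ u0r) k0 A2 A3 A4; rewrite -/q -/th2 -/u1 -/K1 in b1.
have qu1 : q * `|u1| <= (M + K0 * M) + `|q *: u1 - DeltaK S g X k t w *m invmx (I t)|.
  rewrite -[q](gtr0_norm q0) -normrZ.
  rewrite -[X in `|X| <= _](subrK (DeltaK S g X k t w *m invmx (I t))).
  rewrite (gtr0_norm q0) addrC; apply: (le_trans (ler_normD _ _)); rewrite lerD2r.
  apply: (le_trans (fisher_invmx Tt _)); apply: (@le_trans _ _ (K0 * M)).
    by rewrite ler_wpM2l.
  by rewrite lerDr.
have [] := newton a q `|u0| `|u1| _ (K1 * (`|u1| + q * `|u1| ^+ 2)) _ q0 qh qa _ _ b1 qu1 (lexx _) => //.
- by rewrite a0 ah.
- rewrite normr_ge0/=; apply: (le_trans u0M); rewrite ler_wpM2r ?(ltW a0)// lerDl; exact: mulr_ge0.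
rewrite !le_min => /andP[_ u1r] /andP[bound _].
have b2 := onestep_bound (cube _ u1r) k0 A2 A3 A4; rewrite -/q -/K1 in b2.
apply: le_trans bound; apply: le_trans b2; rewrite le_eqVlt; apply/orP; left; apply/eqP.
rewrite /scaled_error -/k -/q /two_step -/k /prelim -/N.
have -> : est N (fun j => X j w) = t + u0 by rewrite /u0 addrC subrK.
by rewrite -/th2 /u1 [t + (th2 - t)]addrC subrK.
Unshelve. all: by end_near. Qed.

End Model.

(** * Locally uniform convergence *)

Lemma sup_diff {R : realType} {T : Type} (B : set T) (a b : T -> R) (M e : R) :
  B !=set0 -> (forall t, B t -> `|a t| <= M) -> (forall t, B t -> `|b t| <= M) ->
  (forall t, B t -> `|a t - b t| <= e) ->
  `|sup [set a t | t in B] - sup [set b t | t in B]| <= e.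
Proof.
move=> B0.
suff h (u v : T -> R) : (forall t, B t -> `|v t| <= M) ->
    (forall t, B t -> `|u t - v t| <= e) ->
    sup [set u t | t in B] - sup [set v t | t in B] <= e.
  move=> aM bM ab; rewrite ler_norml h// andbT lerNl opprB h// => t Bt.
  by rewrite distrC ab.
move=> vM uv; rewrite lerBlDr; apply: ge_sup.
  by case: B0 => t Bt; exists (u t); exists t.
move=> _ [t Bt <-].
have vs : v t <= sup [set v t | t in B].
  apply: ub_le_sup; last by exists t.
  by exists M => _ [t' Bt' <-]; exact: le_trans (ler_norm _) (vM _ Bt').
by have := le_trans (ler_norm _) (uv t Bt); lra.
Qed.

Lemma ler_dist3 {R : realType} (x y z w e : R) : `|x - y| <= e / 3 -> `|y - z| <= e / 3 ->
  `|z - w| <= e / 3 -> `|x - w| <= e.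
Proof.
move=> h1 h2 h3; rewrite (_ : x - w = (x - y) + (y - z) + (z - w)); last by ring.
rewrite (le_trans (ler_normD _ _))//.
have := ler_normD (x - y) (y - z); lra.
Qed.

Section Limits.
Context {R : realType} {d : nat} {dO : measure_display} {Omega : measurableType dO}.
Variables (Theta : set 'rV[R]_d) (P : 'rV[R]_d -> probability Omega R).
Variables (D Z : nat -> 'rV[R]_d -> Omega -> 'rV[R]_d) (I : 'rV[R]_d -> 'M[R]_d) (K0 L : R).
Hypothesis oT : open Theta.
Hypothesis mD : forall n t i, Theta t -> measurable_fun setT (fun w => D n t w 0 i).
Hypotheses (K00 : 0 <= K0) (L0 : 0 <= L).
Hypothesis unitI : forall t, Theta t -> I t \in unitmx.
Hypothesis normVI : forall t (v : 'rV[R]_d), Theta t -> `|v *m invmx (I t)| <= K0 * `|v|.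
Hypothesis lipI : forall t1 t2, Theta t1 -> Theta t2 -> `|I t1 - I t2| <= L * `|t1 - t2|.
Hypothesis remainder : forall t0, Theta t0 -> exists rho : R,
  [/\ 0 < rho, [set t | `|t - t0| <= rho] `<=` Theta &
   forall ep : R, 0 < ep -> exists2 M : R, 0 <= M &
   forall ec : R, 0 < ec -> \forall n \near \oo, forall t, `|t - t0| <= rho ->
   exists A : set Omega, [/\ measurable A, (P t (~` A) <= ep%:E)%E &
     forall w, A w -> `|D n t w| <= M /\ `|Z n t w - D n t w *m invmx (I t)| <= ec]].
Hypothesis equicontinuity : forall t0 (p : 'rV[R]_d -> R) (e : R), Theta t0 -> smooth_test p ->
  0 < e -> exists2 rho : R, 0 < rho & \forall n \near \oo, forall t, `|t - t0| <= rho ->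
    `|Ex (P t) (fun w => p (D n t w)) - Ex (P t0) (fun w => p (D n t0 w))| <= e.
Hypothesis clt : forall t, Theta t -> cvg_dist_normal (P t) (fun n => D n t) (I t).

(** The sandwich with empty event: it says nothing about the value, but makes the expectation of any
    bounded function finite. *)
Lemma expectation_bounded (p : probability Omega R) (F : Omega -> R) (M : R) :
  (forall w, `|F w| <= M) -> expectation p F = (Ex p F)%:E.
Proof.
move=> FM; have M0 : 0 <= M by exact: le_trans (normr_ge0 _) (FM point).
have [fin _] := @expectation_sandwich _ _ _ p F (cst 0) set0 M 0 (measurable_cst _)
  measurable0 FM (fun w => eq_ind _ (fun x => x <= M) M0 _ (esym (normr0 R)))
  (fun w (h : set0 w) => False_ind _ h) (lexx 0).
by rewrite fineK.
Qed.

Lemma measurable_test n t p : Theta t -> smooth_test p -> measurable_fun setT (fun w => p (D n t w)).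
Proof.
move=> Tt [B [G [H td]]]; have := td_mf td (fun i => mD n i Tt).
congr (measurable_fun _ _); apply/funext => w; congr p; apply/rowP => i; by rewrite mxE.
Qed.

Variables (f : 'rV[R]_d -> R) (Mf : R).
Hypotheses (cf : continuous f) (fM : forall x, `|f x| <= Mf).

Let Mf0 : 0 <= Mf. Proof. exact: le_trans (normr_ge0 _) (fM 0). Qed.

Lemma continuous_mulmx (B : 'M[R]_d) : continuous (fun x : 'rV[R]_d => f (x *m B)).
Proof.
move=> x A /cf /nbhs_ballP[e /= e0 eA].
have c0 : 0 <= d%:R * `|B| by rewrite mulr_ge0.
have c1 : 0 < d%:R * `|B| + 1 by rewrite ltr_wpDl.
apply/nbhs_ballP; exists (e / (d%:R * `|B| + 1)) => /=; first by rewrite divr_gt0.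
move=> y; rewrite -ball_normE /= ltr_pdivlMr// => h.
apply: eA; rewrite -ball_normE /= -mulmxBl.
apply: (le_lt_trans (norm_mulmx _ _)); rewrite mulrCA; apply: le_lt_trans h.
by rewrite ler_wpM2l// lerDl.
Qed.

(** [p] approximates f (x I(t0)^-1) on the cube of radius M. Freezing I at [t0] keeps [p] the same
    for all t, as [equicontinuity] demands; the price is |D| times the change of the inverse, small
    with rho. The second inequality is what the central limit theorem at [t0] is combined with. *)
Lemma smooth_replacement t0 (e : R) : Theta t0 -> 0 < e -> exists (rho : R) (p : 'rV[R]_d -> R),
  [/\ 0 < rho, [set t | `|t - t0| <= rho] `<=` Theta, smooth_test p &
   \forall n \near \oo, forall t, `|t - t0| <= rho ->
     `|Ex (P t) (fun w => f (Z n t w)) - Ex (P t) (fun w => p (D n t w))| <= e /\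
     `|Ex (P t) (fun w => f (D n t w *m invmx (I t0))) - Ex (P t) (fun w => p (D n t w))| <= e].
Proof.
move=> Tt0 e0; have [rho1 [rho10 rT rem]] := remainder Tt0.
have ep0 : 0 < e / (16 * (Mf + 1)) by rewrite divr_gt0// mulr_gt0// ltr_wpDl.
have [M M0 remM] := rem _ ep0.
have e8 : 0 < e / 8 by rewrite divr_gt0.
have [dl dl0 heine] := continuous_unif_bounded (K0 * M) cf e8.
have [p [sp pM fp]] := smooth_approx M (@continuous_mulmx (invmx (I t0))) (fun x => fM _) e8.
pose c1 := K0 * (d%:R * (K0 * M * L)).
have c10 : 0 <= c1 by rewrite /c1 !mulr_ge0.
have dl2 : 0 < dl / 2 by rewrite divr_gt0.
pose rho := Num.min rho1 (dl / 2 / (c1 + 1)).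
have c11 : 0 < c1 + 1 by rewrite ltr_wpDl.
have rho0 : 0 < rho by rewrite lt_min rho10 (divr_gt0 dl2 c11).
have rr1 t : `|t - t0| <= rho -> `|t - t0| <= rho1.
  by move=> h; rewrite (le_trans h)// ge_min lexx.
exists rho, p; split=> // [t /= tr|]; first by apply: rT; exact: rr1.
have [n0 _ hn] := remM _ dl2; exists n0 => // n /hn {}hn t tr.
have Tt : Theta t by apply: rT; exact: rr1.
have [A [mA PA hA]] := hn t (rr1 _ tr).
(* The sandwich then costs 2 (e / 4) + e / 4, which is below e. *)
have fPA : 4 * Mf * fine (P t (~` A)) <= e / 4.
  have h : fine (P t (~` A)) <= e / (16 * (Mf + 1)).
    by rewrite -lee_fin fineK// fin_num_measure//; exact: measurableC.
  have := quarter_bound Mf0 e0 (y := 4 * fine (P t (~` A))).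
  have -> : e / (4 * (Mf + 1)) = 4 * (e / (16 * (Mf + 1))).
    by field; rewrite gt_eqF// ltr_wpDl.
  by rewrite ler_pM2l// => /(_ h); rewrite mulrCA mulrA.
have mp := measurable_test n Tt sp.
have sandwich (F : Omega -> R) : (forall w, `|F w| <= Mf) ->
    (forall w, A w -> `|F w - p (D n t w)| <= e / 4) ->
    `|Ex (P t) F - Ex (P t) (fun w => p (D n t w))| <= e.
  move=> FM Fp; have e4 : 0 <= e / 4 by rewrite ltW// divr_gt0.
  have [_ h] := expectation_sandwich (P t) mp mA FM (fun w => pM _) Fp e4.
  by apply: (le_trans h); lra.
split; apply: sandwich => // w Aw; have [DM ZD] := hA w Aw; last first.
  by apply: (le_trans (fp _ DM)); lra.
set x := D n t w in DM ZD *.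
have xZ : `|x *m invmx (I t0) - Z n t w| <= dl.
  (* The resolvent identity for the difference of two inverses. *)
  have V : x *m invmx (I t) - x *m invmx (I t0) =
     (x *m invmx (I t0)) *m (I t0 - I t) *m invmx (I t).
    by rewrite mulmxBr mulmxKV ?unitI// mulmxBl mulmxK ?unitI.
  have VI : `|x *m invmx (I t) - x *m invmx (I t0)| <= dl / 2.
    rewrite V; apply: (le_trans (normVI _ Tt)).
    apply: (@le_trans _ _ (c1 * rho)).
      rewrite /c1 -[leRHS]mulrA ler_wpM2l// -[leRHS]mulrA.
      apply: (le_trans (norm_mulmx _ _)); rewrite ler_wpM2l// -[leRHS]mulrA.
      apply: ler_pM => //.
        by apply: (le_trans (normVI _ Tt0)); rewrite ler_wpM2l.
      by apply: (le_trans (lipI Tt0 Tt)); rewrite distrC ler_wpM2l.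
    apply: (@le_trans _ _ ((c1 + 1) * rho)).
      by rewrite ler_wpM2r ?(ltW rho0)// lerDl.
    by rewrite mulrC -ler_pdivlMr// ge_min lexx orbT.
  rewrite distrC -[Z n t w](subrK (x *m invmx (I t))) -addrA.
  by apply: (le_trans (ler_normD _ _)); lra.
have fx := heine (x *m invmx (I t0)) (Z n t w) _ xZ.
have {fx} : `|f (x *m invmx (I t0)) - f (Z n t w)| <= e / 8.
  by apply: fx; apply: (le_trans (normVI _ Tt0)); rewrite ler_wpM2l.
have := fp _ DM; rewrite distrC => h1 h2.
have -> : f (Z n t w) - p x = (f (x *m invmx (I t0)) - p x) - (f (x *m invmx (I t0)) - f (Z n t w)) by ring.
by rewrite distrC in h1; apply: (le_trans (ler_normB _ _)); lra.
Qed.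

Local Notation e_ n t := (Ex (P t) (fun w => f (Z n t w))).
Local Notation Gamma t := (gauss_E (invmx (I t)) f).

Lemma mean_equicontinuous t0 (e : R) : Theta t0 -> 0 < e -> exists rho : R,
  [/\ 0 < rho, [set t | `|t - t0| <= rho] `<=` Theta &
   \forall n \near \oo, forall t, `|t - t0| <= rho -> `|e_ n t - e_ n t0| <= e].
Proof.
move=> Tt0 e0; have e3 : 0 < e / 3 by rewrite divr_gt0.
have [rho1 [p [r1 rT sp h1]]] := smooth_replacement Tt0 e3.
have [rho2 r2 h2] := equicontinuity Tt0 sp e3.
exists (Num.min rho1 rho2); split; first by rewrite lt_min r1.
  by move=> t /= tr; apply: rT; rewrite /= (le_trans tr)// ge_min lexx.
near=> n => t; rewrite le_min => /andP[t1 t2].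
have t00 : `|t0 - t0| <= rho1 by rewrite subrr normr0 ltW.
have hn1 : forall t, `|t - t0| <= rho1 ->
     `|e_ n t - Ex (P t) (fun w => p (D n t w))| <= e / 3 /\
     `|Ex (P t) (fun w => f (D n t w *m invmx (I t0))) - Ex (P t) (fun w => p (D n t w))| <= e / 3.
  by near: n; exact: h1.
have hn2 : forall t, `|t - t0| <= rho2 ->
  `|Ex (P t) (fun w => p (D n t w)) - Ex (P t0) (fun w => p (D n t0 w))| <= e / 3.
  by near: n; exact: h2.
have [a1 _] := hn1 _ t1; have [a2 _] := hn1 _ t00; have a3 := hn2 _ t2.
by apply: (ler_dist3 a1 a3); rewrite distrC.
Unshelve. all: by end_near. Qed.

(** If a Gaussian vector has covariance I, its image under I^-1 has covariance I^-1. At the level of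
    square roots this is [msqrt_invmx], and the two iterated integrals have the same integrand. *)
Lemma gauss_invmx t : Theta t ->
  gauss_E (I t) (fun x => f (x *m invmx (I t))) = Gamma t.
Proof.
move=> Tt; rewrite /gauss_E; congr std_gauss_E; apply/funext => z.
by rewrite -mulmxA msqrt_invmx// unitI.
Qed.

Lemma mean_cvg t (e : R) : Theta t -> 0 < e -> \forall n \near \oo, `|e_ n t - Gamma t| <= e.
Proof.
move=> Tt e0; have e3 : 0 < e / 3 by rewrite divr_gt0.
have [rho [p [r0 rT sp h1]]] := smooth_replacement Tt e3.
have [|_ /cvgrPdist_le/(_ _ e3) h2] := (fine_cvgP _ _).1
  (clt Tt (@continuous_mulmx (invmx (I t))) _); first by exists Mf.
rewrite gauss_invmx// in h2.
near=> n.
have t0 : `|t - t| <= rho by rewrite subrr normr0 ltW.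
have : forall t', `|t' - t| <= rho ->
     `|e_ n t' - Ex (P t') (fun w => p (D n t' w))| <= e / 3 /\
     `|Ex (P t') (fun w => f (D n t' w *m invmx (I t))) - Ex (P t') (fun w => p (D n t' w))| <= e / 3.
  by near: n; exact: h1.
move=> /(_ _ t0)[a1 a2].
have a3 : `|Gamma t - Ex (P t) (fun w => f (D n t w *m invmx (I t)))| <= e / 3.
  by near: n; exact: h2.
have {}a2 : `|Ex (P t) (fun w => p (D n t w)) - Ex (P t) (fun w => f (D n t w *m invmx (I t)))| <= e / 3.
  by rewrite distrC.
by apply: (ler_dist3 a1 a2); rewrite distrC.
Unshelve. all: by end_near. Qed.

Lemma expectation_cvg t : Theta t ->
  (fun n => expectation (P t) (f \o Z n t)) @ \oo --> (Gamma t)%:E.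
Proof.
move=> Tt; apply/fine_cvgP; split.
  by apply: nearW => n; rewrite (expectation_bounded (P t) (fun w => fM (Z n t w))).
apply/cvgrPdist_le => e e0; have := mean_cvg Tt e0; apply: filterS => n.
by rewrite distrC.
Qed.

(** Continuity is inherited from the equicontinuous means that converge to [Gamma]; the Gaussian
    integral itself is never estimated. *)
Lemma Gamma_continuous t0 (e : R) : Theta t0 -> 0 < e -> exists2 rho : R, 0 < rho &
  forall t, `|t - t0| <= rho -> `|Gamma t - Gamma t0| <= e.
Proof.
move=> Tt0 e0; have e3 : 0 < e / 3 by rewrite divr_gt0.
have [rho [r0 rT h1]] := mean_equicontinuous Tt0 e3.
exists rho => // t tr; have Tt := rT _ tr.
have [n [] [] a1 a2 a3] : exists n, (`|e_ n t - Gamma t| <= e / 3 /\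
    `|e_ n t0 - Gamma t0| <= e / 3) /\ `|e_ n t - e_ n t0| <= e / 3.
  have h2 := mean_cvg Tt e3; have h3 := mean_cvg Tt0 e3.
  near \oo => n; exists n; split; first by split; near: n.
  by near: n; apply: filterS h1 => n; apply.
by apply: (ler_dist3 _ a3 a2); rewrite distrC.
Unshelve. all: by end_near. Qed.

Lemma mean_cvg_uniform (K : set 'rV[R]_d) (e : R) : compact K -> K `<=` Theta -> 0 < e ->
  \forall n \near \oo, forall t, K t -> `|e_ n t - Gamma t| <= e.
Proof.
move=> /compact_near_coveringP cK KT e0.
apply: (cK nat \oo (fun n t => `|e_ n t - Gamma t| <= e)) => t0 Kt0.
have Tt0 := KT _ Kt0; have e3 : 0 < e / 3 by rewrite divr_gt0.
have [rho1 [r1 _ h1]] := mean_equicontinuous Tt0 e3.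
have [rho2 r2 h2] := Gamma_continuous Tt0 e3.
have h3 := mean_cvg Tt0 e3.
exists ([set t | `|t - t0| <= rho1 /\ `|t - t0| <= rho2],
   [set n | (forall t, `|t - t0| <= rho1 -> `|e_ n t - e_ n t0| <= e / 3) /\
            `|e_ n t0 - Gamma t0| <= e / 3]).
  split => /=; last by near=> n; split; near: n.
  apply/nbhs_ballP; exists (Num.min rho1 rho2) => /=; first by rewrite lt_min r1.
  move=> t; rewrite -ball_normE /= distrC lt_min => /andP[/ltW ? /ltW ?]; by split.
move=> [t n] /= [[t1 t2] [a1 a2]].
have {}a1 := a1 _ t1; have a3 := h2 _ t2.
by apply: (ler_dist3 a1 a2); rewrite distrC.
Unshelve. all: by end_near. Qed.

Lemma mean_bounded n t : `|e_ n t| <= 2 * Mf.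
Proof.
have [_] := expectation_sandwich (P t) (F := fun w => f (Z n t w)) (G := cst 0) (A := setT) (M := Mf) (e := Mf)
  (measurable_cst _) measurableT (fun w => fM _) (fun w => eq_ind _ (fun x => x <= Mf) Mf0 _ (esym (normr0 R)))
  (fun w _ => eq_ind _ (fun x => `|x| <= Mf) (fM _) _ (esym (subr0 _))) Mf0.
by rewrite setCT measure0 mulr0 addr0 Exc subr0.
Qed.

(** The inner limit is the supremum of the Gaussian means over the ball, available once the ball
    lies in [Theta], hence for rho near 0. Continuity at [t0] gives the outer limit. *)
Lemma sup_expectation_cvg t0 : Theta t0 -> exists lim_rho : R -> R,
  (\forall rho \near 0^'+,
    (fun n => ereal_sup [set expectation (P t) (fun w => f (Z n t w))
      | t in [set t | enorm (t - t0) < rho]]) @ \oo --> (lim_rho rho)%:E) /\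
  lim_rho rho @[rho --> 0^'+] --> Gamma t0.
Proof.
move=> Tt0; have [r r0 rT] := open_cube oT Tt0.
pose Bl rho := [set t | enorm (t - t0) < rho].
have Bt0 rho : 0 < rho -> Bl rho t0.
  move=> ?; rewrite /Bl /= (le_lt_trans (enorm_norm _))//.
  by rewrite subrr normr0 mulr0.
have Br rho t : Bl rho t -> `|t - t0| <= rho.
  by move=> /ltW; apply: le_trans; exact: norm_enorm.
have GM t : Theta t -> `|Gamma t| <= 2 * Mf + 1.
  move=> Tt; have [n _ /(_ n (leqnn n)) h] := mean_cvg Tt ltr01.
  rewrite -(subrK (e_ n t) (Gamma t)) (le_trans (ler_normD _ _))// [leRHS]addrC lerD//.
    by rewrite distrC.
  exact: mean_bounded.
exists (fun rho => sup [set Gamma t | t in Bl rho]); split.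
  near=> rho.
  have rho0 : 0 < rho by near: rho; exact: nbhs_right_gt.
  have rr : rho <= r by near: rho; exact: nbhs_right_le.
  have BT t : Bl rho t -> Theta t.
    by move=> /Br tr; apply: rT; exact: le_trans rr.
  have ne : Bl rho !=set0 by exists t0; exact: Bt0.
  have -> : (fun n => ereal_sup [set expectation (P t) (fun w => f (Z n t w)) | t in Bl rho]) =
      (fun n => (sup [set e_ n t | t in Bl rho])%:E).
    apply/funext => n; rewrite -ereal_sup_EFin.
    - congr ereal_sup; apply/seteqP; split => [_ [t Bt <-]|_ [_ [t Bt <-] <-]].
        by exists (e_ n t); [exists t|rewrite (expectation_bounded (P t) (fun w => fM (Z n t w)))].
      by exists t => //; rewrite (expectation_bounded (P t) (fun w => fM (Z n t w))).
    - by exists (2 * Mf) => _ [t Bt <-]; exact: le_trans (ler_norm _) (mean_bounded n t).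
    - by case: ne => t Bt; exists (e_ n t); exists t.
  apply/cvg_EFin; first exact: nearW.
  apply/cvgrPdist_le => e e0.
  have := mean_cvg_uniform (@closed_cube_compact _ _ t0 r) rT e0.
  apply: filterS => n hn; rewrite distrC; apply: (sup_diff (M := 2 * Mf + 1)) => // t Bt.
  - by rewrite (le_trans (mean_bounded n t))// lerDl.
  - by apply: GM; exact: BT.
  - by apply: hn; exact: le_trans (Br _ _ Bt) rr.
apply/cvgrPdist_le => e e0; have [rho1 r1 hG] := Gamma_continuous Tt0 e0.
near=> rho.
have rho0 : 0 < rho by near: rho; exact: nbhs_right_gt.
have rr : rho <= r by near: rho; exact: nbhs_right_le.
have rr1 : rho <= rho1 by near: rho; exact: nbhs_right_le.
have ne : Bl rho !=set0 by exists t0; exact: Bt0.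
have BT t : Bl rho t -> Theta t.
  by move=> /Br tr; apply: rT; exact: le_trans rr.
have G0 : Gamma t0 = sup [set Gamma t0 | t in Bl rho].
  rewrite (_ : [set _ | t in _] = [set Gamma t0]) ?sup1//.
  by apply/seteqP; split => [_ [t _ <-]|_ ->]//; exists t0 => //; exact: Bt0.
rewrite G0; apply: (sup_diff (M := 2 * Mf + 1)) => // t Bt.
- exact: GM.
- by apply: GM; exact: BT.
- by rewrite distrC; apply: hG; exact: le_trans (Br _ _ Bt) rr1.
Unshelve. all: by end_near. Qed.

End Limits.

Section DimensionZero.
Context {R : realType} {dO : measure_display} {Omega : measurableType dO}.
Variables (P : 'rV[R]_0 -> probability Omega R) (f : 'rV[R]_0 -> R).

Let f0 x : f x = f 0. Proof. by rewrite [x]thinmx0. Qed.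

Lemma expectation_dim0 t (Y : Omega -> 'rV[R]_0) : expectation (P t) (f \o Y) = (f 0)%:E.
Proof.
rewrite (_ : f \o Y = cst (f 0)); first exact: expectation_cst.
by apply/funext => w; exact: f0.
Qed.

Lemma gauss_E_dim0 Sigma : gauss_E Sigma f = f 0.
Proof. exact: f0. Qed.

End DimensionZero.

Unset Implicit Arguments.

Theorem theorem2 (R : realType) (d : nat) (dO : measure_display)
  (Omega : measurableType dO)
  (Theta : set 'rV[R]_d)
  (S : 'rV[R]_d -> R -> R) (g : R -> R)
  (P : 'rV[R]_d -> probability Omega R) (X : nat -> Omega -> R)
  (pi : 'rV[R]_d -> R -> R)
  (delta : R) (est : nat -> (nat -> R) -> 'rV[R]_d) :
  (* parameter set *)
  open Theta -> convex_set_rV Theta -> bounded_rV Theta ->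
  (* the model X_j = S(theta, X_{j-1}) + eps_j, eps_j iid with density g *)
  (forall j, measurable_fun setT (X j)) ->
  (forall t, Theta t -> measurable_fun setT (S t)) ->
  (forall t, Theta t ->
     mutually_independent (P t) (fun j => if j is 0 then X 0%N else eps S X t j)) ->
  (forall t j, Theta t -> (0 < j)%N -> has_density (P t) (eps S X t j) g) ->
  (* Condition R(1) *)
  (forall t, Theta t ->
     [/\ strictly_stationary (P t) X,
         has_density (P t) (X 0%N) (pi t) &
         forall mu : probability R R, kernel_invariant (S t) g mu ->
           forall B : set R, measurable B ->
             mu B = (\int[lebesgue_measure]_(y in B) (pi t y)%:E)%E]) ->
  (* Condition R(2): the preliminary estimator *)
  (1 / 4 < delta <= 1 / 2) ->
  (forall N x y, (forall j, (j <= N)%N -> x j = y j) -> est N x = est N y) ->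
  (forall N (i : 'I_d), measurable_fun setT (fun w => est N (fun j => X j w) 0 i)) ->
  tight_unif_compacts Theta P
    (fun N t w => Num.sqrt (N%:R) *: (est N (fun j => X j w) - t)) ->
  (* Condition R(3) *)
  (forall x, Ck_on 3 Theta (fun t => S t x)) ->
  (forall x, 0 < g x) -> Ck_R 3 g ->
  (exists (R1 R2 R3 : R -> R -> R) (C : R),
     (forall t x x', Theta t ->
        [/\ `|dl1 S g t x x'| <= R1 x x', `|dl2 S g t x x'| <= R2 x x' &
            forall i j k, `|dl3 S g t x x' i j k| <= R3 x x']) /\
     (forall j, (0 < j)%N ->
        [/\ measurable_fun setT (fun w => R1 (X j.-1 w) (X j w)),
            measurable_fun setT (fun w => R2 (X j.-1 w) (X j w)) &
            measurable_fun setT (fun w => R3 (X j.-1 w) (X j w))]) /\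
     (forall t j, Theta t -> (0 < j)%N ->
        [/\ (expectation (P t) (fun w => `|R1 (X j.-1 w) (X j w)| ^+ 2)%R < C%:E)%E,
            (expectation (P t) (fun w => `|R2 (X j.-1 w) (X j w)| ^+ 2)%R < C%:E)%E &
            (expectation (P t) (fun w => `|R3 (X j.-1 w) (X j w)| ^+ 2)%R < C%:E)%E])) ->
  (* Condition R(4): LLN, CLT, uniform tightness *)
  (forall t, Theta t ->
     cvg_in_prob (P t)
       (fun n w => (n%:R)^-1 *: \sum_(1 <= j < n.+1)
          ((dl1 S g t (X j.-1 w) (X j w))^T *m dl1 S g t (X j.-1 w) (X j w)))
       (fisher P X S g t)) ->
  (forall t, Theta t ->
     cvg_dist_normal (P t)
       (fun n w => (Num.sqrt (n%:R))^-1 *: \sum_(1 <= j < n.+1) dl1 S g t (X j.-1 w) (X j w))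
       (fisher P X S g t)) ->
  tight_unif_compacts Theta P
    (fun n t w => (Num.sqrt (n%:R))^-1 *:
       \sum_(1 <= j < n.+1) (dl2 S g t (X j.-1 w) (X j w) + fisher P X S g t)) ->
  (* Condition R(5) *)
  (exists L : R, forall t1 t2, Theta t1 -> Theta t2 ->
     `|fisher P X S g t1 - fisher P X S g t2| <= L * enorm (t1 - t2)) ->
  (exists c : R, 0 < c /\ forall t (lam : 'rV[R]_d), Theta t -> enorm lam = 1 ->
     c <= (lam *m fisher P X S g t *m lam^T) 0 0) ->
  (exists C : R, forall t (lam : 'rV[R]_d), Theta t -> enorm lam = 1 ->
     (lam *m fisher P X S g t *m lam^T) 0 0 <= C) ->
  (* conclusions *)
  (forall t, Theta t -> forall s : R, 0 < s <= 1 ->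
     cvg_dist_normal (P t)
       (fun n w => Num.sqrt ((kidx s n)%:R) *: (two_step P S g X est delta s n w - t))
       (invmx (fisher P X S g t)))
  /\
  (forall t0, Theta t0 -> forall s : R, 0 < s <= 1 ->
   forall W : 'rV[R]_d -> R, bounded_loss W ->
   exists lim_rho : R -> R,
     (\forall rho \near 0^'+,
        (fun n => ereal_sup [set expectation (P t)
              (fun w => W (Num.sqrt ((kidx s n)%:R) *: (two_step P S g X est delta s n w - t)))
            | t in [set t | enorm (t - t0) < rho]]) @ \oo --> (lim_rho rho)%:E) /\
     lim_rho rho @[rho --> 0^'+] -->
       std_gauss_E (fun z => W (z *m msqrt (invmx (fisher P X S g t0))))).

Proof.
move=> oT _ _ mX mS ind dens station /andP[delta4 _] _ mest tight1 hS gpos hg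
  [R1 [R2 [R3 [C [hR [mR ER]]]]]] lln clt tight2 [L' lipI'] [c [c0 nondeg]] _.
(* Without coordinates there is no [i0] on which to test nondegeneracy; on a one-point space both
   limits are those of constants. *)
case: (posnP d) => [d0|dp].
  subst d; split=> [t Tt s s01 f cf _|t0 Tt0 s s01 W _].
    rewrite (_ : (fun n => _) = fun=> (f 0)%:E); last first.
      by apply/funext => n; rewrite expectation_dim0.
    by rewrite gauss_E_dim0; exact: cvg_cst.
  exists (fun=> W 0); split; last first.
    by rewrite [std_gauss_E _](gauss_E_dim0 W); exact: cvg_cst.
  near=> rho.
  have rho0 : 0 < rho by near: rho; exact: nbhs_right_gt.
  rewrite (_ : (fun n => _) = fun=> (W 0)%:E); first exact: cvg_cst.
  apply/funext => n; rewrite (_ : [set _ | t in _] = [set (W 0)%:E]) ?ereal_sup1//.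
  apply/seteqP; split => [_ [t _ <-]|_ ->]; first by rewrite (expectation_dim0 P W).
  exists t0; last by rewrite (expectation_dim0 P W).
  by rewrite /= /enorm big_ord0 sqrtr0.
pose i0 := Ordinal dp.
(* The factor d pays for passing from the Euclidean to the maximum norm; the absolute value makes
   the constant nonnegative. *)
pose L := `|L'| * d%:R.
have L0 : 0 <= L by rewrite mulr_ge0.
have lipI t1 t2 : Theta t1 -> Theta t2 ->
    `|fisher P X S g t1 - fisher P X S g t2| <= L * `|t1 - t2|.
  move=> T1 T2; apply: (le_trans (lipI' _ _ T1 T2)).
  apply: (@le_trans _ _ (`|L'| * enorm (t1 - t2))).
    by rewrite ler_wpM2r ?sqrtr_ge0// ler_norm.
  by rewrite -mulrA ler_wpM2l// enorm_norm.
have K00 : 0 <= d%:R / c by rewrite divr_ge0// ltW.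
have stat t : Theta t -> strictly_stationary (P t) X by case/station.
have limits s : 0 < s <= 1 -> (forall f : 'rV[R]_d -> R, continuous f ->
   (exists M : R, forall x, `|f x| <= M) ->
   (forall t, Theta t -> (fun n => expectation (P t) (f \o scaled_error S g P X est delta s n t)) @ \oo -->
     (gauss_E (invmx (fisher P X S g t)) f)%:E) /\
   (forall t0, Theta t0 -> exists lim_rho : R -> R,
     (\forall rho \near 0^'+,
       (fun n => ereal_sup [set expectation (P t) (fun w => f (scaled_error S g P X est delta s n t w))
         | t in [set t | enorm (t - t0) < rho]]) @ \oo --> (lim_rho rho)%:E) /\
     lim_rho rho @[rho --> 0^'+] --> gauss_E (invmx (fisher P X S g t0)) f)).
  move=> s01; have s0 : 0 < s by case/andP: s01.
  move=> f cf [M fM].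
  have mD n t i : Theta t -> measurable_fun setT (fun w => DeltaK S g X (kidx s n) t w 0 i).
    exact: (measurable_Delta oT mX mS ind dens hS gpos hg hR mR ER c0 nondeg i0 _ (t := t) i).
  have rm := remainder oT mX mS ind dens hS gpos hg hR mR ER c0 nondeg i0 tight2 L0 lipI
    mest tight1 delta4 s01.
  (* The assumed central limit theorem is used along k = [s n], which tends to infinity as s > 0. *)
  have kinf : kidx s n @[n --> \oo] --> \oo.
    by apply/cvgnyPge => A; exact: near_kidx.
  have eq t0 (p : 'rV[R]_d -> R) (e : R) : Theta t0 -> smooth_test p -> 0 < e ->
      exists2 rho : R, 0 < rho & \forall n \near \oo, forall t, `|t - t0| <= rho ->
      `|Ex (P t) (fun w => p (DeltaK S g X (kidx s n) t w)) -
        Ex (P t0) (fun w => p (DeltaK S g X (kidx s n) t0 w))| <= e.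
    move=> Tt0 sp e0; have [rho [k0 [r0 h]]] := Delta_equicontinuous oT mX mS ind dens stat hS gpos hg
      hR mR ER c0 nondeg i0 tight2 lln L0 lipI Tt0 sp e0.
    exists rho => //; near=> n => t tr; apply: h => //; near: n; exact: near_kidx.
  have cl t : Theta t -> cvg_dist_normal (P t) (fun n => DeltaK S g X (kidx s n) t) (fisher P X S g t).
    move=> Tt h ch bh; have := clt t Tt h ch bh => hc.
    exact: (cvg_comp _ _ kinf hc).
  split => t Tt.
    exact: (expectation_cvg mD K00 L0 (fun t => @fisher_unit _ _ _ _ _ _ _ _ _ _ c0 nondeg t)
      (fun t v Tt => fisher_invmx c0 nondeg Tt v) lipI rm cl cf fM Tt).
  exact: (sup_expectation_cvg oT mD K00 L0 (fun t => @fisher_unit _ _ _ _ _ _ _ _ _ _ c0 nondeg t)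
      (fun t v Tt => fisher_invmx c0 nondeg Tt v) lipI rm eq cl cf fM Tt).
split=> [t Tt s s01 f cf bf|t0 Tt0 s s01 W [_ [W0 [_ [cW [_ [M WM]]]]]]].
  by have [h _] := limits s s01 f cf bf; exact: h.
have bW : exists M : R, forall x, `|W x| <= M by exists M => x; rewrite ger0_norm.
by have [_ h] := limits s s01 W cW bW; exact: h.
Unshelve. all: by end_near. Qed.
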